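(* Let $r\ge2$ and let $A_1,\dots,A_r$, $A_i=R_i/\mathfrak a_i$ with $\mathfrak a_i\subseteq(\mathbf x_i)^2$, be oriented standard graded Artinian Gorenstein $K$-algebras with $\operatorname{reg}(A_\ell)=e\ge3$ for all $1\le\ell\le r$. Let $N=\dim Q$ and let $L=\sum_{1\le i\ne j\le r}\mathbf x_i\cap\mathbf x_j\subset Q$. Then for all integers $t\ge0$ and $s$ there is an isomorphism of $K$-vector spaces $$[\operatorname{Tor}_t^Q(A_1\#_K\cdots\#_K A_r,K)]_s\cong\begin{cases}0&\text{if } s\le t\text{ and }(t,s)\ne(0,0),\\ K&\text{if }(t,s)=(0,0),\\ \bigoplus_{i=1}^r[\operatorname{Tor}_t^Q(A_i,K)]_{t+1}\oplus[\operatorname{Tor}_t^Q(Q/L,K)]_{t+1}&\text{if } s=t+1,\\ \bigoplus_{i=1}^r[\operatorname{Tor}_t^Q(A_i,K)]_s&\text{if } t+2\le s\le t+e-2,\\ \bigoplus_{i=1}^r[\operatorname{Tor}_t^Q(A_i,K)]_s\oplus[\operatorname{Tor}_{N-t}^Q(Q/L,K)]_{N-t+1}&\text{if } s=t+e-1,\\ K&\text{if }(t,s)=(N,e+N),\\ 0&\text{if } s\ge e+t\text{ and }(t,s)\ne(N,e+N).\end{cases}$$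
   Context: $K$ is an arbitrary field. For $i=1,\dots,r$, $R_i=K[x_{i,1},\dots,x_{i,n_i}]$ ($n_i\ge1$) is a standard graded polynomial ring with irrelevant ideal $\mathbf x_i=(x_{i,1},\dots,x_{i,n_i})$, $\mathfrak a_i\subset R_i$ is homogeneous, and $Q=R_1\otimes_K\cdots\otimes_K R_r$, a polynomial ring in $N=n_1+\cdots+n_r$ variables. The symbols $\mathbf x_i,\mathfrak a_i$ also denote the extended ideals in $Q$. Each $A_i$ is a $Q$-module via $A_i\cong Q/(\mathfrak a_i+\sum_{j\ne i}\mathbf x_j)$. $\operatorname{Tor}$ in negative homological index is zero. A graded Artinian $K$-algebra $A$ is Gorenstein (AG) if its socle is one-dimensional; its socle degree, the largest $d$ with $A_d\ne0$, equals $\operatorname{reg}(A)$. An orientation of $A_i$ is a non-zero graded linear map $f_i:A_i\to K(-e)$; $K$ is oriented by the identity. The Thom class of the projection $\pi_i:A_i\to K$ is the unique $\tau_i\in(A_i)_e$ with $f_i(\tau_i)=1$. The fiber product is $A_1\times_K\cdots\times_K A_r=\{(a_1,\dots,a_r)\in A_1\oplus\cdots\oplus A_r\mid\pi_i(a_i)=\pi_j(a_j)\ \forall i,j\}$, and the connected sum is $A_1\#_K\cdots\#_K A_r=(A_1\times_K\cdots\times_K A_r)/\langle(\tau_1,0,\dots,0,\tau_i,0,\dots,0)\mid2\le i\le r\rangle$ ($\tau_i$ in position $i$), a quotient of $Q$. *)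

(* Defs.v *)
From HB Require Import structures.
From mathcomp Require Import all_boot all_order all_algebra.
From mathcomp Require Import boolp.
From mathcomp Require Export ring_quotient.
From mathcomp Require Export mpoly.

Set Implicit Arguments.
Unset Strict Implicit.
Unset Printing Implicit Defensive.

Import GRing.Theory.
Local Open Scope ring_scope.
Local Open Scope quotient_scope.

(* Submodules are bundled as [submodClosed V]; arbitrary (undecidable)
   conditions are turned into boolean predicates with [asbool]. *)

Section Modules.
Variable R : pzRingType.

Section Quotient.
Variables (V : lmodType R) (S : submodClosed V).

(* [submodClosed] does not inherit from the [zmodClosed] expected by
   [Quotient.quot]. *)
Definition zpred : {pred V} := [pred x | x \in S].
Lemma zpred_zmod : zmod_closed zpred.
Proof. exact: (GRing.submod_closedB (GRing.submodClosedP S)). Qed.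
HB.instance Definition _ := GRing.isZmodClosed.Build V zpred zpred_zmod.

Definition quo := Quotient.quot zpred.
HB.instance Definition _ := GRing.Zmodule.on quo.
HB.instance Definition _ := EqQuotient.on quo.
HB.instance Definition _ := ZmodQuotient.on quo.

Definition quo_scale (a : R) : quo -> quo :=
  lift_op1 quo ( *:%R a).

Lemma pi_quo_scale a (x : V) : quo_scale a (\pi_quo x) = \pi_quo (a *: x).
Proof.
rewrite /quo_scale; unlock; apply/eqP.
rewrite -Quotient.idealrBE -scalerBr; apply: (@rpredZ _ _ S).
by have -> : (repr (\pi_quo x) - x \in S) = (repr (\pi_quo x) - x \in zpred);
  rewrite // Quotient.idealrBE reprK.
Qed.

Let Q_ind (P : quo -> Prop) : (forall x, P (\pi_quo x)) -> forall x, P x.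
Proof. by move=> h x; rewrite -[x]reprK. Qed.

Lemma quo_scaleA a b x : quo_scale a (quo_scale b x) = quo_scale (a * b) x.
Proof. by elim/Q_ind: x => x; rewrite !pi_quo_scale scalerA. Qed.
Lemma quo_scale1 : left_id 1 quo_scale.
Proof. by elim/Q_ind=> x; rewrite pi_quo_scale scale1r. Qed.
Lemma quo_scaleDr : right_distributive quo_scale +%R.
Proof.
move=> a; elim/Q_ind=> x; elim/Q_ind=> y.
by rewrite -raddfD !pi_quo_scale scalerDr raddfD.
Qed.
Lemma quo_scaleDl x : {morph quo_scale^~ x : a b / a + b}.
Proof. by elim/Q_ind: x => x a b /=; rewrite !pi_quo_scale scalerDl raddfD. Qed.

HB.instance Definition _ := GRing.Zmodule_isLmodule.Build R quo
  quo_scaleA quo_scale1 quo_scaleDr quo_scaleDl.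
End Quotient.

Section Sub.
Variables (V : lmodType R) (S : submodClosed V).
Definition submod := {x : V | x \in S}.
HB.instance Definition _ := SubChoice.on submod.
HB.instance Definition _ := [SubChoice_isSubLmodule of submod by <:].
End Sub.

Section Span.
Variables (V : lmodType R) (X : V -> Prop).
(* The smallest submodule containing X. *)
Definition span : {pred V} := [pred x |
  `[< forall U : submodClosed V, (forall y, X y -> y \in U) -> x \in U >]].
Lemma span_submod : submod_closed span.
Proof.
split=> [|a x y]; first by apply/asboolP=> U _; exact: rpred0.
move=> /asboolP Sx /asboolP Sy; apply/asboolP=> U XU.
by rewrite rpredD ?rpredZ ?Sx ?Sy.
Qed.
HB.instance Definition _ := GRing.isSubmodClosed.Build R V span span_submod.
End Span.

(* The subquotient Z / (Z :&: B). *)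
Section Subquotient.
Variables (V : lmodType R) (Z B : submodClosed V).
Definition trace_pred : {pred submod Z} := [pred x | val x \in B].
Lemma trace_submod : submod_closed trace_pred.
Proof.
split=> [|a x y]; rewrite !inE ?raddf0 ?rpred0 // => Bx By.
by rewrite linearP rpredD ?rpredZ.
Qed.
HB.instance Definition _ :=
  GRing.isSubmodClosed.Build R (submod Z) trace_pred trace_submod.
Definition subquotient : lmodType R := quo trace_pred.
End Subquotient.

Section DirectSum.
Variables (I : finType) (T : I -> lmodType R).
Definition dsum := {dffun forall i, T i}.
HB.instance Definition _ := Choice.on dsum.
Implicit Types f g h : dsum.
Definition dsum_zero : dsum := [ffun i => 0 : T i].
Definition dsum_opp f : dsum := [ffun i => - f i].
Definition dsum_add f g : dsum := [ffun i => f i + g i].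
Definition dsum_scale (a : R) f : dsum := [ffun i => a *: f i].
Fact dsum_addA : associative dsum_add.
Proof. by move=> f g h; apply/ffunP=> i; rewrite !ffunE addrA. Qed.
Fact dsum_addC : commutative dsum_add.
Proof. by move=> f g; apply/ffunP=> i; rewrite !ffunE addrC. Qed.
Fact dsum_add0 : left_id dsum_zero dsum_add.
Proof. by move=> f; apply/ffunP=> i; rewrite !ffunE add0r. Qed.
Fact dsum_addN : left_inverse dsum_zero dsum_opp dsum_add.
Proof. by move=> f; apply/ffunP=> i; rewrite !ffunE addNr. Qed.
HB.instance Definition _ :=
  GRing.isZmodule.Build dsum dsum_addA dsum_addC dsum_add0 dsum_addN.
Fact dsum_scaleA a b f : dsum_scale a (dsum_scale b f) = dsum_scale (a * b) f.
Proof. by apply/ffunP=> i; rewrite !ffunE scalerA. Qed.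
Fact dsum_scale1 : left_id 1 dsum_scale.
Proof. by move=> f; apply/ffunP=> i; rewrite !ffunE scale1r. Qed.
Fact dsum_scaleDr : right_distributive dsum_scale +%R.
Proof. by move=> a f g; apply/ffunP=> i; rewrite !ffunE scalerDr. Qed.
Fact dsum_scaleDl f : {morph dsum_scale^~ f : a b / a + b}.
Proof. by move=> a b; apply/ffunP=> i; rewrite !ffunE scalerDl. Qed.
HB.instance Definition _ := GRing.Zmodule_isLmodule.Build R dsum
  dsum_scaleA dsum_scale1 dsum_scaleDr dsum_scaleDl.
End DirectSum.

Definition oplus (U V : lmodType R) : lmodType R := (U * V)%type.

Definition isomorphic (U V : lmodType R) : Prop :=
  exists f : {linear U -> V}, bijective f.

End Modules.

(* Restriction of scalars along f : R -> S. *)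
Definition restr (R S : pzRingType) (f : {rmorphism R -> S})
  (V : lmodType S) : Type := V.

Section Restriction.
Variables (R S : pzRingType) (f : {rmorphism R -> S}) (V : lmodType S).
Local Notation restr := (restr f V).
HB.instance Definition _ := GRing.Zmodule.on restr.
Definition restr_scale (a : R) (x : restr) : restr := f a *: (x : V).
Fact restr_scaleA a b x : restr_scale a (restr_scale b x) = restr_scale (a * b) x.
Proof. by rewrite /restr_scale scalerA rmorphM. Qed.
Fact restr_scale1 : left_id 1 restr_scale.
Proof. by move=> x; rewrite /restr_scale rmorph1 scale1r. Qed.
Fact restr_scaleDr : right_distributive restr_scale +%R.
Proof. by move=> a x y; rewrite /restr_scale scalerDr. Qed.
Fact restr_scaleDl x : {morph restr_scale^~ x : a b / a + b}.
Proof. by move=> a b; rewrite /restr_scale rmorphD scalerDl. Qed.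
HB.instance Definition _ := GRing.Zmodule_isLmodule.Build R restr
  restr_scaleA restr_scale1 restr_scaleDr restr_scaleDl.
End Restriction.

Section Graded.
Variables (K : fieldType) (n : nat).
Local Notation Q := {mpoly K[n]}.

Definition vect (M : lmodType Q) : lmodType K := restr (@mpolyC n K) M.

(* A Q-module with its family of homogeneous components [M]_d, d : int.  All
   the instances below are built from homogeneous data; that M is the direct
   sum of the [M]_d is not part of the record. *)
Record gmod := GMod {
  gm_car :> lmodType Q;
  gm_hom : int -> submodClosed (vect gm_car)
}.

Definition form (d : int) : {pred vect Q^o} :=
  [pred p : Q | if d is Posz k then p \is k.-homog else p == 0].

Lemma form_submod d : submod_closed (form d).
Proof.
case: d => d; split=> [|c p q]; rewrite !inE /=; rewrite ?dhomog0 //.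
  by move=> hp hq; rewrite rpredD // [_ *: _]mul_mpolyC rpredZ.
by move=> /eqP-> /eqP->; rewrite scaler0 addr0.
Qed.
HB.instance Definition _ d := GRing.isSubmodClosed.Build K (vect Q^o)
  (form d) (form_submod d).

Definition greg : gmod :=
  @GMod Q^o (fun d => form d : submodClosed (vect Q^o)).

Lemma gm_hom_lin (M : gmod) d (c : K) (x y : M) :
  x \in gm_hom M d -> y \in gm_hom M d -> c%:MP *: x + y \in gm_hom M d.
Proof.
by case: (submodClosedP (gm_hom M d)) => _; apply.
Qed.

Section GradedSub.
Variables (M : gmod) (S : submodClosed M).
Definition gsub_hom (d : int) : {pred vect (submod S)} :=
  [pred x | (val x : M) \in gm_hom M d].
Lemma gsub_hom_submod d : submod_closed (gsub_hom d).
Proof.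
split=> [|c x y]; rewrite !inE ?raddf0 ?(rpred0 (gm_hom M d)) // => hx hy.
have -> : val (c *: x + y) = c%:MP *: (val x : M) + val y.
  exact: (linearP (val : submod S -> M) c%:MP x y).
exact: gm_hom_lin.
Qed.
HB.instance Definition _ d := GRing.isSubmodClosed.Build K (vect (submod S))
  (gsub_hom d) (gsub_hom_submod d).
Definition gsub : gmod :=
  @GMod (submod S) (fun d => gsub_hom d : submodClosed (vect (submod S))).
End GradedSub.

Section GradedQuotient.
Variables (M : gmod) (S : submodClosed M).
Definition gquo_hom (d : int) : {pred vect (quo S)} :=
  [pred x | `[< exists2 y : M, y \in gm_hom M d & x = \pi_(quo S) y >]].
Lemma gquo_hom_submod d : submod_closed (gquo_hom d).
Proof.
split=> [|c x y].
  by apply/asboolP; exists 0; rewrite ?raddf0 ?(rpred0 (gm_hom M d)).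
move=> /asboolP[x' hx ->] /asboolP[y' hy ->]; apply/asboolP.
exists (c *: (x' : vect M) + y'); first exact: gm_hom_lin.
by rewrite raddfD /= -pi_quo_scale.
Qed.
HB.instance Definition _ d := GRing.isSubmodClosed.Build K (vect (quo S))
  (gquo_hom d) (gquo_hom_submod d).
Definition gquo : gmod :=
  @GMod (quo S) (fun d => gquo_hom d : submodClosed (vect (quo S))).
End GradedQuotient.

Section GradedSum.
Variables (I : finType) (T : I -> gmod).
Definition gdsum_hom (d : int) : {pred vect (dsum T)} :=
  [pred x : dsum T | [forall i, x i \in gm_hom (T i) d]].
Lemma gdsum_hom_submod d : submod_closed (gdsum_hom d).
Proof.
split=> [|c x y]; rewrite !inE.
  by apply/forallP=> i; rewrite ffunE (rpred0 (gm_hom (T i) d)).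
move=> /forallP hx /forallP hy; apply/forallP=> i; rewrite !ffunE.
exact: gm_hom_lin.
Qed.
HB.instance Definition _ d := GRing.isSubmodClosed.Build K (vect (dsum T))
  (gdsum_hom d) (gdsum_hom_submod d).
Definition gdsum : gmod :=
  @GMod (dsum T) (fun d => gdsum_hom d : submodClosed (vect (dsum T))).
End GradedSum.

(* x = (x_1, ..., x_n) *)
Definition irrelevant : {pred Q^o} :=
  span (fun p : Q^o => exists k, p = 'X_k).
HB.instance Definition _ := GRing.SubmodClosed.on irrelevant.

Definition irrelevant2 : {pred Q^o} :=
  span (fun p : Q^o => exists u v : Q,
    [/\ u \in irrelevant, v \in irrelevant & p = u * v]).
HB.instance Definition _ := GRing.SubmodClosed.on irrelevant2.

Definition homogeneous (a : submodClosed Q^o) : Prop :=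
  forall (p : Q) d, p \in a -> pihomog [measure of mdeg] d p \in a.

(* Q/a is a cyclic Q-module, so the ideals of the ring Q/a are its
   Q-submodules. *)
Definition artinian (M : gmod) : Prop :=
  forall I : nat -> submodClosed M,
    (forall k, {subset I k.+1 <= I k}) ->
    exists m, forall k, (m <= k)%N -> {subset I m <= I k}.

(* The annihilator of the irrelevant ideal. *)
Section Socle.
Variable M : gmod.
Definition socle : {pred vect M} :=
  [pred x | `[< forall p : Q, p \in irrelevant -> p *: (x : M) = 0 >]].
Lemma socle_submod : submod_closed socle.
Proof.
split=> [|c x y]; first by apply/asboolP=> p _; rewrite scaler0.
move=> /asboolP hx /asboolP hy; apply/asboolP=> p hp.
rewrite scalerDr hy // addr0 scalerA mulrC -scalerA hx ?scaler0 //.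
Qed.
HB.instance Definition _ := GRing.isSubmodClosed.Build K (vect M)
  socle socle_submod.
End Socle.
Arguments socle M : clear implicits.

Definition gorenstein (M : gmod) : Prop :=
  artinian M /\ isomorphic (submod (socle M)) (K^o : lmodType K).

(* A non-zero graded K-linear map M -> K(-e). *)
Definition orientation (M : gmod) (e : nat) (f : {linear vect M -> K^o}) :=
  (exists x, f x != 0) /\
  (forall (d : int) x, d != e%:Z -> x \in gm_hom M d -> f x = 0).

Definition thom_class (M : gmod) (e : nat) (f : {linear vect M -> K^o})
  (tau : M) := tau \in gm_hom M e%:Z /\ f tau = 1.

(* The projection Q/a -> K; it is independent of the representative when a is
   contained in the irrelevant ideal. *)
Definition proj (a : submodClosed Q^o) (x : gquo (M := greg) a) : K :=
  (repr (x : quo a) : Q)@_0%MM.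

Section Proj.
Variable a : submodClosed Q^o.
Hypothesis a2 : {subset a <= irrelevant2}.

Lemma const_submod :
  submod_closed ([pred p : Q | p@_0%MM == 0] : {pred Q^o}).
Proof.
split=> [|c p q]; rewrite !inE ?mcoeff0 // => /eqP hp /eqP hq.
by rewrite mcoeffD hq addr0 [_ *: _]/(c * p) rmorphM /= hp mulr0.
Qed.

Lemma irrelevant2_const p : p \in irrelevant2 -> p@_0%MM = 0.
Proof.
pose I : submodClosed Q^o := HB.pack ([pred p : Q | p@_0%MM == 0] : {pred Q^o})
  (GRing.isSubmodClosed.Build Q Q^o _ const_submod).
move=> /asboolP /(_ I) hI; apply/eqP/hI => _ [u [v [/asboolP hu _ ->]]].
rewrite inE rmorphM /=; suff /eqP -> : u \in I by rewrite mul0r.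
by apply: hu => _ [k ->]; rewrite inE mcoeffX mnm1_eq0.
Qed.

Lemma proj_pi p : proj (\pi_(quo a) p) = p@_0%MM.
Proof.
apply/eqP; rewrite -subr_eq0 -mcoeffB; apply/eqP/irrelevant2_const/a2.
have : repr (\pi_(quo a) p) - p \in zpred a by rewrite Quotient.idealrBE reprK.
by [].
Qed.

Lemma proj_lin (q : Q) (x y : gquo (M := greg) a) :
  proj (q *: x + y) = q@_0%MM * proj x + proj y.
Proof.
have [x' ->] : exists x', x = \pi_(quo a) x' by exists (repr x); rewrite reprK.
have [y' ->] : exists y', y = \pi_(quo a) y' by exists (repr y); rewrite reprK.
have -> : q *: (\pi_(quo a) x' : gquo (M := greg) a) + \pi_(quo a) y'
          = \pi_(quo a) (q * x' + y').
  by rewrite raddfD; congr (_ + _); rewrite [LHS]pi_quo_scale.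
by rewrite !proj_pi mcoeffD rmorphM.
Qed.
End Proj.

(* A graded free resolution  ... -> F_1 -> F_0 -> K -> 0  of K = Q/(x_1, ..., x_n)
   by free modules of finite rank: F_t = \bigoplus_j Q(- fr_deg t j), elements
   being row vectors; the differential F_(t+1) -> F_t is v |-> v *m fr_d t and
   the augmentation is v |-> \sum_j v_j(0) * fr_aug j. *)
Record free_resolution := FreeResolution {
  fr_rank : nat -> nat;
  fr_deg : forall t, 'I_(fr_rank t) -> int;
  fr_d : forall t, 'M[Q]_(fr_rank t.+1, fr_rank t);
  fr_aug : 'I_(fr_rank 0) -> K;
  fr_d_graded : forall t i j, fr_d t i j \in form (fr_deg i - fr_deg j);
  fr_aug_graded : forall j, fr_aug j != 0 -> fr_deg j = 0;
  fr_aug_surj : exists j, fr_aug j != 0;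
  fr_exact0 : forall v : 'rV[Q]_(fr_rank 0),
    \sum_j (v 0 j)@_0%MM * fr_aug j = 0 <-> exists w, v = w *m fr_d 0;
  fr_exact : forall t (v : 'rV[Q]_(fr_rank t.+1)),
    v *m fr_d t = 0 <-> exists w, v = w *m fr_d t.+1
}.

(* Tor_t(M, K) is the homology of M \otimes_Q F for a graded free resolution F
   of K, where M \otimes_Q F_t is the direct sum of the M(- fr_deg t j); it
   does not depend on F up to isomorphism. *)
Section Tor.
Variables (F : free_resolution) (M : gmod).

Definition chain t := {ffun 'I_(fr_rank F t) -> vect M}.

Definition bdry t (w : chain t.+1) : chain t :=
  [ffun j => \sum_i fr_d F t i j *: (w i : M)].

Definition chain_hom t (s : int) (v : chain t) : bool :=
  [forall j, v j \in gm_hom M (s - fr_deg j)].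

Definition is_cycle t : chain t -> bool :=
  if t is t'.+1 then fun v => bdry v == 0 else fun=> true.

Lemma bdry_lin t c (v w : chain t.+1) :
  bdry (c *: v + w) = c *: bdry v + bdry w.
Proof.
apply/ffunP=> j; transitivity (c%:MP *: (\sum_i fr_d F t i j *: (v i : M))
  + \sum_i fr_d F t i j *: (w i : M)); last by rewrite !ffunE.
rewrite ffunE scaler_sumr -big_split; apply: eq_bigr => i _ /=.
have -> : (c *: v + w) i = c%:MP *: (v i : M) + (w i : M) by rewrite !ffunE.
by rewrite scalerDr !scalerA mulrC.
Qed.

Lemma chain_hom_submod t s : submod_closed (chain_hom s : {pred chain t}).
Proof.
split=> [|c v w].
  by apply/forallP=> j; rewrite ffunE (rpred0 (gm_hom M _)).
move=> /forallP hv /forallP hw; apply/forallP=> j; rewrite !ffunE.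
exact: gm_hom_lin.
Qed.

Lemma is_cycle_lin t c (v w : chain t) :
  is_cycle v -> is_cycle w -> is_cycle (c *: v + w).
Proof.
case: t v w => //= t v w /eqP zv /eqP zw.
by rewrite bdry_lin zv zw scaler0 addr0.
Qed.

Definition cycles t s : {pred chain t} :=
  [pred v | chain_hom s v && is_cycle v].
Lemma cycles_submod t s : submod_closed (@cycles t s).
Proof.
have [h0 hl] := chain_hom_submod t s.
split=> [|c v w]; rewrite !inE.
  apply/andP; split=> //; case: t {h0 hl} => //= t; apply/eqP/ffunP=> j.
  by rewrite !ffunE big1 // => i _; rewrite ffunE scaler0.
move=> /andP[hv zv] /andP[hw zw]; apply/andP; split; first exact: hl.
exact: is_cycle_lin.
Qed.
HB.instance Definition _ t s :=
  GRing.isSubmodClosed.Build K (chain t) (@cycles t s) (cycles_submod t s).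

Definition boundaries t s : {pred chain t} :=
  [pred v | `[< exists2 w : chain t.+1, chain_hom s w & v = bdry w >]].
Lemma boundaries_submod t s : submod_closed (@boundaries t s).
Proof.
have [h0 hl] := chain_hom_submod t.+1 s.
split=> [|c _ _ /asboolP[v hv ->] /asboolP[w hw ->]]; apply/asboolP.
  exists 0 => //; apply/ffunP=> j.
  by rewrite !ffunE big1 // => i _; rewrite ffunE scaler0.
by exists (c *: v + w); [exact: hl | rewrite bdry_lin].
Qed.
HB.instance Definition _ t s := GRing.isSubmodClosed.Build K (chain t)
  (@boundaries t s) (boundaries_submod t s).

(* [Tor_t(M, K)]_s *)
Definition Tor (t s : int) : lmodType K :=
  if t is Posz t' then subquotient (@cycles t' s) (@boundaries t' s)
  else 'rV[K]_0.

(* The Castelnuovo-Mumford regularity of M is e. *)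
Definition regularity (e : int) : Prop :=
  (exists (t : nat) (x : Tor t (t%:Z + e)), x != 0) /\
  (forall (t : nat) (s : int) (x : Tor t s), x != 0 -> s - t%:Z <= e).
End Tor.

End Graded.
Arguments irrelevant K n : clear implicits.
Arguments irrelevant2 K n : clear implicits.

Section ConnectedSum.
Variables (K : fieldType) (r : nat) (n : 'I_r -> nat).

Local Notation N := (\sum_(i < r) n i)%N.
Local Notation Q := {mpoly K[N]}.
Local Notation R i := {mpoly K[n i]}.

Definition xvar (i : 'I_r) (k : 'I_(n i)) : 'I_N := tagnat.Rank i k.
Arguments xvar : clear implicits.

(* The extended ideal x_i of Q. *)
Definition xideal (i : 'I_r) : {pred Q^o} :=
  span (fun p : Q^o => exists k, p = 'X_(xvar i k)).
HB.instance Definition _ i := GRing.SubmodClosed.on (xideal i).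

(* L = \sum_(i != j) x_i \cap x_j *)
Definition cross_ideal : {pred Q^o} :=
  span (fun p : Q^o => exists i j, [/\ i != j, p \in xideal i & p \in xideal j]).
HB.instance Definition _ := GRing.SubmodClosed.on cross_ideal.

(* The retraction Q -> R_i, which kills x_(j,k) for j != i. *)
Definition retract (i : 'I_r) : Q -> R i :=
  comp_mpoly [tuple if [pick k | xvar i k == l] is Some k then 'X_k else 0
             | l < N].
HB.instance Definition _ i := GRing.RMorphism.on (retract i).

Lemma retract_const i q : (retract i q)@_0%MM = q@_0%MM.
Proof.
elim/mpolyind: q => [|c m p _ _ IH]; first by rewrite raddf0 !mcoeff0.
rewrite raddfD /= !mcoeffD IH; congr (_ + _).
rewrite /retract comp_mpolyZ comp_mpolyX !mcoeffZ mcoeffX rmorph_prod /=.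
congr (c * _); case: eqP => [->|/eqP m0].
  by rewrite big1 => // l _; rewrite mnm0E expr0 mcoeff1 eqxx.
have [l ml] : exists l, m l != 0%N.
  apply/existsP; rewrite -[X in is_true X]negbK negb_exists; apply/negP.
  move=> /forallP h; case/eqP: m0; apply/mnmP=> l; rewrite mnm0E.
  by apply/eqP; have := h l; rewrite negbK.
rewrite (bigD1 l) //= rmorphXn /= tnth_mktuple.
have -> : (if [pick k | xvar i k == l] is Some k then 'X_k else 0 : R i)@_0%MM = 0.
  by case: pickP => [k _|_]; rewrite ?mcoeff0 // mcoeffX mnm1_eq0.
by rewrite expr0n (negPf ml) mul0r.
Qed.

(* An R_i-module seen as a Q-module. *)
Section Inflation.
Variables (i : 'I_r) (M : gmod K (n i)).
Let Mr : lmodType Q := restr (retract i) M.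
Definition infl_hom (d : int) : {pred vect Mr} :=
  [pred x | (x : M) \in gm_hom M d].
Lemma infl_hom_submod d : submod_closed (infl_hom d).
Proof.
split=> [|c x y hx hy]; first exact: (rpred0 (gm_hom M d)).
have -> : c *: x + y = c%:MP *: (x : M) + y :> M.
  by congr (_ + _); rewrite [LHS]/(retract i c%:MP *: (x : M)) /retract
    comp_mpolyC.
exact: gm_hom_lin.
Qed.
HB.instance Definition _ d := GRing.isSubmodClosed.Build K (vect Mr)
  (infl_hom d) (infl_hom_submod d).
Definition inflate : gmod K N :=
  @GMod K N Mr (fun d => infl_hom d : submodClosed (vect Mr)).
End Inflation.

Variable a : forall i, submodClosed (R i)^o.
Arguments a : clear implicits.

Definition alg (i : 'I_r) : gmod K (n i) := gquo (M := greg K (n i)) (a i).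

Definition algQ (i : 'I_r) : gmod K N := inflate (alg i).

Hypothesis a2 : forall i, {subset a i <= irrelevant2 K (n i)}.

Definition fiber of (forall i, {subset a i <= irrelevant2 K (n i)}) :
    {pred gdsum algQ} :=
  [pred v : gdsum algQ | [forall i, forall j,
     proj (v i : alg i) == proj (v j : alg j)]].
Lemma fiber_submod : submod_closed (fiber a2).
Proof.
split=> [|q v w]; rewrite !inE.
  apply/forallP=> i; apply/forallP=> j; rewrite !ffunE.
  by rewrite -[X in proj X](raddf0 \pi_(quo (a i)))
             -[X in _ == proj X](raddf0 \pi_(quo (a j))) !proj_pi // !mcoeff0.
move=> /'forall_'forall_eqP hv /'forall_'forall_eqP hw.
apply/'forall_'forall_eqP=> i j; rewrite !ffunE.
rewrite [X in proj X = _](_ : _ = retract i q *: (v i : alg i) + (w i : alg i)) //.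
rewrite [X in _ = proj X](_ : _ = retract j q *: (v j : alg j) + (w j : alg j)) //.
by rewrite !proj_lin // !retract_const (hv i j) (hw i j).
Qed.
HB.instance Definition _ := GRing.isSubmodClosed.Build Q (gdsum algQ)
  (fiber a2) fiber_submod.

(* A_1 \times_K ... \times_K A_r *)
Definition fiber_product : gmod K N :=
  gsub (M := gdsum algQ) (fiber a2 : submodClosed (gdsum algQ)).

(* The element (tau_1, 0, ..., 0, tau_i, 0, ..., 0), where tau_1 is in the
   position of value 0 of 'I_r. *)
Definition thom_pair (tau : forall i, alg i) (i : 'I_r) : gdsum algQ :=
  [ffun j : 'I_r => if (val j == 0%N) || (j == i) then tau j : algQ j else 0].

(* The fiber product is a quotient ring of Q, so the ideal generated by the
   thom_pair's is the Q-submodule they generate. *)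
Definition thom_ideal (tau : forall i, alg i) : {pred fiber_product} :=
  span (fun x : fiber_product =>
    exists2 i : 'I_r, (0 < i)%N & (val x : gdsum algQ) = thom_pair tau i).
HB.instance Definition _ tau := GRing.SubmodClosed.on (thom_ideal tau).

(* A_1 #_K ... #_K A_r *)
Definition connected_sum (tau : forall i, alg i) : gmod K N :=
  gquo (M := fiber_product) (thom_ideal tau).

Definition cross_quotient : gmod K N := gquo (M := greg K N) cross_ideal.
End ConnectedSum.

(* Main.v *)
Require Import Defs.
From HB Require Import structures.
From mathcomp Require Import all_boot all_order all_algebra.
From mathcomp Require Import boolp.
From mathcomp Require Import mpoly.
From mathcomp Require Import zify ring.

Set Implicit Arguments.
Unset Strict Implicit.
Unset Printing Implicit Defensive.

Import GRing.Theory.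
Local Open Scope ring_scope.
Local Open Scope quotient_scope.

(** Why the formula holds.  Tor may be computed from any graded free resolution
    of K, in particular from the Koszul complex (Tor_comparison, koszul_exact,
    Tor_koszul).  Hence [Tor_t(M, K)]_(t + j) is the homology KH M t j of
      M_(j-1) (x) L^(t+1) -> M_j (x) L^t -> M_(j+1) (x) L^(t-1),
    L^t being the exterior powers of the space of variables, and it only sees
    the degrees j - 1, j, j + 1 of M and the multiplication by the variables.

    Let C be the connected sum.  In degrees 1, ..., e - 1 it is the direct sum
    of the A_i; in degree 0 the r copies of K are reduced to their diagonal, and
    in degree e the r lines K tau_i are glued to one.  So for 2 <= j <= e - 2
    the strand of C is the sum of the strands of the A_i (KH_middle), while
    C_j = 0 for j < 0 and j > e.  The strand j = 0 is trivial because the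
    variables are independent in C_1 (KH_00, KH_linear).

    Strand j = 1 (KH_degree1): the cycles are those of the sum of the A_i, but
    only the boundaries of diagonal chains remain.  In A_i the chain c e_T of
    degree 0 has a boundary that vanishes iff T misses the variables of block i;
    so the lost boundaries contribute, for each T with t + 1 elements, K^h
    modulo the diagonal, h being the number of blocks that T meets.  The same
    computation on Q/L, where all cycles of this strand come from such chains
    c_i e_T, shows that this contribution is [Tor_t(Q/L, K)]_(t+1)
    (KH_cross).

    Strand j = e - 1 (KH_degree_pred): the boundaries are those of the sum of the
    A_i, but a chain u is now a cycle as soon as the boundaries c_i e_S tau_i
    of its components cancel in the glued line.  The Gorenstein pairing
    A_(e-1) x A_1 -> A_e gives elements b_l with x_k b_l = delta_kl tau_i
    (dual_exists), so a family c_i occurs iff c_i = 0 whenever S contains block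
    i, and the cycles gained are, for each S with t - 1 elements, the vectors
    with signed sum 0 in K^h, h being the number of blocks met by the
    complement of S.  Complementation S |-> T, with N - t + 1 elements in T, and
    the equality of dimensions h - 1 identify this with the contribution
    computed for Q/L in homological degree N - t.  The index set of both is
    hit_pairs.

    Strand j = e (KH_top_eq0, KH_top): the b_l of all blocks together make every
    chain c e_S tau a boundary, unless S consists of all the variables. *)

(** * Quotients, subquotients and their isomorphisms *)
Section Quotients.
Variable R : pzRingType.

Section QuotientClass.
Variables (V : lmodType R) (S : submodClosed V).

Lemma pi_eq (x y : V) : (\pi_(quo S) x == \pi_(quo S) y) = (x - y \in S).
Proof. by rewrite (_ : (x - y \in S) = (x - y \in zpred S)) // Quotient.idealrBE. Qed.

Lemma pi_eq0 (x : V) : (\pi_(quo S) x == 0) = (x \in S).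
Proof. by rewrite -(raddf0 \pi_(quo S)) /= pi_eq subr0. Qed.

Lemma pi_lin a (x y : V) :
  \pi_(quo S) (a *: x + y) = a *: (\pi_(quo S) x : quo S) + \pi_(quo S) y.
Proof. by rewrite raddfD /= -pi_quo_scale. Qed.

Lemma pi_surj (x : quo S) : exists y, x = \pi_(quo S) y.
Proof. by exists (repr x); rewrite reprK. Qed.
End QuotientClass.

Lemma span_sub (V : lmodType R) (X : V -> Prop) (P : {pred V}) :
  submod_closed P -> (forall y, X y -> y \in P) -> {subset Defs.span X <= P}.
Proof.
move=> cP XP x /asboolP xS.
pose U : submodClosed V := HB.pack P (GRing.isSubmodClosed.Build R V _ cP).
exact: (xS U XP).
Qed.

Lemma mem_span (V : lmodType R) (X : V -> Prop) x : X x -> x \in Defs.span X.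
Proof. by move=> Xx; apply/asboolP=> U; apply. Qed.

Lemma submod_memB (V : lmodType R) (Z : submodClosed V) x y :
  x \in Z -> y \in Z -> x - y \in Z.
Proof. by move=> Zx Zy; rewrite -scaleN1r rpredD ?rpredZ. Qed.

Section Subquotients.
Variables (V : lmodType R) (Z B : submodClosed V).

(** Total on V, with the value 0 outside Z, so that maps into subquotients can
    be written down without carrying proofs of membership. *)
Definition cls (x : V) : subquotient Z B :=
  \pi_(quo (@trace_pred R V Z B)) (insubd (0 : submod Z) x : submod Z).

Lemma insubd_val x : x \in Z -> val (insubd (0 : submod Z) x) = x.
Proof. by move=> Zx; rewrite val_insubd Zx. Qed.

Lemma cls_lin a x y : x \in Z -> y \in Z ->
  cls (a *: x + y) = a *: cls x + cls y.
Proof.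
move=> Zx Zy; rewrite /cls -pi_lin; congr (\pi _).
apply: val_inj; rewrite insubd_val ?rpredD ?rpredZ //.
by rewrite linearP [X in _ = _ *: X + _]insubd_val // [X in _ = _ + X]insubd_val.
Qed.

Lemma clsD x y : x \in Z -> y \in Z -> cls (x + y) = cls x + cls y.
Proof. by move=> Zx Zy; rewrite -[x]scale1r cls_lin // !scale1r. Qed.

Lemma cls_eq0 x : x \in Z -> cls x = 0 <-> x \in B.
Proof.
move=> Zx; rewrite -[x in _ <-> x \in _](insubd_val Zx).
rewrite (rwP eqP) /cls; split=> [|h]; last by rewrite pi_eq0.
by rewrite pi_eq0.
Qed.

Lemma cls_surj (y : subquotient Z B) : exists2 x, x \in Z & y = cls x.
Proof.
have [u ->] := pi_surj y; exists (val u); first exact: (valP u).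
by rewrite /cls valKd.
Qed.

(** The first isomorphism theorem in the form in which homology groups are
    computed: Z the cycles, B the boundaries, phi defined on all chains. *)
Lemma subquotient_iso (T : lmodType R) (phi : V -> T) :
    (forall a, {in Z &, forall x y, phi (a *: x + y) = a *: phi x + phi y}) ->
    (forall y, exists2 x, x \in Z & phi x = y) ->
    {in Z, forall x, phi x = 0 <-> x \in B} ->
  isomorphic (subquotient Z B) T.
Proof.
move=> lin surj ker.
pose g (y : subquotient Z B) : T := phi (val (repr y)).
have phiB x y : x \in Z -> y \in Z -> x - y \in B -> phi x = phi y.
  move=> Zx Zy Bxy; have Zxy : x - y \in Z by exact: submod_memB.
  by rewrite -[x](subrK y) -[x - y]scale1r lin // (ker _ Zxy).2 // scaler0 add0r.
have gE x : x \in Z -> g (cls x) = phi x.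
  move=> Zx; apply: phiB => //; first exact: (valP (repr _)).
  pose u : submod Z := insubd (0 : submod Z) x.
  rewrite -{2}(insubd_val Zx) -[X in X \in B](raddfB val (repr (cls x)) u).
  have : \pi_(quo (@trace_pred R V Z B)) (repr (cls x)) == \pi u by rewrite reprK.
  by rewrite pi_eq.
have glin : linear g.
  move=> a y1 y2; have [x1 Z1 ->] := cls_surj y1; have [x2 Z2 ->] := cls_surj y2.
  by rewrite -cls_lin // !gE ?lin // rpredD ?rpredZ.
pose G : {linear subquotient Z B -> T} :=
  HB.pack g (GRing.isLinear.Build R _ _ _ g glin).
exists G.
have inj : injective G.
  move=> y1 y2; have [x1 Z1 ->] := cls_surj y1; have [x2 Z2 ->] := cls_surj y2.
  rewrite /= !gE // => e12; apply/eqP; rewrite -subr_eq0 addrC -scaleN1r -cls_lin //.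
  apply/eqP/cls_eq0; first by rewrite rpredD ?rpredZ.
  by apply/ker; rewrite ?rpredD ?rpredZ // lin // e12 scaleN1r addNr.
have /boolp.choice[h hK] : forall y, exists x, G x = y.
  by move=> y; have [x Zx <-] := surj y; exists (cls x); exact: gE.
by exists h => // x; apply: inj; rewrite hK.
Qed.

End Subquotients.

Lemma isomorphic_sym (U V : lmodType R) : isomorphic U V -> isomorphic V U.
Proof.
move=> [f [g fK gK]].
have glin : linear g.
  by move=> a x y; apply: (can_inj fK); rewrite linearP !gK.
exists (HB.pack g (GRing.isLinear.Build R _ _ _ g glin) : {linear V -> U}).
by exists f.
Qed.

Lemma isomorphic_trans (U V W : lmodType R) :
  isomorphic U V -> isomorphic V W -> isomorphic U W.
Proof.
by move=> [f bf] [g bg]; exists (g \o f : {linear U -> W}); exact: bij_comp.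
Qed.

Lemma isomorphic_oplus (U U' V V' : lmodType R) :
  isomorphic U U' -> isomorphic V V' -> isomorphic (oplus U V) (oplus U' V').
Proof.
move=> [f [f' fK f'K]] [g [g' gK g'K]].
pose h (x : oplus U V) : oplus U' V' := (f x.1, g x.2).
have hlin : linear h by move=> a x y; rewrite /h !linearP.
exists (HB.pack h (GRing.isLinear.Build R _ _ _ h hlin) : {linear _ -> _}).
by exists (fun y => (f' y.1, g' y.2)) => -[x y]; rewrite /= /h /= ?fK ?gK ?f'K ?g'K.
Qed.

Lemma isomorphic_dsum (I : finType) (U V : I -> lmodType R) :
  (forall i, isomorphic (U i) (V i)) -> isomorphic (dsum U : lmodType R) (dsum V).
Proof.
move=> iso; pose f i := sval (cid (iso i)).
have bij i : exists g, cancel (f i) g /\ cancel g (f i).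
  by rewrite /f; case: cid => g /= [g' gK g'K]; exists g'.
pose g i := sval (cid (bij i)).
have fK i : cancel (f i) (g i) by rewrite /g; case: cid => ? [].
have gK i : cancel (g i) (f i) by rewrite /g; case: cid => ? [].
pose h (x : dsum U) : dsum V := [ffun i => f i (x i)].
have hlin : linear h by move=> a x y; apply/ffunP=> i; rewrite !ffunE linearP.
exists (HB.pack h (GRing.isLinear.Build R _ _ _ h hlin) : {linear _ -> _}).
by exists (fun y : dsum V => [ffun i => g i (y i)] : dsum U) => x; apply/ffunP=> i;
  rewrite /h !ffunE ?fK ?gK.
Qed.

Lemma isomorphic_zero (U V : lmodType R) :
  (forall x : U, x = 0) -> (forall x : V, x = 0) -> isomorphic U V.
Proof.
move=> U0 V0.
exists (\0 : {linear U -> V}); exists (fun=> 0) => x /=; last by rewrite [x]V0 [LHS]V0.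
by rewrite [x]U0.
Qed.

End Quotients.

(** * Homogeneous components of polynomials *)
Section Forms.
Variables (K : fieldType) (n : nat).
Local Notation Q := {mpoly K[n]}.
Implicit Types (p q : Q) (d e : int).

Lemma formE d p : (p \in @Defs.form K n d) = if d is Posz k then p \is k.-homog else p == 0.
Proof. by []. Qed.

Lemma form_mcoeff d p m : p \in @Defs.form K n d -> (mdeg m : int) != d -> p@_m = 0.
Proof.
case: d => d; rewrite formE => hp; last by rewrite (eqP hp) mcoeff0.
by move=> hm; apply: (dhomog_nemf_coeff hp).
Qed.

Lemma form0 d : 0 \in @Defs.form K n d.
Proof. exact: (rpred0 (@Defs.form K n d)). Qed.

Lemma form_const c : c%:MP \in @Defs.form K n 0.
Proof.
apply/dhomogP=> m; rewrite msuppC; case: ifP => // _.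
by rewrite inE => /eqP->; apply: mdeg0.
Qed.

Lemma form_X (k : 'I_n) : 'X_k \in @Defs.form K n 1.
Proof.
have : ('X_k : Q) \is 1.-homog by rewrite dhomogX; apply/eqP/mdeg1.
by [].
Qed.

Lemma formB d p q :
  p \in @Defs.form K n d -> q \in @Defs.form K n d -> p - q \in @Defs.form K n d.
Proof. exact: (@submod_memB K (vect Q^o) (@Defs.form K n d)). Qed.

Lemma form_sum d (I : finType) (F : I -> Q) :
  (forall i, F i \in @Defs.form K n d) -> \sum_i F i \in @Defs.form K n d.
Proof.
move=> hF; elim/big_ind: _ => // [|p q]; first exact: form0.
exact: (@rpredD _ (@Defs.form K n d : submodClosed (vect Q^o))).
Qed.

Lemma formM d e p q :
  p \in @Defs.form K n d -> q \in @Defs.form K n e -> p * q \in @Defs.form K n (d + e).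
Proof.
case: d => d; rewrite formE => hp; last first.
  by move=> _; rewrite (eqP hp) mul0r form0.
case: e => e; rewrite formE => hq; last first.
  by rewrite (eqP hq) mulr0 form0.
by rewrite formE; apply: dhomogM.
Qed.

(** Indexed by all integers: the generators of a resolution may have any degree,
    so the entries of a graded matrix may be forms of negative degree. *)
Definition hcomp d p : Q := if d is Posz k then pihomog [measure of mdeg] k p else 0.

Lemma hcomp_form d p : hcomp d p \in @Defs.form K n d.
Proof. by case: d => d; rewrite formE //; apply: pihomogP. Qed.

Lemma hcomp_lin d : linear (hcomp d).
Proof. by case: d => d c p q; rewrite /hcomp ?linearP // scaler0 addr0. Qed.
HB.instance Definition _ d := GRing.isLinear.Build K Q Q _ (hcomp d) (hcomp_lin d).

Lemma hcomp_of_form d e p :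
  p \in @Defs.form K n e -> hcomp d p = if e == d then p else 0.
Proof.
case: e => e; rewrite formE; last by move=> /eqP->; rewrite raddf0 if_same.
case: d => d hp //=; rewrite eqz_nat; case: eqP => [<-|/eqP ne].
  exact: pihomog_dE.
exact: (pihomog_ne0 ne hp).
Qed.

(** Multiplication by a form shifts components; this makes the homogeneous part
    of a solution of a graded linear system again a solution. *)
Lemma hcompM d e p q : q \in @Defs.form K n e -> hcomp d (p * q) = hcomp (d - e) p * q.
Proof.
move=> hq; elim/mpolyind: p => [|c m p _ _ IH]; first by rewrite mul0r !raddf0 mul0r.
rewrite mulrDl !raddfD /= mulrDl IH; congr (_ + _).
rewrite -scalerAl !linearZ /= -scalerAl; congr (_ *: _).
have hm : 'X_[m] \in @Defs.form K n (mdeg m) by rewrite formE dhomogX.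
rewrite (hcomp_of_form _ (formM hm hq)) (hcomp_of_form _ hm).
by rewrite [_ == d - e]eq_sym subr_eq eq_sym; case: eqP; rewrite ?mul0r.
Qed.

End Forms.

(** * Comparison of graded free resolutions *)
Section Comparison.
Variables (K : fieldType) (n : nat).
Local Notation Q := {mpoly K[n]}.

Definition graded_mx m p (a : 'I_m -> int) (b : 'I_p -> int) (A : 'M[Q]_(m, p)) :=
  forall i j, A i j \in @Defs.form K n (a i - b j).

Lemma graded_mxM m p q a b c (A : 'M[Q]_(m, p)) (B : 'M[Q]_(p, q)) :
  graded_mx a b A -> graded_mx b c B -> graded_mx a c (A *m B).
Proof.
move=> gA gB i k; rewrite mxE form_sum // => j.
have -> : a i - c k = (a i - b j) + (b j - c k) by ring.
exact: formM.
Qed.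

Lemma graded_mxB m p a b (A B : 'M[Q]_(m, p)) :
  graded_mx a b A -> graded_mx a b B -> graded_mx a b (A - B).
Proof. by move=> gA gB i k; rewrite !mxE formB. Qed.

Lemma graded_mx1 m (a : 'I_m -> int) : graded_mx a a 1%:M.
Proof.
move=> i j; rewrite mxE; case: eqP => [->|_]; last exact: form0.
by rewrite subrr formE mulr1n; apply: dhomog1.
Qed.

Section Resolution.
Variable G : free_resolution K n.

(** The homogeneous components, in the degrees prescribed by a, of any lift of
    the rows form a graded lift, because the differential is graded. *)
Lemma row_lift t p (a : 'I_p -> int) (A : 'M[Q]_(p, fr_rank G t)) :
    graded_mx a (@fr_deg _ _ G t) A ->
    (forall i, exists w, row i A = w *m fr_d G t) ->
  exists2 B, graded_mx a (@fr_deg _ _ G t.+1) B & A = B *m fr_d G t.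
Proof.
move=> gA /boolp.choice[w hw].
exists (\matrix_(i, j) hcomp (a i - fr_deg j) (w i 0 j)).
  by move=> i j; rewrite mxE; apply: hcomp_form.
apply/matrixP=> i l; have := gA i l; have := hw i => /rowP/(_ l).
rewrite !mxE => -> /hcomp_of_form-/(_ (a i - fr_deg l)); rewrite eqxx => <-.
rewrite raddf_sum /=; apply: eq_bigr => j _; rewrite mxE.
by rewrite (hcompM _ _ (fr_d_graded j l)); congr (hcomp _ _ * _); ring.
Qed.

Lemma cycle_lift t p (a : 'I_p -> int) (A : 'M[Q]_(p, fr_rank G t.+1)) :
    graded_mx a (@fr_deg _ _ G t.+1) A -> A *m fr_d G t = 0 ->
  exists2 B, graded_mx a (@fr_deg _ _ G t.+2) B & A = B *m fr_d G t.+1.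
Proof.
move=> gA Ad; apply: row_lift gA _ => i; apply/fr_exact.
by rewrite -row_mul Ad row0.
Qed.

Lemma aug_lift p (a : 'I_p -> int) (A : 'M[Q]_(p, fr_rank G 0)) :
    graded_mx a (@fr_deg _ _ G 0) A ->
    (forall i, \sum_j (A i j)@_0%MM * @fr_aug _ _ G j = 0) ->
  exists2 B, graded_mx a (@fr_deg _ _ G 1) B & A = B *m fr_d G 0.
Proof.
move=> gA Ad; apply: row_lift gA _ => i; apply/fr_exact0.
by rewrite -[RHS](Ad i); apply: eq_bigr => j _; rewrite mxE.
Qed.

Lemma fr_d_comp0 t : fr_d G t.+1 *m fr_d G t = 0.
Proof.
apply/row_matrixP=> i; rewrite row_mul row0; apply/fr_exact.
by exists (delta_mx 0 i); rewrite -rowE.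
Qed.

Lemma fr_d_aug i : \sum_j (fr_d G 0 i j)@_0%MM * @fr_aug _ _ G j = 0.
Proof.
have /fr_exact0 h : exists w, row i (fr_d G 0) = w *m fr_d G 0.
  by exists (delta_mx 0 i); rewrite -rowE.
by rewrite -[RHS]h; apply: eq_bigr => j _; rewrite mxE.
Qed.
End Resolution.

(** Dependent choice along nat; the invariant P is what makes a further step
    possible. *)
Lemma dep_choice (T : nat -> Type) (P : forall m, T m -> Prop)
    (R : forall m, T m -> T m.+1 -> Prop) :
    (exists x, P 0%N x) ->
    (forall m x, P m x -> exists2 y, P m.+1 y & R m x y) ->
  exists2 f : forall m, T m, forall m, P m (f m) & forall m, R m (f m) (f m.+1).
Proof.
move=> /cid[x0 P0] step.
have stepS m (u : {x | P m x}) : {y : {y | P m.+1 y} | R m (sval u) (sval y)}.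
  by case: u => x Px; have [y Py Ry] := cid2 (step m x Px); exists (exist _ y Py).
pose f := fix f m : {x | P m x} :=
  if m is m'.+1 then sval (stepS m' (f m')) else exist _ x0 P0.
by exists (fun m => sval (f m)) => m; [case: (f m)|rewrite /=; case: (stepS m (f m))].
Qed.

Definition chain_map (F G : free_resolution K n)
    (phi : forall t, 'M[Q]_(fr_rank F t, fr_rank G t)) :=
  (forall t, graded_mx (@fr_deg _ _ F t) (@fr_deg _ _ G t) (phi t)) /\
  (forall t, phi t.+1 *m fr_d G t = fr_d F t *m phi t).

(** The matrix A covers the multiplication by c on the resolved module K. *)
Definition augments (F G : free_resolution K n)
    (A : 'M[Q]_(fr_rank F 0, fr_rank G 0)) (c : K) :=
  forall i, \sum_j (A i j)@_0%MM * @fr_aug _ _ G j = c * @fr_aug _ _ F i.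

(** The comparison theorem.  The invariant kept along the construction is that
    boundaries are sent to boundaries, which is what the next lift needs. *)
Lemma chain_map_exists F G : exists2 phi, @chain_map F G phi & augments (phi 0%N) 1.
Proof.
pose T t := 'M[Q]_(fr_rank F t, fr_rank G t).
(* the last condition concerns t = 0 only, where there are augmentations; the
   matches make it well typed for all t *)
pose P t (A : T t) := [/\ graded_mx (@fr_deg _ _ F t) (@fr_deg _ _ G t) A,
  exists2 B, graded_mx (@fr_deg _ _ F t.+1) (@fr_deg _ _ G t.+1) B &
     fr_d F t *m A = B *m fr_d G t
  & t = 0%N -> forall i, \sum_j mcoeff 0%MM (A i j) *
        (if t is 0 return 'I_(fr_rank G t) -> K then @fr_aug _ _ G else fun=> 0) j
      = (if t is 0 return 'I_(fr_rank F t) -> K then @fr_aug _ _ F else fun=> 0) i].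
have [] := @dep_choice T P (fun t A B => B *m fr_d G t = fr_d F t *m A).
- have [j0 nz] := fr_aug_surj G.
  pose A : T 0%N :=
    \matrix_(i, j) (if j == j0 then (@fr_aug _ _ F i / @fr_aug _ _ G j0)%:MP else 0).
  have gA : graded_mx (@fr_deg _ _ F 0) (@fr_deg _ _ G 0) A.
    move=> i j; rewrite mxE; case: eqP => [->|_]; last exact: form0.
    have [->|nzF] := eqVneq (@fr_aug _ _ F i) 0.
      by rewrite mul0r mpolyC0 form0.
    by rewrite (fr_aug_graded nz) (fr_aug_graded nzF) subrr form_const.
  have augA i : \sum_j mcoeff 0%MM (A i j) * @fr_aug _ _ G j = @fr_aug _ _ F i.
    rewrite (bigD1 j0) //= big1 => [|j /negPf ne]; last by rewrite mxE ne mcoeff0 mul0r.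
    by rewrite mxE eqxx mcoeffC eqxx mulr1 addr0 divfK.
  exists A; split=> //; apply: aug_lift.
    exact: graded_mxM (@fr_d_graded _ _ F 0) gA.
  move=> i; rewrite -[RHS](fr_d_aug i).
  under eq_bigr => j _ do rewrite mxE raddf_sum mulr_suml /=.
  rewrite exchange_big; apply: eq_bigr => k _ /=.
  by rewrite -(augA k) mulr_sumr; apply: eq_bigr => j _; rewrite rmorphM mulrA.
- move=> t A [gA [B gB hB] _]; exists B => //; split=> //.
  apply: cycle_lift; first exact: graded_mxM (@fr_d_graded _ _ F t.+1) gB.
  by rewrite -mulmxA -hB mulmxA fr_d_comp0 mul0mx.
move=> phi Pphi Rphi; exists phi; first by split=> // t; have [] := Pphi t.
by move=> i; have [_ _ /(_ erefl i) ->] := Pphi 0%N; rewrite mul1r.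
Qed.

(** If h_t is constructed, the defect phi_(t+1) - d h_t is a cycle, hence a
    boundary; h_(t+1) is a lift of it. *)
Lemma null_homotopy F G phi : @chain_map F G phi -> augments (phi 0%N) 0 ->
  exists h : forall t, 'M[Q]_(fr_rank F t, fr_rank G t.+1),
   [/\ forall t, graded_mx (@fr_deg _ _ F t) (@fr_deg _ _ G t.+1) (h t),
       phi 0%N = h 0%N *m fr_d G 0
     & forall t, phi t.+1 = fr_d F t *m h t + h t.+1 *m fr_d G t.+1].
Proof.
move=> [gphi cphi] aphi.
pose T t := 'M[Q]_(fr_rank F t, fr_rank G t.+1).
pose P t (h : T t) := [/\ graded_mx (@fr_deg _ _ F t) (@fr_deg _ _ G t.+1) h,
  fr_d F t *m (phi t - h *m fr_d G t) = 0 & t = 0%N -> phi t = h *m fr_d G t].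
have [] := @dep_choice T P (fun t h h' => phi t.+1 = fr_d F t *m h + h' *m fr_d G t.+1).
- have [h gh eh] := aug_lift (gphi 0%N) (fun i => etrans (aphi i) (mul0r _)).
  by exists h; split=> //; rewrite -eh subrr mulmx0.
- move=> t h [gh eh _].
  have [||h' gh' eh'] :=
    @cycle_lift G t _ (@fr_deg _ _ F t.+1) (phi t.+1 - fr_d F t *m h).
  + exact: graded_mxB (gphi _) (graded_mxM (@fr_d_graded _ _ F t) gh).
  + by rewrite mulmxBl cphi -mulmxA -mulmxBr eh.
  exists h'; last by rewrite -eh' addrC subrK.
  split=> //; rewrite -eh' opprB addrC subrK mulmxA fr_d_comp0.
  by rewrite mul0mx.
move=> h Ph Rh; exists h; split=> // [t|]; first by have [] := Ph t.
by have [_ _] := Ph 0%N; apply.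
Qed.

End Comparison.

(** * Independence of Tor from the resolution *)
Section TorComparison.
Variables (K : fieldType) (n : nat).
Local Notation Q := {mpoly K[n]}.

(** Under this condition a matrix of forms, such as a differential of a graded
    resolution or a homotopy, acts on chains with entries in M in a graded
    way. *)
Definition graded_action (M : gmod K n) :=
  forall d e (p : Q) (x : M), p \in @Defs.form K n d -> x \in gm_hom M e ->
    p *: x \in gm_hom M (d + e).

Section Act.
Variable M : gmod K n.

(** The map induced by A between the tensor products of M with free modules. *)
Definition act m p (A : 'M[Q]_(m, p)) (v : {ffun 'I_m -> vect M}) :
    {ffun 'I_p -> vect M} :=
  [ffun j => \sum_i A i j *: (v i : M)].

Lemma act_lin m p (A : 'M[Q]_(m, p)) : linear (act A).
Proof.
move=> c v w; apply/ffunP=> j.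
transitivity (c%:MP *: (\sum_i A i j *: (v i : M)) + \sum_i A i j *: (w i : M));
  last by rewrite !ffunE.
rewrite ffunE scaler_sumr -big_split; apply: eq_bigr => i _ /=.
have -> : (c *: v + w) i = c%:MP *: (v i : M) + (w i : M) by rewrite !ffunE.
by rewrite scalerDr !scalerA mulrC.
Qed.
HB.instance Definition _ m p (A : 'M[Q]_(m, p)) :=
  GRing.isLinear.Build K {ffun 'I_m -> vect M} {ffun 'I_p -> vect M} _
    (act A) (act_lin A).

Lemma act_mulmx m p q (A : 'M[Q]_(m, p)) (B : 'M[Q]_(p, q)) v :
  act (A *m B) v = act B (act A v).
Proof.
apply/ffunP=> k; rewrite !ffunE.
under [RHS]eq_bigr => j _ do rewrite ffunE scaler_sumr.
rewrite exchange_big; apply: eq_bigr => i _.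
rewrite mxE scaler_suml; apply: eq_bigr => j _.
by rewrite scalerA mulrC.
Qed.

Lemma act_addmx m p (A B : 'M[Q]_(m, p)) v : act (A + B) v = act A v + act B v.
Proof.
apply/ffunP=> k; transitivity (\sum_i A i k *: (v i : M) + \sum_i B i k *: (v i : M));
  last by rewrite !ffunE.
by rewrite ffunE -big_split; apply: eq_bigr => i _; rewrite mxE scalerDl.
Qed.

Lemma act_1 m (v : {ffun 'I_m -> vect M}) : act 1%:M v = v.
Proof.
apply/ffunP=> k; rewrite ffunE (bigD1 k) //= big1 => [|i /negPf ne].
  by rewrite mxE eqxx scale1r addr0.
by rewrite mxE ne scale0r.
Qed.

Lemma act_hom (gM : graded_action M) m p (a : 'I_m -> int) (b : 'I_p -> int)
    (A : 'M[Q]_(m, p)) (v : {ffun 'I_m -> vect M}) s :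
  graded_mx a b A -> (forall i, v i \in gm_hom M (s - a i)) ->
  forall j, act A v j \in gm_hom M (s - b j).
Proof.
move=> gA hv j; rewrite ffunE; elim/big_ind: _ => [|x y|i _].
- exact: (rpred0 (gm_hom M _)).
- exact: (@rpredD _ (gm_hom M (s - b j))).
have -> : s - b j = (a i - b j) + (s - a i) by ring.
exact: gM.
Qed.
End Act.

Lemma bdryE (F : free_resolution K n) M t (w : chain F M t.+1) : bdry w = act (fr_d F t) w.
Proof. by []. Qed.

(** Chain maps over the identity of K exist in both directions, and their
    composites are homotopic to the identity.  All this is expressed by matrix
    identities, which persist after tensoring with M. *)
Lemma Tor_comparison (F G : free_resolution K n) (M : gmod K n) (t : nat) (s : int) :
  graded_action M -> isomorphic (Tor F M t s) (Tor G M t s).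
Proof.
move=> gM.
have [phi [gphi cphi] aphi] := chain_map_exists F G.
have [psi [gpsi cpsi] apsi] := chain_map_exists G F.
(* the composite of two chain maps over the identity of K is homotopic to 1 *)
have htp (F1 G1 : free_resolution K n) al be : @chain_map K n F1 G1 al ->
    @chain_map K n G1 F1 be -> augments (al 0%N) 1 -> augments (be 0%N) 1 ->
    forall u (v : chain F1 M u), chain_hom s v -> is_cycle v ->
    exists2 w : chain F1 M u.+1, chain_hom s w & v - act (be u) (act (al u) v) = bdry w.
  move=> [ga ca] [gb cb] aa ab.
  pose th u := 1%:M - al u *m be u.
  have cth : @chain_map K n F1 F1 th.
    split=> u; first apply: graded_mxB.
    - exact: graded_mx1.
    - exact: graded_mxM (ga u) (gb u).
    by rewrite mulmxBl mulmxBr mul1mx mulmx1 -mulmxA cb mulmxA ca mulmxA.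
  have ath : augments (th 0%N) 0.
    move=> i; rewrite mul0r -[RHS](subrr (@fr_aug _ _ F1 i)) -{2}[fr_aug i]mul1r -aa.
    transitivity (\sum_j (((1%:M : 'M[Q]_(fr_rank F1 0)) i j)@_0%MM * fr_aug j
                   - ((al 0%N *m be 0%N) i j)@_0%MM * fr_aug j)).
      by apply: eq_bigr => j _; rewrite !mxE raddfB mulrBl.
    rewrite sumrB; congr (_ - _).
      rewrite (bigD1 i) //= big1 => [|j /negPf ne]; last first.
        by rewrite mxE eq_sym ne mcoeff0 mul0r.
      by rewrite mxE eqxx mcoeff1 eqxx mul1r addr0.
    under eq_bigr => j _ do rewrite mxE raddf_sum mulr_suml /=.
    rewrite exchange_big; apply: eq_bigr => k _ /=.
    rewrite -[fr_aug k]mul1r -ab mulr_sumr.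
    by apply: eq_bigr => j _; rewrite rmorphM mulrA.
  have [h [gh h0 hS]] := null_homotopy cth ath.
  move=> u v hv zv; exists (act (h u) v).
    by apply/forallP; apply: (act_hom gM (gh u)) => i; apply: (forallP hv).
  have -> : v - act (be u) (act (al u) v) = act (th u) v.
    by apply/eqP; rewrite -act_mulmx subr_eq -act_addmx subrK act_1.
  case: u v hv zv => [|u] v hv zv; first by rewrite h0 act_mulmx.
  by rewrite hS act_addmx !act_mulmx -[act (fr_d _ _) v]bdryE (eqP zv) raddf0 add0r.
(* chain maps preserve cycles and boundaries *)
have mapZ (F1 G1 : free_resolution K n) al : @chain_map K n F1 G1 al ->
    forall u (v : chain F1 M u), v \in @cycles K n F1 M u s ->
    act (al u) v \in @cycles K n G1 M u s.
  move=> [ga ca] u v; rewrite !inE => /andP[/forallP hv zv]; apply/andP; split.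
    by apply/forallP; apply: (act_hom gM (ga u)).
  case: u v hv zv => //= u v _ /eqP zv.
  by rewrite bdryE -act_mulmx ca act_mulmx -bdryE zv raddf0.
have mapB (F1 G1 : free_resolution K n) al : @chain_map K n F1 G1 al ->
    forall u (v : chain F1 M u), v \in @boundaries K n F1 M u s ->
    act (al u) v \in @boundaries K n G1 M u s.
  move=> [ga ca] u v /asboolP[w hw ->]; apply/asboolP.
  exists (act (al u.+1) w); last by rewrite !bdryE -!act_mulmx ca.
  by apply/forallP; apply: (act_hom gM (ga u.+1)); apply/forallP.
have htpB (F1 G1 : free_resolution K n) al be (ha : @chain_map K n F1 G1 al)
    (hb : @chain_map K n G1 F1 be) (aa : augments (al 0%N) 1) (ab : augments (be 0%N) 1)
    u (v : chain F1 M u) : v \in @cycles K n F1 M u s ->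
    v - act (be u) (act (al u) v) \in @boundaries K n F1 M u s.
  rewrite inE => /andP[hv zv]; apply/asboolP.
  by have [w hw ->] := htp _ _ _ _ ha hb aa ab u v hv zv; exists w.
apply: (subquotient_iso (phi := fun v => cls _ _ (act (phi t) v))).
- by move=> c v w Zv Zw; rewrite linearP cls_lin // (mapZ F G).
- move=> y; have [z Zz ->] := cls_surj y.
  exists (act (psi t) z); first exact: (mapZ G F).
  apply/eqP; rewrite eq_sym -subr_eq0 addrC -scaleN1r -cls_lin ?(mapZ F G) ?(mapZ G F) //.
  apply/eqP/cls_eq0; first by rewrite rpredD ?rpredZ // (mapZ F G) ?(mapZ G F).
  by rewrite scaleN1r addrC; apply: (htpB G F).
- move=> v Zv; rewrite cls_eq0 ?(mapZ F G) //; split; last exact: (mapB F G).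
  move=> Bv; rewrite -[v](subrK (act (psi t) (act (phi t) v))).
  by rewrite rpredD ?(mapB G F) // (htpB F G).
Qed.
End TorComparison.

(** * The Koszul complex *)
Section Minimum.
Variable N : nat.
Implicit Type P : pred 'I_N.

Definition is_min P k := P k && [forall l, P l ==> (k <= l)%N].

Lemma is_min_exists P k : P k -> exists l, is_min P l.
Proof.
move=> Pk; case: (arg_minnP (P := P) (fun l => val l) Pk) => l Pl min.
by exists l; rewrite /is_min Pl; apply/forallP=> m; apply/implyP; apply: min.
Qed.

Lemma is_min_uniq P k l : is_min P k -> is_min P l -> k = l.
Proof.
move=> /andP[Pk /forallP mk] /andP[Pl /forallP ml]; apply/val_inj/eqP.
by rewrite eqn_leq (implyP (mk l) Pl) (implyP (ml k) Pk).
Qed.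

Lemma eq_is_min P P' : P =1 P' -> is_min P =1 is_min P'.
Proof.
by move=> eP k; rewrite /is_min eP; congr (_ && _); apply: eq_forallb => l; rewrite eP.
Qed.

End Minimum.

Section Koszul.
Variables (K : fieldType) (N : nat).
Local Notation Q := {mpoly K[N]}.
Implicit Types (S T : {set 'I_N}) (k l : 'I_N).

(** The sign of e_k e_S with respect to the basis vector of k |: S. *)
Definition ksign k S : K := (-1) ^+ #|[set l in S | (l < k)%N]|.

Lemma ksign_sq k S : ksign k S * ksign k S = 1.
Proof. by rewrite /ksign -exprMn mulrNN mulr1 expr1n. Qed.

Lemma ksign_setU1 k l S : l \notin S -> ksign k (l |: S) = if (l < k)%N then - ksign k S else ksign k S.
Proof.
move=> lS; rewrite /ksign; case: ifP => lk.
  have -> : [set m in l |: S | (m < k)%N] = l |: [set m in S | (m < k)%N].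
    by apply/setP=> m; rewrite !inE; case: eqP => [->|].
  by rewrite cardsU1 inE (negPf lS) /= exprS mulN1r.
congr (_ ^+ #|pred_of_set _|); apply/setP=> m; rewrite !inE.
by case: eqP => [->|//]; rewrite lk !andbF.
Qed.

(** Exchanging the order of two insertions changes the sign: the reason why the
    Koszul differential squares to 0. *)
Lemma ksign_anti k l S : k != l -> k \notin S -> l \notin S ->
  ksign k S * ksign l (k |: S) = - (ksign l S * ksign k (l |: S)).
Proof.
move=> kl kS lS; rewrite !ksign_setU1 //; case: (ltngtP l k) => [_|_|/val_inj e].
- by rewrite mulrN opprK mulrC.
- by rewrite mulrN mulrC.
- by rewrite e eqxx in kl.
Qed.

(** Proved by pairing (k, l) with (l, k), so that it is also valid in
    characteristic 2. *)
Lemma antisym_sum (V : zmodType) (F : 'I_N -> 'I_N -> V) :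
  (forall k l, F k l = - F l k) -> (forall k, F k k = 0) -> \sum_k \sum_l F k l = 0.
Proof.
move=> anti diag.
have -> : \sum_k \sum_l F k l =
    \sum_(k < N) \sum_(l < N | (l < k)%N) F k l + \sum_(k < N) \sum_(l < N | (k < l)%N) F k l.
  rewrite -big_split; apply: eq_bigr => k _ /=.
  rewrite (bigID (fun l : 'I_N => (l < k)%N)) /=; congr (_ + _).
  rewrite (bigD1 k) ?ltnn //= diag add0r; apply: eq_bigl => l.
  by rewrite -leqNgt ltn_neqAle -val_eqE andbC eq_sym.
rewrite [X in _ + X](exchange_big_dep xpredT) //= -big_split big1 // => k _.
rewrite -big_split big1 // => l _ /=.
by rewrite [F l k]anti addrN.
Qed.

Section Complex.
Variable M : gmod K N.

Definition mulX k (x : vect M) : vect M := 'X_k *: (x : M).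

Lemma mulX_lin k : linear (mulX k).
Proof.
move=> c x y; rewrite /mulX.
transitivity ('X_k *: (c%:MP *: (x : M)) + 'X_k *: (y : M)).
  exact: (scalerDr 'X_k (c%:MP *: (x : M)) (y : M)).
by congr (_ + _); rewrite [RHS](_ : _ = c%:MP *: ('X_k *: (x : M))) // !scalerA mulrC.
Qed.
HB.instance Definition _ k :=
  GRing.isLinear.Build K (vect M) (vect M) _ (mulX k) (mulX_lin k).

Lemma mulXC k l x : mulX k (mulX l x) = mulX l (mulX k x).
Proof. by rewrite /mulX !scalerA mulrC. Qed.

(** The Koszul complex of M with all its homological degrees at once: v S is
    the coefficient of e_S. *)
Definition kchain := {ffun {set 'I_N} -> vect M}.
Implicit Types v w : kchain.

(** The differential sends e_T to the sum over k in T of the terms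
    (sign) x_k e_(T \ k); read off at S, the sets T are the k |: S. *)
Definition kd v : kchain :=
  [ffun S : {set 'I_N} => \sum_(k | k \notin S) ksign k S *: mulX k (v (k |: S) : vect M)].

Lemma kd_lin : linear kd.
Proof.
move=> c v w; apply/ffunP=> S; rewrite !ffunE scaler_sumr -big_split.
apply: eq_bigr => k _ /=.
by rewrite !ffunE linearP scalerDr !scalerA mulrC.
Qed.
HB.instance Definition _ := GRing.isLinear.Build K kchain kchain _ kd kd_lin.

Lemma kd_kd v : kd (kd v) = 0.
Proof.
apply/ffunP=> S; rewrite !ffunE.
pose F k l : vect M := if [&& k != l, k \notin S & l \notin S] then
  (ksign k S * ksign l (k |: S)) *: mulX k (mulX l (v (l |: (k |: S)))) else 0.
rewrite -[RHS](@antisym_sum _ F) => [|k l|k]; last by rewrite /F eqxx.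
  rewrite big_mkcond; apply: eq_bigr => k _ /=.
  case: ifP => kS; last by rewrite big1 // => l _; rewrite /F kS andbF.
  rewrite ffunE linear_sum scaler_sumr big_mkcond; apply: eq_bigr => l _ /=.
  rewrite /F !inE negb_or eq_sym kS /=; case: ifP => // _.
  by rewrite linearZ /= scalerA.
rewrite /F eq_sym [(l \notin S) && _]andbC; case: ifP => [/and3P[kl kS lS]|_].
  by rewrite ksign_anti ?scaleNr 1?eq_sym // mulXC setUCA.
by rewrite oppr0.
Qed.

(** Homological degree t and coefficients in M_j, that is, internal degree
    t + j. *)
Definition khom t (j : int) v := [forall S, (v S \in gm_hom M j) && ((#|S| != t) ==> (v S == 0))].

Lemma khomP t j v : reflect ((forall S, v S \in gm_hom M j) /\ (forall S, #|S| != t -> v S = 0))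
  (khom t j v).
Proof.
apply: (iffP forallP) => [h|[h1 h2] S]; last first.
  by rewrite h1; apply/implyP => /h2->.
by split=> S; have /andP[h1 /implyP h2] := h S => // /h2/eqP.
Qed.

Lemma khom_submod t j : submod_closed (khom t j : {pred kchain}).
Proof.
split=> [|c v w]; first by apply/khomP; split=> S; rewrite ?ffunE // (rpred0 (gm_hom M j)).
move=> /khomP[hv sv] /khomP[hw sw]; apply/khomP; split=> S.
  by rewrite !ffunE; apply: gm_hom_lin.
by move=> St; rewrite !ffunE sv // sw // scaler0 addr0.
Qed.

Definition kcycles t j : {pred kchain} := [pred v | khom t j v && (kd v == 0)].
Lemma kcycles_submod t j : submod_closed (kcycles t j).
Proof.
have [h0 hl] := khom_submod t j.
split=> [|c v w]; rewrite !inE; first by rewrite [khom _ _ _]h0 raddf0 eqxx.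
move=> /andP[hv /eqP zv] /andP[hw /eqP zw].
by rewrite [khom _ _ _](hl c) // linearP /= zv zw scaler0 addr0 eqxx.
Qed.
HB.instance Definition _ t j :=
  GRing.isSubmodClosed.Build K kchain (kcycles t j) (kcycles_submod t j).

Definition kbound t j : {pred kchain} :=
  [pred v | `[< exists2 w, khom t.+1 (j - 1) w & v = kd w >]].
Lemma kbound_submod t j : submod_closed (kbound t j).
Proof.
have [h0 hl] := khom_submod t.+1 (j - 1).
split=> [|c _ _ /asboolP[v hv ->] /asboolP[w hw ->]]; apply/asboolP.
  by exists 0; rewrite ?raddf0.
by exists (c *: v + w); [exact: hl | rewrite linearP].
Qed.
HB.instance Definition _ t j :=
  GRing.isSubmodClosed.Build K kchain (kbound t j) (kbound_submod t j).

(** This is [Tor_t(M, K)]_(t + j), by Tor_koszul. *)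
Definition KH t j : lmodType K := subquotient (kcycles t j) (kbound t j).

Lemma kd_supp t w : (forall S, #|S| != t.+1 -> w S = 0) ->
  forall S, #|S| != t -> kd w S = 0.
Proof.
move=> hw S St; rewrite ffunE big1 // => k kS.
by rewrite hw ?raddf0 ?scaler0 // cardsU1 kS.
Qed.

Lemma kd_supp0 w : (forall S, #|S| != 0%N -> w S = 0) -> kd w = 0.
Proof.
move=> hw; apply/ffunP=> S; rewrite ffunE big1 ?ffunE // => k kS.
by rewrite hw ?raddf0 ?scaler0 // cardsU1 kS.
Qed.

Section Enumeration.
Variable t : nat.
Local Notation At := [set S : {set 'I_N} | #|S| == t].

Definition kext (v : {ffun 'I_#|At| -> vect M}) : kchain :=
  [ffun S : {set 'I_N} => \sum_(i | enum_val i == S) v i].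
Definition kres (v : kchain) : {ffun 'I_#|At| -> vect M} := [ffun i => v (enum_val i)].

Lemma kres_lin : linear kres.
Proof. by move=> c v w; apply/ffunP=> i; rewrite !ffunE. Qed.
HB.instance Definition _ := GRing.isLinear.Build K kchain {ffun 'I_#|At| -> vect M} _ kres kres_lin.

Lemma kextK : cancel kext kres.
Proof.
move=> v; apply/ffunP=> i; rewrite !ffunE (big_pred1 i) // => j.
by rewrite (inj_eq enum_val_inj).
Qed.

Lemma kext_supp (v : {ffun 'I_#|At| -> vect M}) S : #|S| != t -> kext v S = 0.
Proof.
move=> St; rewrite ffunE big1 // => i /eqP e; case/negP: St.
by rewrite -e; have := enum_valP i; rewrite inE.
Qed.

Lemma kresK v : (forall S, #|S| != t -> v S = 0) -> kext (kres v) = v.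
Proof.
move=> sv; apply/ffunP=> S; have [/eqP St|St] := eqVneq #|S| t; last first.
  by rewrite kext_supp // sv.
have AS : S \in At by rewrite inE.
rewrite ffunE (big_pred1 (enum_rank_in AS S)) => [|i].
  by rewrite ffunE enum_rankK_in.
by apply/eqP/eqP=> [e|->]; [apply: enum_val_inj; rewrite enum_rankK_in | rewrite enum_rankK_in].
Qed.
End Enumeration.

End Complex.
End Koszul.

(** * Exactness of the Koszul complex of the polynomial ring *)
Section KoszulResolution.
Variables (K : fieldType) (N : nat).
Local Notation Q := {mpoly K[N]}.
Implicit Types (S T : {set 'I_N}) (k l : 'I_N) (p : Q) (m : 'X_{1..N}).

Lemma mcoeffXM k p m :
  ('X_k * p)@_m = if (0 < m k)%N then p@_(m - U_(k))%MM else 0.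
Proof.
rewrite mulrC; case: ifP => mk.
  have -> : m = (U_(k) + (m - U_(k)))%MM.
    by rewrite addmC submK //; apply/mnm_lepP=> l; rewrite mnm1E; case: eqP => // <-.
  by rewrite mcoeffMX addmC addmK.
apply/memN_msupp_eq0/negP => /msuppM_le /allpairsP[[m1 m2] /= [h1]].
rewrite msuppX inE => /eqP-> e.
by move: mk; rewrite e mnmDE mnm1E eqxx addn1.
Qed.

(** Divides by x_k those monomials of p whose quotient satisfies b.  The
    contracting homotopy of the Koszul complex treats each multidegree
    differently, so it is built from such K-linear operations. *)
Lemma partial_quotient k p (b : pred 'X_{1..N}) :
  exists q : Q, forall m, q@_m = if b m then p@_(m + U_(k))%MM else 0.
Proof.
exists (\sum_(m' <- msupp p | (0 < m' k)%N && b (m' - U_(k))%MM)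
          p@_m' *: 'X_[(m' - U_(k))%MM]).
move=> m; rewrite raddf_sum /=.
under eq_bigr => m' _ do rewrite mcoeffZ mcoeffX.
have inv m' : (0 < m' k)%N -> (m' - U_(k))%MM = m -> m' = (m + U_(k))%MM.
  move=> mk <-; rewrite submK //; apply/mnm_lepP=> l; rewrite mnm1E.
  by case: eqP => // <-.
have [hin|hout] := boolP ((m + U_(k))%MM \in msupp p).
  rewrite big_mkcond (bigD1_seq (m + U_(k))%MM) ?msupp_uniq //= addmK eqxx mulr1.
  rewrite mnmDE mnm1E eqxx addn1 /= big1 ?addr0 // => m' ne.
  case: ifP => // /andP[mk _]; case: eqP; rewrite ?mulr0 // => e.
  by rewrite (inv m' mk e) eqxx in ne.
rewrite (memN_msupp_eq0 hout) if_same big1_seq // => m' /andP[/andP[mk _] hm'].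
case: eqP; rewrite ?mulr0 // => e.
by rewrite -(inv m' mk e) hm' in hout.
Qed.

(** The differential preserves the multidegree, the sum of the exponent m and of
    the indicator function of S.  In a fixed non-zero multidegree let k be the
    least variable that occurs in it; the map x^m e_S |-> (x^m / x_k) e_k e_S,
    read as 0 if k is in S, is a contracting homotopy, without denominators.
    As k is least, no sign is needed to insert it. *)
Lemma koszul_exact (v : kchain (greg K N)) :
  kd v = 0 -> (v set0 : Q)@_0%MM = 0 -> exists w, v = kd w.
Proof.
move=> zv v0.
pose occ m S : pred 'I_N := fun l => (0 < m l)%N || (l \in S).
have /boolp.choice[q hq] : forall kS : 'I_N * {set 'I_N}, exists q : Q, forall m,
    q@_m = if is_min (occ m kS.2) kS.1 then (v (kS.2 :\ kS.1) : Q)@_(m + U_(kS.1))%MM else 0.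
  by move=> [k S]; apply: partial_quotient.
pose w : kchain (greg K N) := [ffun S : {set 'I_N} => \sum_(k in S) q (k, S)].
have wE S m : (w S : Q)@_m =
    \sum_(k in S) if is_min (occ m S) k then (v (S :\ k) : Q)@_(m + U_(k))%MM else 0.
  by rewrite ffunE (raddf_sum (mcoeff m)); apply: eq_bigr => k _; apply: (hq (k, S)).
have kdE (u : kchain (greg K N)) S m : (kd u S : Q)@_m =
    \sum_(l | l \notin S) ksign K l S * (if (0 < m l)%N then (u (l |: S) : Q)@_(m - U_(l))%MM else 0).
  rewrite ffunE (raddf_sum (mcoeff m)); apply: eq_bigr => l _ /=.
  by rewrite [_ *: _](mul_mpolyC (ksign K l S)) mcoeffZ mcoeffXM.
exists w; apply/ffunP=> S; apply/mpolyP=> m; rewrite kdE.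
have wEm l : l \notin S -> (0 < m l)%N -> (w (l |: S) : Q)@_(m - U_(l))%MM =
    \sum_(k in l |: S) if is_min (occ m S) k then
      (v ((l |: S) :\ k) : Q)@_(m - U_(l) + U_(k))%MM else 0.
  move=> lS ml; rewrite wE; apply: eq_bigr => k _; congr (if _ then _ else _).
  apply: eq_is_min => i; rewrite /occ !inE mnmBE mnm1E.
  case: (eqVneq i l) => [->|ne]; first by rewrite ml orbT.
  by rewrite subn0.
have [k0 hk0|none] := pickP (occ m S); last first.
  have S0 : S = set0 by apply/setP=> l; have := none l; rewrite inE => /norP[_ /negPf].
  have m0 : m = 0%MM.
    by apply/mnmP=> l; have := none l; rewrite mnm0E => /norP[+ _]; rewrite -eqn0Ngt => /eqP.
  rewrite S0 m0 v0 big1 // => l _; rewrite mnm0E mulr0 //.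
have [k kmin] := is_min_exists hk0.
have uniqk l : is_min (occ m S) l -> l = k by move/is_min_uniq; apply.
have kle l : (0 < m l)%N || (l \in S) -> (k <= l)%N.
  by move=> h; have /andP[_ /forallP/(_ l)/implyP] := kmin; apply.
have [kS|kS] := boolP (k \in S); last first.
  have mk : (0 < m k)%N by have /andP[/orP[|/idPn]] := kmin.
  rewrite (bigD1 k) //= mk wEm // (bigD1 k) ?setU11 //= kmin.
  rewrite setU1K // submK; last first.
    by apply/mnm_lepP=> l; rewrite mnm1E; case: eqP => // <-.
  rewrite big1 => [|l /andP[_ ne]]; last first.
    by case: ifP => // /uniqk e; rewrite e eqxx in ne.
  rewrite big1 => [|l /andP[lS ne]]; last first.
    case: ifP; rewrite ?mulr0 // => ml; rewrite wEm // big1 ?mulr0 // => i.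
    rewrite !inE; case: ifP => // /uniqk-> /orP[/eqP e|]; last by rewrite (negPf kS).
    by rewrite e eqxx in ne.
  rewrite !addr0 /ksign (_ : [set l in S | (l < k)%N] = set0) ?cards0 ?expr0 ?mul1r //.
  apply/setP=> l; rewrite !inE; apply/negP => /andP[lS].
  by rewrite ltnNge kle // lS orbT.
(* the minimum k lies in S: use that v is a cycle at (m + U_k, S :\ k) *)
have := kdE v (S :\ k) (m + U_(k))%MM; rewrite zv ffunE mcoeff0.
rewrite (bigD1 k) ?setD11 //= setD1K // addmK mnmDE mnm1E eqxx addn1 /=.
have -> : ksign K k (S :\ k) = 1.
  rewrite /ksign (_ : [set l in S :\ k | (l < k)%N] = set0) ?cards0 ?expr0 //.
  apply/setP=> l; rewrite !inE; apply/negP => /andP[/andP[_ lS]].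
  by rewrite ltnNge kle // lS orbT.
rewrite mul1r => /esym/eqP; rewrite addr_eq0 => /eqP->.
rewrite -sumrN; apply: eq_big => [l|l].
  by rewrite !inE negb_and negbK; case: eqVneq => [->|]; rewrite ?kS ?andbT ?orbF.
rewrite !inE negb_and negbK => /andP[+ ne]; rewrite (negPf ne) /= => lS.
rewrite mnmDE mnm1E eq_sym (negPf ne) addn0.
case: ifP => ml; last by rewrite !mulr0 oppr0.
have kl : (k < l)%N by rewrite ltn_neqAle kle ?ml // val_eqE eq_sym ne.
have -> : ksign K l S = - ksign K l (S :\ k).
  by rewrite -[in LHS](setD1K kS) ksign_setU1 ?setD11 ?kl.
rewrite mulNr; congr (- (_ * _)).
rewrite wEm // (bigD1 k) ?inE ?kS ?orbT //= kmin big1 => [|i /andP[_ ik]]; last first.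
  by case: ifP => // /uniqk e; rewrite e eqxx in ik.
have -> : l |: (S :\ k) = (l |: S) :\ k.
  by apply/setP=> i; rewrite !inE; case: (eqVneq i k) => // ->; rewrite eq_sym (negPf ne).
rewrite addr0; congr (mcoeff _ _).
apply/mnmP=> i; rewrite !(mnmBE, mnmDE, mnm1E).
case: (eqVneq l i) => [<-|_]; last by rewrite !subn0.
by rewrite eq_sym (negPf ne) !addn0.
Qed.

End KoszulResolution.

(** * Tor as Koszul homology *)
Section KoszulTor.
Variables (K : fieldType) (N : nat).
Local Notation Q := {mpoly K[N]}.
Local Notation At t := [set S : {set 'I_N} | #|S| == t].

Definition kmx t : 'M[Q]_(#|At t.+1|, #|At t|) :=
  \matrix_(i < #|At t.+1|, j < #|At t|)
    \sum_(k < N | (k \notin (enum_val j : {set 'I_N})) &&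
        ((enum_val i : {set 'I_N}) == k |: (enum_val j : {set 'I_N})))
     (ksign K k (enum_val j))%:MP * 'X_k.

Lemma act_kmx (M : gmod K N) t (v : {ffun 'I_#|At t.+1| -> vect M}) :
  act (kmx t) v = kres t (kd (kext v)).
Proof.
apply/ffunP=> j; rewrite !ffunE.
under eq_bigr => i _ do rewrite mxE scaler_suml.
rewrite (exchange_big_dep (fun k => k \notin (enum_val j : {set 'I_N}))) /=; last by move=> i k _ /andP[].
apply: eq_bigr => k kS; rewrite ffunE raddf_sum scaler_sumr /=.
under eq_bigl => i do rewrite kS /=.
apply: eq_bigr => i _; by rewrite -scalerA.
Qed.

Lemma kd_kext_supp (M : gmod K N) t (v : {ffun 'I_#|At t.+1| -> vect M}) :
  forall S : {set 'I_N}, #|S| != t -> kd (kext v) S = 0.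
Proof. by apply: kd_supp => S; apply: kext_supp. Qed.

Lemma act_kmx_eq0 (M : gmod K N) t (v : {ffun 'I_#|At t.+1| -> vect M}) :
  act (kmx t) v = 0 <-> kd (kext v) = 0.
Proof.
rewrite act_kmx; split=> [e|->]; last by rewrite raddf0.
rewrite -(kresK (kd_kext_supp v)) e.
by apply/ffunP=> S; rewrite !ffunE big1 // => i _; rewrite ffunE.
Qed.

Definition row_chain t (v : 'rV[Q]_#|At t|) : {ffun 'I_#|At t| -> vect (greg K N)} :=
  [ffun i => v 0 i].

Lemma row_chain_inj t : injective (@row_chain t).
Proof. by move=> v w /ffunP e; apply/rowP=> i; have := e i; rewrite !ffunE. Qed.

Lemma row_chainM t (v : 'rV[Q]_#|At t.+1|) : row_chain (v *m kmx t) = act (kmx t) (row_chain v).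
Proof.
apply/ffunP=> j; rewrite !ffunE mxE; apply: eq_bigr => i _.
by rewrite ffunE mulrC.
Qed.

Lemma kmx_exact_of t (v : 'rV[Q]_#|At t|) (w : kchain (greg K N)) :
  kext (row_chain v) = kd w -> exists u, v = u *m kmx t.
Proof.
move=> e; pose u : 'rV[Q]_#|At t.+1| := \row_i (w (enum_val i) : Q).
exists u; apply: row_chain_inj; rewrite row_chainM act_kmx.
rewrite -[LHS]kextK e; apply/ffunP=> j; rewrite !ffunE; apply: eq_bigr => k kS.
congr (_ *: mulX _ _).
have cS : k |: enum_val j \in At t.+1.
  by have := enum_valP j; rewrite !inE cardsU1 kS => /eqP->.
have -> : row_chain u = kres t.+1 w by apply/ffunP=> i; rewrite !ffunE mxE.
rewrite ffunE (big_pred1 (enum_rank_in cS (k |: enum_val j))) => [|i].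
  by rewrite ffunE enum_rankK_in.
by apply/eqP/eqP=> [ei|->]; [apply: enum_val_inj; rewrite enum_rankK_in | rewrite enum_rankK_in].
Qed.

Lemma kmx_graded t i j : kmx t i j \in @Defs.form K N (t.+1%:Z - t%:Z).
Proof.
have -> : t.+1%:Z - t%:Z = 1 by rewrite intS addrK.
rewrite mxE; elim/big_ind: _ => [|p q|k _]; first exact: form0.
  exact: (@rpredD _ (@Defs.form K N 1 : submodClosed (vect (greg K N)))).
apply: (@formM K N 0 1); first exact: form_const.
exact: form_X.
Qed.

(** Exactness at the augmentation: the constant term is the only obstruction
    left by koszul_exact. *)
Lemma kmx_aug (v : 'rV[Q]_#|At 0|) :
  \sum_j (v 0 j)@_0%MM * 1 = 0 :> K <-> exists w, v = w *m kmx 0.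
Proof.
have A0 : set0 \in At 0 by rewrite inE cards0.
have sumE : \sum_j (v 0 j)@_0%MM * 1 = (kext (row_chain v) set0 : Q)@_0%MM.
  rewrite ffunE (raddf_sum (mcoeff 0%MM)) [RHS]big_mkcond; apply: eq_bigr => j _ /=.
  have := enum_valP j; rewrite inE cards_eq0 => /eqP->.
  by rewrite eqxx ffunE mulr1.
rewrite sumE; split=> [v0|[w ->]].
  have [//|w e] := koszul_exact _ v0.
    by apply: kd_supp0 => S; apply: kext_supp.
  exact: kmx_exact_of e.
rewrite row_chainM act_kmx kresK; last exact: kd_kext_supp.
rewrite ffunE (raddf_sum (mcoeff 0%MM)) big1 // => k _ /=.
rewrite [_ *: _](mul_mpolyC (ksign K k set0)) mcoeffZ mcoeffXM mnm0E.
by rewrite mulr0.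
Qed.

Lemma kmx_exact t (v : 'rV[Q]_#|At t.+1|) :
  v *m kmx t = 0 <-> exists w, v = w *m kmx t.+1.
Proof.
split=> [e|[w ->]].
  have /act_kmx_eq0 zv : act (kmx t) (row_chain v) = 0.
    by rewrite -row_chainM e; apply/ffunP=> i; rewrite !ffunE mxE.
  have [|w ew] := koszul_exact zv; last exact: kmx_exact_of ew.
  by rewrite kext_supp ?cards0 // mcoeff0.
apply: row_chain_inj; rewrite !row_chainM [RHS](_ : _ = 0); last first.
  by apply/ffunP=> i; rewrite !ffunE mxE.
apply/act_kmx_eq0; rewrite act_kmx kresK; last exact: kd_kext_supp.
exact: kd_kd.
Qed.

Definition koszul_resolution : free_resolution K N.
Proof.
refine (@FreeResolution K N (fun t => #|At t|) (fun t _ => t%:Z) kmx (fun _ => 1) _ _ _ _ _).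
- exact: kmx_graded.
- by [].
- have A0 : set0 \in At 0 by rewrite inE cards0.
  by exists (enum_rank_in A0 set0); rewrite oner_eq0.
- exact: kmx_aug.
- exact: kmx_exact.
Defined.

Lemma Tor_koszul (F : free_resolution K N) (M : gmod K N) (t : nat) (s : int) :
  graded_action M -> isomorphic (Tor F M t s) (KH M t (s - t%:Z)).
Proof.
move=> gM; apply: isomorphic_trans (Tor_comparison F koszul_resolution t s gM) _.
apply: isomorphic_sym.
have homE (u : nat) (v : kchain M) : khom u (s - u%:Z) v ->
    @chain_hom K N koszul_resolution M u s (kres u v).
  by move=> /khomP[hv _]; apply/forallP=> i; rewrite ffunE.
have cycE (u : nat) (v : kchain M) : (forall S : {set 'I_N}, #|S| != u -> v S = 0) ->
    @is_cycle K N koszul_resolution M u (kres u v) = (kd v == 0).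
  case: u => [|u] sv; first by rewrite (kd_supp0 sv) eqxx.
  have := act_kmx_eq0 (kres u.+1 v); rewrite kresK // => h.
  by apply/eqP/eqP => /h.
have homE' (u : nat) (v : @chain K N koszul_resolution M u) : chain_hom s v ->
    khom u (s - u%:Z) (kext v).
  move=> /forallP hv; apply/khomP; split=> S; last exact: kext_supp.
  rewrite ffunE; elim/big_ind: _ => [|x y|i _].
  - exact: (rpred0 (gm_hom M _)).
  - exact: (@rpredD _ (gm_hom M (s - u%:Z))).
  - exact: hv.
have sE : s - t.+1%:Z = s - t%:Z - 1 by rewrite intS; ring.
have cycZ v : v \in @kcycles K N M t (s - t%:Z) ->
    kres t v \in @cycles K N koszul_resolution M t s.
  move=> /andP[hv zv]; rewrite inE homE //=.
  by have /khomP[_ sv] := hv; rewrite cycE.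
apply: (subquotient_iso (phi := fun v => cls _ _ (kres t v : chain koszul_resolution M t))).
- by move=> c v w Zv Zw; rewrite linearP cls_lin // cycZ.
- move=> y; have [z Zz ->] := cls_surj y; exists (kext z); last by rewrite kextK.
  move: Zz; rewrite !inE => /andP[hz zz]; rewrite homE' //=.
  by rewrite -(cycE t) ?kextK //; apply: kext_supp.
- move=> v Zv; rewrite cls_eq0 ?cycZ //; have /andP[/khomP[_ sv] _] := Zv.
  split=> /asboolP[w hw e]; apply/asboolP.
    exists (kext w); first by rewrite -sE homE'.
    have := act_kmx w; rewrite -[act _ _]e => /(congr1 (@kext K N M t)).
    by rewrite !kresK //; apply: kd_kext_supp.
  have /khomP[hw' sw] := hw; exists (kres t.+1 w); first by apply: homE; rewrite sE.
  by rewrite e; have := act_kmx (kres t.+1 w); rewrite kresK // => <-.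
Qed.

End KoszulTor.

(** * Blocks of variables *)
Section Blocks.
Variables (K : fieldType) (N r : nat) (blk : 'I_N -> 'I_r).
Implicit Types (S T : {set 'I_N}) (k l : 'I_N) (i : 'I_r).

Definition hit T : pred 'I_r := fun i => [exists l, (l \in T) && (blk l == i)].

Lemma hitP T i : reflect (exists2 l, l \in T & blk l = i) (hit T i).
Proof.
apply: (iffP existsP) => [[l /andP[lT /eqP li]]|[l lT li]]; exists l => //.
by rewrite lT li eqxx.
Qed.

(** A basis of the contribution of Q/L to the Tor formula.  A set T that meets h
    blocks carries h - 1 basis vectors, one for each block met except the first.
    This is the dimension both of K^h modulo its diagonal (differences with the
    entry of the first block) and of the vectors with a given signed sum 0 in
    K^h (the entry of the first block is determined by the others). *)
Definition hit_pairs p := {x : {set 'I_N} * 'I_r |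
  [&& #|x.1| == p, hit x.1 x.2 & ~~ is_min (hit x.1) x.2]}.
Definition hit_space p : lmodType K := {ffun hit_pairs p -> K^o}.

Definition hit_ext p (g : hit_space p) T i : K := if insub (T, i) is Some x then g x else 0.

Lemma hit_ext_val p (g : hit_space p) x : hit_ext g (val x).1 (val x).2 = g x.
Proof. by rewrite /hit_ext -surjective_pairing valK. Qed.

Lemma hit_ext_eq0 p (g : hit_space p) T i :
  ~~ [&& #|T| == p, hit T i & ~~ is_min (hit T) i] -> hit_ext g T i = 0.
Proof. by move=> h; rewrite /hit_ext insubF //; apply/negbTE. Qed.

Definition hit_diff p (c : 'I_r -> {set 'I_N} -> K) : hit_space p :=
  [ffun x : hit_pairs p => c (val x).2 (val x).1 - \sum_(i | is_min (hit (val x).1) i) c i (val x).1].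

Lemma sum_is_min n (V : nmodType) (P : pred 'I_n) (k : 'I_n) (F : 'I_n -> V) :
  is_min P k -> \sum_(l | is_min P l) F l = F k.
Proof.
move=> mk; rewrite (big_pred1 k) // => l /=.
by apply/idP/eqP => [/is_min_uniq|->]; first apply.
Qed.

Lemma hit_diff_eq0 p c : hit_diff p c = 0 -> forall T i j, #|T| = p ->
  hit T i -> is_min (hit T) j -> c i T = c j T.
Proof.
move=> g0 T i j Tp Ti Tj; have [/is_min_uniq/(_ Tj)->//|nm] := boolP (is_min (hit T) i).
have hx : [&& #|(T, i).1| == p, hit (T, i).1 (T, i).2 & ~~ is_min (hit (T, i).1) (T, i).2].
  by rewrite /= Tp eqxx Ti nm.
have := congr1 (fun g : {ffun hit_pairs p -> K^o} => g (exist _ (T, i) hx)) g0.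
by rewrite !ffunE /= (sum_is_min _ Tj) => /eqP; rewrite subr_eq0 => /eqP.
Qed.

Lemma eq0_hit_diff p c : (forall T i j, hit T i -> hit T j -> c i T = c j T) -> hit_diff p c = 0.
Proof.
move=> h; apply/ffunP=> -[[T i] /= hx]; rewrite !ffunE /=.
have /and3P[_ Ti _] := hx; have [j Tj] := is_min_exists Ti.
rewrite (sum_is_min _ Tj); apply/eqP; rewrite subr_eq0; apply/eqP/h => //.
by have /andP[] := Tj.
Qed.

Lemma hit_diff_surj p (g : hit_space p) c :
  (forall T i, #|T| = p -> hit T i -> c i T = hit_ext g T i) -> hit_diff p c = g.
Proof.
move=> h; apply/ffunP=> x; rewrite -[RHS]hit_ext_val ffunE.
case: x => -[T i] /= hx; have /and3P[/eqP Tp Ti _] := hx; have [j Tj] := is_min_exists Ti.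
have [Thj _] := andP Tj.
rewrite (sum_is_min _ Tj) !h // [hit_ext g T j]hit_ext_eq0 ?subr0 //.
by rewrite Tj !andbF.
Qed.

Lemma hit_diff_lin p a c c' : hit_diff p (fun i T => a * c i T + c' i T) = a *: hit_diff p c + hit_diff p c'.
Proof.
apply/ffunP=> x; rewrite !ffunE /= big_split -mulr_sumr /= -[_ *: _]/(_ * _).
by ring.
Qed.

Section Coordinates.
Variables (M : gmod K N).
Implicit Types (cf : 'I_N -> {linear vect M -> K^o}) (z : kchain M).

Definition bmin i T := is_min (fun l => (l \in T) && (blk l == i)).

(** The coefficient c i T of a boundary d(c), recovered from the coefficient of
    x_k at T \ k, where k is the least variable of block i in T. *)
Definition bcoord cf i z T : K :=
  \sum_(k | bmin i T k) ksign K k (T :\ k) * cf k (z (T :\ k)).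

Lemma bcoordE cf z (c : {set 'I_N} -> K) i T :
  (forall k S, blk k = i -> cf k (z S) = if k \notin S then ksign K k S * c (k |: S) else 0) ->
  hit T i -> bcoord cf i z T = c T.
Proof.
move=> h /existsP[l hl]; have [k mk] := @is_min_exists _ (fun l => (l \in T) && (blk l == i)) _ hl.
rewrite /bcoord (sum_is_min _ mk); have /andP[/andP[kT /eqP ki] _] := mk.
by rewrite h // setD11 /= mulrA ksign_sq mul1r setD1K.
Qed.

Lemma bcoord_lin cf i T a z z' : bcoord cf i (a *: z + z') T = a * bcoord cf i z T + bcoord cf i z' T.
Proof.
rewrite /bcoord mulr_sumr -big_split; apply: eq_bigr => k _ /=.
by rewrite !ffunE linearP mulrDr mulrCA.
Qed.

Lemma bcoord_supp cf i z t T : (forall S, #|S| != t -> z S = 0) -> #|T| != t.+1 ->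
  bcoord cf i z T = 0.
Proof.
move=> sz hT; apply: big1 => k /andP[/andP[kT _] _].
rewrite sz ?raddf0 ?mulr0 //; apply: contra hT => /eqP <-.
by rewrite (cardsD1 k T) kT.
Qed.

(** A primitive of c tau, if b_l are elements with x_k b_l = delta_kl tau for l
    in B: the set S is enlarged by the least element of B that is not in S. *)
Definition kprim (B : pred 'I_N) (b : 'I_N -> vect M) (c : {set 'I_N} -> K) : kchain M :=
  [ffun T : {set 'I_N} => \sum_(k in T | is_min (fun l => B l && (l \notin T :\ k)) k)
     (ksign K k (T :\ k) * c (T :\ k)) *: b k].

Lemma kprim_lin (B : pred 'I_N) b a c c' :
  kprim B b (fun S => a * c S + c' S) = a *: kprim B b c + kprim B b c'.
Proof.
apply/ffunP=> T; rewrite !ffunE scaler_sumr -big_split; apply: eq_bigr => k _ /=.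
by rewrite scalerA -scalerDl; congr (_ *: _); ring.
Qed.

Lemma kprim0 (B : pred 'I_N) b c : (forall S, c S = 0) -> kprim B b c = 0.
Proof.
move=> c0; apply/ffunP=> T; rewrite !ffunE big1 // => k _.
by rewrite c0 mulr0 scale0r.
Qed.

Lemma kprim_hom (B : pred 'I_N) b c t j : (forall k, B k -> b k \in gm_hom M j) ->
  (forall S, #|S|.+1 != t -> c S = 0) -> khom t j (kprim B b c).
Proof.
move=> hb hc; apply/khomP; split=> T => [|Tt]; rewrite ffunE.
  elim/big_ind: _ => [|x y|k /andP[_ /andP[/andP[Bk _] _]]].
  - exact: (rpred0 (gm_hom M _)).
  - exact: (@rpredD _ (gm_hom M j)).
  - by apply: (@rpredZ _ _ (gm_hom M j)); apply: hb.
rewrite big1 // => k /andP[kT _]; rewrite hc ?mulr0 ?scale0r //.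
by apply: contra Tt => /eqP <-; rewrite (cardsD1 k T) kT.
Qed.

(** If S contains B, the chain e_S tau cannot be reached by enlarging S. *)
Lemma kd_kprim (B : pred 'I_N) b c tau :
  (forall k l, B l -> mulX k (b l) = if k == l then tau else 0) ->
  forall S, kd (kprim B b c) S = if [forall l, B l ==> (l \in S)] then 0 else c S *: tau.
Proof.
move=> hb S; rewrite ffunE.
have term k : k \notin S -> ksign K k S *: mulX k (kprim B b c (k |: S)) =
    if is_min (fun l => B l && (l \notin S)) k then c S *: tau else 0.
  move=> kS; rewrite ffunE linear_sum scaler_sumr /=.
  have other l : is_min (fun l' => B l' && (l' \notin (k |: S) :\ l)) l -> l != k ->
      ksign K k S *: mulX k ((ksign K l ((k |: S) :\ l) * c ((k |: S) :\ l)) *: b l) = 0.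
    move=> /andP[/andP[Bl _] _] lk.
    by rewrite linearZ /= hb // eq_sym (negPf lk) !scaler0.
  case: ifPn => mk.
    rewrite (bigD1 k) /= ?setU11 ?setU1K //.
    rewrite big1 ?addr0 => [|l /andP[/andP[_ ml] lk]]; last exact: other.
    have /andP[/andP[Bk _] _] := mk.
    by rewrite linearZ /= hb // eqxx scalerA mulrA ksign_sq mul1r.
  rewrite big1 // => l /andP[_ ml]; apply: other => //.
  by apply: contraNneq mk => e; move: ml; rewrite e setU1K.
rewrite (eq_bigr _ term) -big_mkcondr.
case: ifPn => [/forallP full|/forallPn[l]].
  rewrite big_pred0 // => k; apply/negbTE/negP => /andP[kS /andP[/andP[Bk _] _]].
  by have := full k; rewrite Bk (negPf kS).
rewrite negb_imply => hl.
have [k mk] := @is_min_exists _ (fun l => B l && (l \notin S)) _ hl.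
rewrite (big_pred1 k) // => k' /=; apply/andP/eqP => [[_ /is_min_uniq]|->]; first by apply.
by have /andP[/andP[_ ->] _] := mk.
Qed.
End Coordinates.
End Blocks.

(** * Strands of the Koszul complex *)
Lemma dsum_sumE (R : pzRingType) (I : finType) (V : I -> lmodType R) (J : finType) (P : pred J)
  (F : J -> dsum V) i : (\sum_(j | P j) F j) i = \sum_(j | P j) F j i.
Proof. by elim/big_rec2: _ => [|j x y _ <-]; rewrite ffunE. Qed.

Definition dsum_of (R : pzRingType) (I : finType) (V : I -> lmodType R) (F : forall i, V i) :
  dsum V := [ffun i => F i].

Section Strands.
Variables (K : fieldType) (N : nat).
Implicit Types (M : gmod K N) (S T : {set 'I_N}).

Lemma mulX_hom M k j x : graded_action M -> x \in gm_hom M j -> mulX k x \in gm_hom M (j + 1).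
Proof. by move=> gM hx; rewrite addrC; apply: gM hx; apply: form_X. Qed.

Lemma hom_sum M j (I : finType) (P : pred I) (F : I -> vect M) :
  (forall i, P i -> F i \in gm_hom M j) -> \sum_(i | P i) F i \in gm_hom M j.
Proof.
move=> hF; elim/big_ind: _ => // [|x y]; first exact: (rpred0 (gm_hom M _)).
exact: (@rpredD _ (gm_hom M j)).
Qed.

Lemma homZ M j c (x : vect M) : x \in gm_hom M j -> c *: x \in gm_hom M j.
Proof. exact: (@rpredZ _ _ (gm_hom M j)). Qed.

Lemma khom_kd M t j v : graded_action M -> khom t.+1 j v -> khom t (j + 1) (@kd K N M v).
Proof.
move=> gM /khomP[hv sv]; apply/khomP; split=> S; last exact: kd_supp.
rewrite ffunE; apply: hom_sum => k _; apply: homZ; exact: mulX_hom.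
Qed.

Lemma kcycleP M t j v : reflect (khom t j v /\ kd v = 0) (v \in @kcycles K N M t j).
Proof. by apply: (iffP andP) => -[h /eqP z]; split=> //; apply/eqP. Qed.

Lemma kcyclesD M t j : {in @kcycles K N M t j &, forall v w,
  v + w \in @kcycles K N M t j}.
Proof. exact: (@rpredD _ (@kcycles K N M t j : submodClosed (kchain M))). Qed.

Lemma kboundP M t j v :
  reflect (exists2 w, khom t.+1 (j - 1) w & v = kd w) (v \in @kbound K N M t j).
Proof. exact: asboolP. Qed.

Lemma KH_eq0 M t j : {subset @kcycles K N M t j <= @kbound K N M t j} ->
  isomorphic (KH M t j) 'rV[K]_0.
Proof.
move=> h; apply: (subquotient_iso (phi := fun=> 0)) => [c v w _ _|y|v /h //].
  by rewrite scaler0 addr0.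
by exists 0; [exact: rpred0 | rewrite [y]thinmx0].
Qed.

Lemma KH_degree0 M t j : (forall x, x \in gm_hom M j -> x = 0) -> isomorphic (KH M t j) 'rV[K]_0.
Proof.
move=> h; apply: KH_eq0 => v /kcycleP[/khomP[hv _] _].
by rewrite (_ : v = 0) ?rpred0 //; apply/ffunP=> S; rewrite ffunE; apply: h.
Qed.

Definition scalar_chain (M : gmod K N) (u : vect M) (c : {set 'I_N} -> K) : kchain M :=
  [ffun S : {set 'I_N} => c S *: u].

Lemma khom_scalar (M : gmod K N) (u : vect M) c t j : u \in gm_hom M j ->
  (forall S, #|S| != t -> c S = 0) -> khom t j (scalar_chain u c).
Proof.
move=> hu hc; apply/khomP; split=> S; rewrite ffunE; first exact: homZ.
by move/hc->; rewrite scale0r.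
Qed.

Section Map.
Variables (M M' : gmod K N) (g : {linear vect M -> vect M'}).
Definition kmap (v : kchain M) : kchain M' := [ffun S => g (v S)].

Lemma kmap_lin : linear kmap.
Proof. by move=> c v w; apply/ffunP=> S; rewrite !ffunE linearP. Qed.
HB.instance Definition _ := GRing.isLinear.Build K (kchain M) (kchain M') _ kmap kmap_lin.

Lemma kmap_kd (v : kchain M) : (forall k S, g (mulX k (v S)) = mulX k (g (v S))) -> kmap (kd v) = kd (kmap v).
Proof.
move=> h; apply/ffunP=> S; rewrite !ffunE linear_sum; apply: eq_bigr => k _ /=.
by rewrite linearZ /= h ffunE.
Qed.

Lemma khom_kmap t j (v : kchain M) : (forall x, x \in gm_hom M j -> g x \in gm_hom M' j) ->
  khom t j v -> khom t j (kmap v).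
Proof.
move=> h /khomP[hv sv]; apply/khomP; split=> S; first by rewrite ffunE h.
by move=> St; rewrite ffunE sv // raddf0.
Qed.
End Map.

End Strands.

(** What the proof uses of a Gorenstein algebra of socle degree e in the
    variables of B, as a module over the ring in all variables: one generates
    degree 0, with coordinate gd_ev; the variables of B are independent in
    degree 1, with coordinate functionals gd_coef; tau spans degree e, with
    coordinate gd_top; and gd_dual is dual to the variables of B under the
    pairing of degrees 1 and e - 1 with values in degree e. *)
Record gorenstein_data (K : fieldType) (N : nat) (B : pred 'I_N) (M : gmod K N) (e : nat) := GorensteinData {
  gd_action : graded_action M;
  gd_one : vect M;
  gd_ev : {linear vect M -> K^o};
  gd_coef : 'I_N -> {linear vect M -> K^o};
  gd_top : {linear vect M -> K^o};
  gd_tau : vect M;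
  gd_dual : 'I_N -> vect M;
  gd_kill : forall k x, ~~ B k -> mulX k x = 0 :> vect M;
  gd_one_hom : gd_one \in gm_hom M 0;
  gd_ev_one : forall x, x \in gm_hom M 0 -> x = gd_ev x *: gd_one;
  gd_coef_one : forall k l, B k -> gd_coef k (mulX l gd_one) = (k == l)%:R;
  gd_tau_hom : gd_tau \in gm_hom M e%:Z;
  gd_top_tau : gd_top gd_tau = 1;
  gd_topE : forall x, x \in gm_hom M e%:Z -> x = gd_top x *: gd_tau;
  gd_dual_hom : forall l, B l -> gd_dual l \in gm_hom M (e%:Z - 1);
  gd_dualE : forall k l, B l -> mulX k (gd_dual l) = if k == l then gd_tau else 0;
  gd_ev_gd_one : gd_ev gd_one = 1;
  gd_ev_off : forall d x, x \in gm_hom M d -> d != 0 -> gd_ev x = 0;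
  gd_top_off : forall d x, x \in gm_hom M d -> d != e%:Z -> gd_top x = 0;
  gd_tau_scale : forall q : {mpoly K[N]}, q *: (gd_tau : M) = (q@_0%MM)%:MP *: (gd_tau : M);
  gd_neg : forall d x, x \in gm_hom M d -> d < 0 -> x = 0;
  gd_high : forall d x, x \in gm_hom M d -> e%:Z < d -> x = 0
}.

(** How C is glued from the A_i.  The K-linear maps lam and rho are inverse to
    each other in degrees 1, ..., e - 1, and commute with the variables as long
    as lam does not have to enter degree e and rho does not have to leave degree
    0.  In degree 0, C is the diagonal line; in degree e, it is the line on
    which rho is the signed sum of the coordinates in the A_i. *)
Record amalgam (K : fieldType) (N r : nat) (A : 'I_r -> gmod K N) (C : gmod K N)
    (e : nat) (B : 'I_r -> pred 'I_N) (G : forall i, gorenstein_data (B i) (A i) e) := Amalgam {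
  lam : forall i, {linear vect C -> vect (A i)};
  rho : {linear (dsum (fun i => vect (A i)) : lmodType K) -> vect C};
  amalgam_action : graded_action C;
  lam_hom : forall i j y, y \in gm_hom C j -> lam i y \in gm_hom (A i) j;
  lam_xm : forall i k j y, y \in gm_hom C j -> j <= e%:Z - 2 ->
    lam i (mulX k y) = mulX k (lam i y);
  rho_hom : forall j (x : dsum (fun i => vect (A i))), 1 <= j -> (forall i, x i \in gm_hom (A i) j) ->
    rho x \in gm_hom C j;
  rho_xm : forall k j (x : dsum (fun i => vect (A i))), 1 <= j -> (forall i, x i \in gm_hom (A i) j) ->
    mulX k (rho x) = rho (dsum_of (V := fun i => vect (A i)) (fun i => mulX k (x i)));
  lam_rho : forall j (x : dsum (fun i => vect (A i))), 1 <= j -> j <= e%:Z - 1 ->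
    (forall i, x i \in gm_hom (A i) j) -> forall i, lam i (rho x) = x i;
  rho_lam : forall j y, 1 <= j -> j <= e%:Z - 1 -> y \in gm_hom C j ->
    rho (dsum_of (V := fun i => vect (A i)) (fun i => lam i y)) = y;
  am_one : vect C;
  am_ev : {linear vect C -> K^o};
  am_one_hom : am_one \in gm_hom C 0;
  am_ev_one : am_ev am_one = 1;
  am_evE : forall y, y \in gm_hom C 0 -> y = am_ev y *: am_one;
  lam_one : forall i, lam i am_one = gd_one (G i);
  am_sign : 'I_r -> K;
  am_sign_sq : forall i, am_sign i * am_sign i = 1;
  am_top : {linear vect C -> K^o};
  am_top_rho : forall x : dsum (fun i => vect (A i)), (forall i, x i \in gm_hom (A i) e%:Z) ->
    am_top (rho x) = \sum_i am_sign i * gd_top (G i) (x i);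
  am_top_inj : forall y, y \in gm_hom C e%:Z -> am_top y = 0 -> y = 0
}.

Section Amalgam.
Variables (K : fieldType) (N r : nat) (blk : 'I_N -> 'I_r).
Variables (A : 'I_r -> gmod K N) (C : gmod K N) (e : nat).
Hypothesis e3 : (3 <= e)%N.
Variable G : forall i, gorenstein_data (fun k => blk k == i) (A i) e.
Variable D : amalgam C G.
Implicit Types (S T : {set 'I_N}) (x : dsum (fun i => vect (A i))) (y : vect C) (j : int).
Local Notation lam := (lam D).
Local Notation rho := (rho D).

Definition rhoc (z : forall i, kchain (A i)) : kchain C :=
  [ffun S : {set 'I_N} => rho (dsum_of (V := fun i => vect (A i)) (fun i => z i S))].

Lemma khom_rhoc t j z : 1 <= j -> (forall i, khom t j (z i)) -> khom t j (rhoc z).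
Proof.
move=> j1 hz; apply/khomP; split=> S; rewrite ffunE.
  by apply: rho_hom => // i; rewrite ffunE; have /khomP[] := hz i.
move=> St; rewrite -[RHS](raddf0 rho); congr (rho _).
by apply/ffunP=> i; rewrite !ffunE; have /khomP[_ ->] := hz i.
Qed.

Lemma kd_rhoc t j z : 1 <= j -> (forall i, khom t j (z i)) ->
  kd (rhoc z) = rhoc (fun i => kd (z i)).
Proof.
move=> j1 hz; apply/ffunP=> S; rewrite !ffunE.
transitivity (\sum_(k | k \notin S) rho (ksign K k S *:
  dsum_of (V := fun i => vect (A i)) (fun i => mulX k (z i (k |: S))))).
  apply: eq_bigr => k _; rewrite linearZ ffunE; congr (_ *: _).
  rewrite (rho_xm D _ j1) => [|i]; last by rewrite ffunE; have /khomP[] := hz i.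
  by congr (rho _); apply/ffunP=> i; rewrite !ffunE.
rewrite -linear_sum; congr (rho _); apply/ffunP=> i; rewrite dsum_sumE !ffunE.
by apply: eq_bigr => k _; rewrite !ffunE.
Qed.

Lemma kd_lam i t j v : khom t j v -> j <= e%:Z - 2 ->
  kmap (lam i) (kd v) = kd (kmap (lam i) v).
Proof. by move=> /khomP[hv _] je; apply: kmap_kd => k S; apply: lam_xm je. Qed.

Lemma kmap_rhoc t j z : 1 <= j -> j <= e%:Z - 1 -> (forall i, khom t j (z i)) ->
  forall i, kmap (lam i) (rhoc z) = z i.
Proof.
move=> j1 je hz i; apply/ffunP=> S; rewrite !ffunE.
rewrite (lam_rho D j1 je) ?ffunE // => i'; rewrite ffunE.
by have /khomP[] := hz i'.
Qed.

Lemma rhoc_kmap t j v : 1 <= j -> j <= e%:Z - 1 -> khom t j v ->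
  rhoc (fun i => kmap (lam i) v) = v.
Proof.
move=> j1 je /khomP[hv _]; apply/ffunP=> S; rewrite ffunE -[RHS](rho_lam D j1 je) //.
by congr (rho _); apply/ffunP=> i; rewrite !ffunE.
Qed.

Lemma eq_rhoc z z' : (forall i, z i = z' i) -> rhoc z = rhoc z'.
Proof.
by move=> h; apply/ffunP=> S; rewrite !ffunE; congr (rho _); apply/ffunP=> i; rewrite !ffunE h.
Qed.

Lemma khom_lam i t j v : khom t j v -> khom t j (kmap (lam i) v).
Proof. by apply: khom_kmap => x; apply: lam_hom. Qed.

Lemma kcycles_lam i t j v : j <= e%:Z - 2 -> v \in @kcycles K N C t j ->
  kmap (lam i) v \in @kcycles K N (A i) t j.
Proof.
move=> je /kcycleP[hv zv]; apply/kcycleP; split; first exact: khom_lam.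
by rewrite -(kd_lam i hv) // zv raddf0.
Qed.

Lemma rhoc0 : rhoc (fun i => 0) = 0.
Proof.
apply/ffunP=> S; rewrite !ffunE -[RHS](raddf0 rho); congr (rho _).
by apply/ffunP=> i; rewrite !ffunE.
Qed.

Lemma kcycles_rhoc t j z : 1 <= j -> (forall i, z i \in @kcycles K N (A i) t j) ->
  rhoc z \in @kcycles K N C t j.
Proof.
move=> j1 hz; have hz1 i : khom t j (z i) by have /kcycleP[] := hz i.
apply/kcycleP; split; first exact: khom_rhoc.
rewrite (kd_rhoc (t := t) j1) // -[RHS]rhoc0; apply: eq_rhoc => i.
by have /kcycleP[] := hz i.
Qed.

(** Here lam and rho identify the degrees j - 1, j, j + 1 of C with those of the
    sum of the A_i. *)
Lemma KH_middle t j : 2 <= j -> j <= e%:Z - 2 ->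
  isomorphic (KH C t j) (dsum (fun i => KH (A i) t j)).
Proof.
move=> j2 je.
apply: (subquotient_iso (phi := fun v => dsum_of (V := fun i => KH (A i) t j)
  (fun i => cls _ _ (kmap (lam i) v)))).
- move=> c v w Zv Zw; apply/ffunP=> i.
  by rewrite !ffunE linearP cls_lin ?kcycles_lam.
- move=> y.
  pose z' i := s2val (cid2 (cls_surj (y i))).
  have Zz i : z' i \in @kcycles K N (A i) t j by rewrite /z'; case: cid2.
  have ez i : y i = cls _ _ (z' i) by rewrite /z'; case: cid2.
  exists (rhoc z'); first by apply: kcycles_rhoc => //; lia.
  apply/ffunP=> i; rewrite ffunE (kmap_rhoc (t := t) (j := j)) -?ez //; try lia.
  by move=> i'; have /kcycleP[] := Zz i'.
- move=> v Zv; have /kcycleP[hv zv] := Zv; split=> [h|/kboundP[w hw ew]].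
  + have B i : kmap (lam i) v \in @kbound K N (A i) t j.
      apply/(cls_eq0 _ (kcycles_lam i je Zv)).
      by have := congr1 (fun x : dsum _ => x i) h; rewrite !ffunE.
    pose w i := s2val (cid2 (elimT (@kboundP _ _ _ _ _ _) (B i))).
    have hw i : khom t.+1 (j - 1) (w i) by rewrite /w; case: cid2.
    have ew i : kmap (lam i) v = kd (w i) by rewrite /w; case: cid2.
    apply/kboundP; exists (rhoc w); first by apply: khom_rhoc => //; lia.
    rewrite (kd_rhoc (t := t.+1) (j := j - 1)) //; last by lia.
    by rewrite -(eq_rhoc ew) (rhoc_kmap (t := t) (j := j)) //; lia.
  apply/ffunP=> i; rewrite !ffunE; apply/(cls_eq0 _ (kcycles_lam i je Zv)).
  apply/kboundP; exists (kmap (lam i) w); first exact: khom_lam.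
  by rewrite ew; apply: kd_lam hw _; lia.
Qed.

End Amalgam.

(** * The strands of a connected sum *)
Section ConnectedStrands.
Variables (K : fieldType) (N r : nat) (blk : 'I_N -> 'I_r).
Variables (A : 'I_r -> gmod K N) (C : gmod K N) (e : nat).
Hypothesis e3 : (3 <= e)%N.
Variable G : forall i, gorenstein_data (fun k => blk k == i) (A i) e.
Variable D : amalgam C G.
Implicit Types (S T : {set 'I_N}) (x : dsum (fun i => vect (A i))) (y : vect C) (j : int).
Local Notation lam := (lam D).
Local Notation rho := (rho D).

Lemma am_coef_one i k l : blk k = i -> gd_coef (G i) k (lam i (mulX l (am_one D))) = (k == l)%:R.
Proof.
move=> ki; rewrite (lam_xm D _ _ (am_one_hom D)); last by lia.
by rewrite (lam_one D) gd_coef_one // ki.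
Qed.

Lemma KH_00 : (forall y, y \in gm_hom C (-1) -> y = 0) -> isomorphic (KH C 0 0) K^o.
Proof.
move=> Cneg.
apply: (subquotient_iso (phi := fun v : kchain C => am_ev D (v set0))).
- by move=> c v w _ _; rewrite !ffunE linearP.
- move=> c; exists ([ffun S : {set 'I_N} => if S == set0 then c *: am_one D else 0] : kchain C).
    apply/kcycleP; split.
      apply/khomP; split=> S; rewrite ffunE.
        by case: eqP => // _; [apply/homZ/(am_one_hom D) | apply: (rpred0 (gm_hom C 0))].
      by rewrite cards_eq0 => /negPf->.
    by apply: kd_supp0 => S; rewrite cards_eq0 ffunE => /negPf->.
  by rewrite ffunE eqxx linearZ /= am_ev_one [_ *: _]mulr1.
- move=> v /kcycleP[/khomP[hv sv] _]; split=> [v0|/kboundP[w /khomP[hw _] ->]].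
    suff -> : v = 0 by apply: rpred0.
    apply/ffunP=> S; rewrite [RHS]ffunE; have [->|S0] := eqVneq S set0.
      by rewrite (am_evE D (hv set0)) v0 scale0r.
    by apply: sv; rewrite cards_eq0.
  rewrite (_ : kd w = 0) ?ffunE ?raddf0 //; apply/ffunP=> S; rewrite !ffunE big1 // => k _.
  by rewrite (Cneg _ (hw _)) raddf0 scaler0.
Qed.

(** The coefficient of x_k in the boundary at T \ k is the coefficient of e_T up
    to sign, so a cycle vanishes. *)
Lemma KH_linear t : isomorphic (KH C t.+1 0) 'rV[K]_0.
Proof.
apply: KH_eq0 => v /kcycleP[/khomP[hv sv] zv].
suff -> : v = 0 by apply: rpred0.
apply/ffunP=> T; rewrite [RHS]ffunE; have [->|/set0Pn[k kT]] := eqVneq T set0.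
  by apply: sv; rewrite cards0.
have := congr1 (fun v : kchain C => gd_coef (G (blk k)) k (lam (blk k) (v (T :\ k)))) zv.
rewrite !ffunE !raddf0 !linear_sum (bigD1 k) ?setD11 //= big1 => [|l /andP[_ lk]].
  rewrite addr0 setD1K // (am_evE D (hv T)) !linearZ /= am_coef_one // eqxx.
  move=> h; have {}h : ksign K k (T :\ k) * (am_ev D (v T) * 1) = 0 by [].
  rewrite -[am_ev D (v T)]mul1r -(ksign_sq K k (T :\ k)) -mulrA -[X in _ * X]mulr1 -mulrA h.
  by rewrite mulr0 scale0r.
rewrite (am_evE D (hv _)) !linearZ /= am_coef_one // eq_sym (negPf lk).
by rewrite [X in _ *: X]mulr0 [LHS]mulr0.
Qed.


(** In A_i, the boundary of c determines c T for the sets T that meet block i;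
    for the other sets c T does not contribute to it. *)
Lemma bcoord_kd_scalar i c T : hit blk T i ->
  bcoord blk (gd_coef (G i)) i (kd (scalar_chain (gd_one (G i)) c)) T = c T.
Proof.
apply: bcoordE => k S ki; rewrite ffunE linear_sum /=.
have term l : l \notin S -> gd_coef (G i) k (ksign K l S *: mulX l (scalar_chain (gd_one (G i)) c (l |: S)))
    = if k == l then ksign K k S * c (k |: S) else 0.
  move=> lS; rewrite ffunE !linearZ /= gd_coef_one ?ki //; case: eqP => [<-|_].
    by rewrite [_ *: 1]mulr1.
  by rewrite scaler0 [LHS]mulr0.
rewrite (eq_bigr _ term) -big_mkcondr; case: ifP => kS.
  by rewrite (big_pred1 k) // => l; rewrite /= eq_sym; case: eqP => [->|]; rewrite ?kS ?andbT ?andbF.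
by rewrite big_pred0 // => l; case: eqP => [<-|]; rewrite ?kS ?andbF.
Qed.

(** A cycle v of C is mapped to the classes of its components and to the
    differences of the coordinates bcoord of the components.  A boundary of C
    comes from one scalar chain, common to all blocks, so its differences
    vanish; conversely, if the components bound and the differences vanish, the
    primitives in the A_i can be chosen to agree, and they glue to a primitive
    in C. *)
Lemma KH_degree1 t : isomorphic (KH C t 1)
  (oplus (dsum (fun i => KH (A i) t 1)) (hit_space K blk t.+1)).
Proof.
pose cA v i T := bcoord blk (gd_coef (G i)) i (kmap (lam i) v) T.
pose T1 : lmodType K := dsum (fun i => KH (A i) t 1).
pose phi (v : kchain C) : oplus T1 (hit_space K blk t.+1) :=
  (dsum_of (V := fun i => KH (A i) t 1) (fun i => cls _ _ (kmap (lam i) v)),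
   hit_diff blk t.+1 (cA v)).
have j1 : (1 : int) <= e%:Z - 2 by lia.
have j1' : (1 : int) <= e%:Z - 1 by lia.
apply: (subquotient_iso (phi := phi)).
- move=> c v w Zv Zw; congr (_, _) => /=.
    apply/ffunP=> i; rewrite !ffunE linearP.
    by rewrite cls_lin //; apply: kcycles_lam.
  rewrite -hit_diff_lin; congr hit_diff; apply/funext=> i; apply/funext=> T.
  by rewrite /cA linearP bcoord_lin.
- move=> [y g].
  pose z i := s2val (cid2 (cls_surj (y i))).
  have Zz i : z i \in @kcycles K N (A i) t 1 by rewrite /z; case: cid2.
  have ez i : y i = cls _ _ (z i) by rewrite /z; case: cid2.
(* adding a boundary to z i makes the coordinate at T any prescribed one without
   changing the class *)
  pose c i T : K := if #|T| == t.+1 then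
    hit_ext g T i - bcoord blk (gd_coef (G i)) i (z i) T else 0.
  pose b i := kd (scalar_chain (gd_one (G i)) (c i)).
  have hc i : khom t.+1 0 (scalar_chain (gd_one (G i)) (c i)).
    by apply: khom_scalar => [|S /negPf]; [apply: gd_one_hom | rewrite /c => ->].
  have Zb i : b i \in @kcycles K N (A i) t 1.
    apply/kcycleP; split; last exact: kd_kd.
    exact: khom_kd (gd_action (G i)) (hc i).
  have Zzb i : z i + b i \in @kcycles K N (A i) t 1 by apply: kcyclesD (Zz i) (Zb i).
  have lamE i : kmap (lam i) (rhoc D (fun i => z i + b i)) = z i + b i.
    by apply: (kmap_rhoc D (t := t) (j := 1)) => // i'; have /kcycleP[] := Zzb i'.
  exists (rhoc D (fun i => z i + b i)); first exact: kcycles_rhoc.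
  congr (_, _) => /=.
    apply/ffunP=> i; rewrite ffunE lamE ez.
    rewrite (clsD _ (Zz i) (Zb i)) -[RHS]addr0; congr (_ + _).
    by apply/(cls_eq0 _ (Zb i))/kboundP; exists (scalar_chain (gd_one (G i)) (c i)).
  apply: hit_diff_surj => T i Tt Ti; rewrite /cA lamE.
  rewrite -[z i]scale1r bcoord_lin mul1r bcoord_kd_scalar // /c Tt eqxx.
  by rewrite addrC subrK.
- move=> v Zv; have /kcycleP[hv zv] := Zv; split=> [[h hg]|/kboundP[w hw ew]].
  + have B i : kmap (lam i) v \in @kbound K N (A i) t 1.
      apply/(cls_eq0 _ (kcycles_lam D i j1 Zv)).
      by have := congr1 (fun x : dsum _ => x i) h; rewrite !ffunE.
    pose w i := s2val (cid2 (elimT (@kboundP _ _ _ _ _ _) (B i))).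
    have hw i : khom t.+1 0 (w i) by rewrite /w; case: cid2.
    have ew i : kmap (lam i) v = kd (w i) by rewrite /w; case: cid2.
    pose ci i S := gd_ev (G i) (w i S).
    have wE i : w i = scalar_chain (gd_one (G i)) (ci i).
      by apply/ffunP=> S; rewrite ffunE; apply: gd_ev_one; have /khomP[] := hw i.
    have ciE i T : hit blk T i -> cA v i T = ci i T.
      by move=> Ti; rewrite /cA ew {1}wE bcoord_kd_scalar.
(* a primitive common to all blocks; at T it is read off in the first block that
   T meets *)
    pose c T := \sum_(i | is_min (hit blk T) i) ci i T.
    have cE i T : hit blk T i -> ci i T = c T.
      move=> Ti; have [j Tj] := is_min_exists Ti.
      have [Tt|Tt] := eqVneq #|T| t.+1.
        have [hj _] := andP Tj.
        by rewrite /c (sum_is_min _ Tj) -!ciE //; apply: hit_diff_eq0 hg _ _ _ Tt Ti Tj.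
      have z0 i' : ci i' T = 0 by have /khomP[_ sw] := hw i'; rewrite /ci sw ?raddf0.
      by rewrite z0 /c big1.
    apply/kboundP; exists (scalar_chain (am_one D) c).
      apply: khom_scalar => [|S St]; first exact: am_one_hom.
      by apply: big1 => i _; have /khomP[_ sw] := hw i; rewrite /ci sw ?raddf0.
    have hs : khom t 1 (kd (scalar_chain (am_one D) c)).
      apply: (@khom_kd _ _ _ _ 0); first exact: amalgam_action D.
      apply: khom_scalar => [|S St]; first exact: am_one_hom.
      by apply: big1 => i _; have /khomP[_ sw] := hw i; rewrite /ci sw ?raddf0.
    rewrite -(rhoc_kmap D (t := t) (j := 1) _ _ hv) //.
    rewrite -[RHS](rhoc_kmap D (t := t) (j := 1) _ _ hs) //.
    apply: eq_rhoc => i; rewrite ew wE kmap_kd => [|k S]; last first.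
      rewrite ffunE (lam_xm D _ _ (j := 0)) //; last by lia.
      exact/homZ/(am_one_hom D).
    apply/ffunP=> S; rewrite !ffunE; apply: eq_bigr => k kS.
    rewrite !ffunE !linearZ /= (lam_one D).
    have [ki|ki] := boolP (blk k == i); last by rewrite !(gd_kill (G i)) ?scaler0.
    by rewrite cE //; apply/hitP; exists k; rewrite ?setU11 //; apply/eqP.
  have lamv i : kmap (lam i) v = kd (kmap (lam i) w).
    by rewrite ew (kd_lam D _ (t := t.+1) (j := 0)) //; lia.
  congr (_, _) => /=.
    apply/ffunP=> i; rewrite !ffunE; apply/(cls_eq0 _ (kcycles_lam D i j1 Zv)).
    by apply/kboundP; exists (kmap (lam i) w); first exact: khom_lam.
  apply: eq0_hit_diff => T i j Ti Tj; rewrite /cA !lamv.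
  have wE i' : kmap (lam i') w = scalar_chain (gd_one (G i')) (fun S => am_ev D (w S)).
    apply/ffunP=> S; have /khomP[hw' _] := hw.
    by rewrite !ffunE {1}(am_evE D (hw' S)) linearZ /= (lam_one D).
  by rewrite !wE !bcoord_kd_scalar.
Qed.


(** S contains block i iff its complement does not meet it: this is how the
    strand e - 1 is reindexed by complements. *)
Lemma full_block S i : [forall l, (blk l == i) ==> (l \in S)] = ~~ hit blk (~: S) i.
Proof.
rewrite /hit negb_exists; apply: eq_forallb => l.
by rewrite negb_and inE negbK implybE orbC.
Qed.

Lemma hit_card T i : hit blk T i -> (0 < #|T|)%N.
Proof. by case/hitP=> l lT _; apply/card_gt0P; exists l. Qed.

Lemma card_setC_ord S : (#|S| + #|~: S| = N)%N.
Proof. by rewrite cardsC card_ord. Qed.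

(** Let u_i be the components of a cycle v of C.  The boundary of u_i is
    c_i tau_i, where the signed sum of the c_i vanishes.  Subtracting from u_i
    the primitive kprim of c_i tau_i gives a cycle of A_i, and v is mapped to
    the classes of these cycles and to the entries of c_i at the complements of
    the sets, for the blocks other than the first one met; the remaining entry
    is determined by the signed sum. *)
Lemma KH_degree_pred t : isomorphic (KH C t (e%:Z - 1))
  (oplus (dsum (fun i => KH (A i) t (e%:Z - 1))) (hit_space K blk (N.+1 - t)%N)).
Proof.
set j := e%:Z - 1.
have j1 : 1 <= j by rewrite /j; lia.
have je : j <= e%:Z - 1 by [].
have j2 : 1 <= j - 1 by rewrite /j; lia.
have je2 : j - 1 <= e%:Z - 2 by rewrite /j; lia.
have jE : j + 1 = e%:Z by rewrite /j; lia.
pose c v i S := gd_top (G i) (kd (kmap (lam i) v) S).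
pose prim i (ci : {set 'I_N} -> K) : kchain (A i) :=
  kprim (fun k => blk k == i) (gd_dual (G i)) ci.
pose z v i := kmap (lam i) v - prim i (c v i).
have c_lin a v w i S : c (a *: v + w) i S = a * c v i S + c w i S.
  by rewrite /c kmap_lin kd_lin !ffunE linearP.
have prim_hom ci i : (forall S, #|S|.+1 != t -> ci S = 0) -> khom t j (prim i ci).
  by apply: kprim_hom => k hk; apply: (gd_dual_hom (G i) hk).
have kd_prim ci i S : kd (prim i ci) S = if hit blk (~: S) i then ci S *: gd_tau (G i) else 0.
  rewrite (kd_kprim _ (gd_dualE (G i))) full_block.
  by case: (hit _ _ _).
have kdE i (u : kchain (A i)) S : khom t j u -> kd u S = gd_top (G i) (kd u S) *: gd_tau (G i).
  case/khomP=> hu _; apply: gd_topE; rewrite ffunE -jE; apply: hom_sum => k _.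
  by apply/homZ/mulX_hom => //; apply: gd_action (G i).
have kd_nohit i (u : kchain (A i)) S : ~~ hit blk (~: S) i -> kd u S = 0.
  rewrite -full_block => /forallP full; rewrite ffunE big1 // => k kS.
  rewrite (gd_kill (G i)) ?scaler0 //.
  by apply: contra kS => ki; apply: (implyP (full k)).
have c_supp v i S : khom t j v -> #|S|.+1 != t -> c v i S = 0.
  move=> /khomP[_ sv] St; rewrite /c ffunE big1 ?raddf0 // => k kS.
  by rewrite ffunE sv ?raddf0 ?scaler0 // cardsU1 kS.
have c_nohit v i S : ~~ hit blk (~: S) i -> c v i S = 0.
  by move=> h; rewrite /c kd_nohit ?raddf0.
have z_cycle v : khom t j v -> forall i, z v i \in @kcycles K N (A i) t j.
  move=> hv i; apply/kcycleP; split.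
    have [_ hl] := khom_submod (A i) t j.
    rewrite /z addrC -scaleN1r; apply: (hl (-1)); last exact: khom_lam.
    by apply: prim_hom => S; apply: c_supp.
  rewrite /z raddfB /=; apply/ffunP=> S; rewrite [LHS]ffunE [X in _ + X]ffunE kd_prim [RHS]ffunE.
  case: ifPn => [_|h]; last by rewrite kd_nohit // subrr.
  by rewrite [X in X - _](kdE _ _ _ (khom_lam D i hv)) subrr.
have c_sum v S : khom t j v -> am_top D (kd v S) = \sum_i am_sign D i * c v i S.
  move=> hv; rewrite -{1}(rhoc_kmap D j1 je hv) (kd_rhoc D (t := t) j1); last first.
    by move=> i; apply: khom_lam.
  rewrite ffunE am_top_rho => [|i]; first by apply: eq_bigr => i _; rewrite ffunE.
  rewrite ffunE (kdE _ _ _ (khom_lam D i hv)); apply/homZ/gd_tau_hom.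
pose phi (v : kchain C) : oplus (dsum (fun i => KH (A i) t j)) (hit_space K blk (N.+1 - t)%N) :=
  (dsum_of (V := fun i => KH (A i) t j) (fun i => cls _ _ (z v i)),
   [ffun x => c v (val x).2 (~: (val x).1)]).
apply: (subquotient_iso (phi := phi)).
- move=> a v w Zv Zw; have /kcycleP[hv _] := Zv; have /kcycleP[hw _] := Zw.
  congr (_, _) => /=; apply/ffunP=> x; last by rewrite !ffunE c_lin.
  rewrite !ffunE -cls_lin ?z_cycle //; congr cls.
  have -> : z (a *: v + w) x = kmap (lam x) (a *: v + w)
      - (a *: prim x (c v x) + prim x (c w x)).
    by rewrite /z /prim -kprim_lin; congr (_ - kprim _ _ _); apply/funext=> S; apply: c_lin.
  by rewrite kmap_lin /z scalerBr opprD addrACA.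
- move=> [y g].
  pose z0 i := s2val (cid2 (cls_surj (y i))).
  have Zz i : z0 i \in @kcycles K N (A i) t j by rewrite /z0; case: cid2.
  have ez i : y i = cls _ _ (z0 i) by rewrite /z0; case: cid2.
  pose rest T := \sum_i am_sign D i * hit_ext g T i.
(* the entries for the blocks other than the first are prescribed by g; that of
   the first one is what makes the signed sum 0 *)
  pose c0 i S := if is_min (hit blk (~: S)) i then - (am_sign D i * rest (~: S))
                 else hit_ext g (~: S) i.
  have ext_supp T i : #|~: T|.+1 != t -> hit_ext g T i = 0.
    move=> h; apply: hit_ext_eq0; apply: contra h => /and3P[/eqP Tt /hit_card T0 _].
    by have hc := card_setC_ord T; apply/eqP; lia.
  have c0_supp i S : #|S|.+1 != t -> c0 i S = 0.
    rewrite -[in #|S|](setCK S) => h; rewrite /c0 /rest.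
    by case: ifP => _; rewrite ?big1 ?ext_supp ?mulr0 ?oppr0 // => i' _; rewrite ext_supp ?mulr0.
  have c0_nohit i S : ~~ hit blk (~: S) i -> c0 i S = 0.
    move=> h; rewrite /c0 ifN; last by apply: contra h => /andP[].
    by apply: hit_ext_eq0; rewrite (negPf h) andbF.
  have c0_sum S : \sum_i am_sign D i * c0 i S = 0.
    have [i0 hi0|none] := pickP (hit blk (~: S)); last first.
      by rewrite big1 // => i _; rewrite c0_nohit ?mulr0 ?none.
    have [i1 mi1] := is_min_exists hi0.
    have others i : i != i1 -> c0 i S = hit_ext g (~: S) i.
      by move=> ne; rewrite /c0 ifN //; apply: contra ne => mi; apply/eqP; apply: is_min_uniq mi mi1.
    rewrite (bigD1 i1) //= {1}/c0 mi1 mulrN mulrA am_sign_sq mul1r /rest.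
    rewrite [X in - X](bigD1 i1) //= [hit_ext _ _ i1]hit_ext_eq0 ?mi1 ?andbF // mulr0 add0r.
    rewrite addrC; apply/eqP; rewrite subr_eq0; apply/eqP; apply: eq_bigr => i ne.
    by rewrite others.
  pose u i := z0 i + prim i (c0 i).
  have hprim i : khom t j (prim i (c0 i)) by apply: prim_hom => S; apply: c0_supp.
  have hz0 i : khom t j (z0 i) by have /kcycleP[] := Zz i.
  have hu i : khom t j (u i).
    have [_ hl] := khom_submod (A i) t j.
    by rewrite /u -[z0 i]scale1r; apply: (hl 1 _ _ (hz0 i) (hprim i)).
  have lamE i : kmap (lam i) (rhoc D u) = u i by apply: (kmap_rhoc D (t := t) j1 je hu).
  have kdu i S : kd (u i) S = c0 i S *: gd_tau (G i).
    have /kcycleP[_ zz] := Zz i.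
    rewrite /u raddfD /= zz add0r kd_prim; case: ifPn => // h.
    by rewrite c0_nohit // scale0r.
  have cE i S : c (rhoc D u) i S = c0 i S.
    by rewrite /c lamE kdu linearZ /= gd_top_tau [_ *: _]mulr1.
  have hru : khom t j (rhoc D u) by apply: khom_rhoc.
  exists (rhoc D u).
    apply/kcycleP; split=> //; apply/ffunP=> S; rewrite [RHS]ffunE.
    apply: (am_top_inj (a := D)).
      rewrite -jE ffunE; apply: hom_sum => k _; apply/homZ/mulX_hom.
        exact: amalgam_action D.
      by have /khomP[] := hru.
    rewrite c_sum // -[RHS](c0_sum S).
    by apply: eq_bigr => i _; rewrite cE.
  congr (_, _) => /=; apply/ffunP=> x.
    rewrite ffunE ez /z lamE (_ : prim x (c _ x) = prim x (c0 x)) ?addrK //.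
    by congr kprim; apply/funext=> S; apply: cE.
  rewrite ffunE cE /c0 setCK ifN ?hit_ext_val //.
  by have /and3P[] := valP x.
- move=> v Zv; have /kcycleP[hv zv] := Zv; split=> [[h hg]|/kboundP[w hw ew]].
(* the signed sum of c v is 0 as v is a cycle, so no entry is left *)
  + have c0 i S : c v i S = 0.
      have [St|/c_supp->//] := eqVneq #|S|.+1 t.
      have nonmin i' : ~~ is_min (hit blk (~: S)) i' -> c v i' S = 0.
        move=> nm; have [hi|/c_nohit//] := boolP (hit blk (~: S) i').
        have hx : [&& #|(~: S, i').1| == (N.+1 - t)%N, hit blk (~: S, i').1 (~: S, i').2
                    & ~~ is_min (hit blk (~: S, i').1) (~: S, i').2].
          rewrite /= hi nm !andbT; by rewrite -St subSS [#|~: S|]cardsCs setCK card_ord.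
        have := congr1 (fun g : {ffun hit_pairs blk (N.+1 - t)%N -> K^o} => g (exist _ (~: S, i') hx)) hg.
        by rewrite !ffunE /= setCK.
      have [mi|/nonmin//] := boolP (is_min (hit blk (~: S)) i).
      have := c_sum v S hv; rewrite zv ffunE raddf0 (bigD1 i) //= big1 => [|i' ne].
        rewrite addr0 => /(congr1 (fun d => am_sign D i * d)).
        by rewrite mulr0 mulrA am_sign_sq mul1r.
      rewrite nonmin ?mulr0 //; apply: contra ne => mi'; apply/eqP; exact: is_min_uniq mi' mi.
    have zE i : z v i = kmap (lam i) v.
      by rewrite /z /prim kprim0 ?subr0.
    have B i : kmap (lam i) v \in @kbound K N (A i) t j.
      rewrite -zE; apply/(cls_eq0 _ (z_cycle v hv i)).
      by have := congr1 (fun x : dsum _ => x i) h; rewrite !ffunE.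
    pose w i := s2val (cid2 (elimT (@kboundP _ _ _ _ _ _) (B i))).
    have hw i : khom t.+1 (j - 1) (w i) by rewrite /w; case: cid2.
    have ew i : kmap (lam i) v = kd (w i) by rewrite /w; case: cid2.
    apply/kboundP; exists (rhoc D w); first exact: khom_rhoc.
    by rewrite (kd_rhoc D (t := t.+1) j2) // -(rhoc_kmap D j1 je hv); apply: eq_rhoc.
  have lamv i : kmap (lam i) v = kd (kmap (lam i) w) by rewrite ew (kd_lam D i hw).
  have c0 i S : c v i S = 0 by rewrite /c lamv kd_kd ffunE raddf0.
  congr (_, _) => /=; apply/ffunP=> x; rewrite !ffunE //.
  apply/(cls_eq0 _ (z_cycle v hv x)); rewrite /z /prim kprim0 // subr0 lamv.
  by apply/kboundP; exists (kmap (lam x) w) => //; apply: khom_lam.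
Qed.


Variable i0 : 'I_r.

(** The image in C of any tau_i, up to the sign of block i; i0 only serves to
    pick one of them. *)
Definition top_class : vect C :=
  rho (dsum_of (V := fun i => vect (A i))
    (fun i => if i == i0 then am_sign D i *: gd_tau (G i) else 0)).

(** The signs make these elements dual to all the variables at once, with
    respect to the same top_class. *)
Definition dual_class (l : 'I_N) : vect C :=
  rho (dsum_of (V := fun i => vect (A i))
    (fun i => if i == blk l then am_sign D i *: gd_dual (G i) l else 0)).

Lemma top_class_hom : top_class \in gm_hom C e%:Z.
Proof.
apply: rho_hom => [|i]; first by lia.
rewrite ffunE; case: ifP => _; last exact: (rpred0 (gm_hom (A i) _)).
exact/homZ/gd_tau_hom.
Qed.

Lemma am_top_delta (j : 'I_r) (u : forall i, vect (A i)) c :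
  (forall i, u i = if i == j then (am_sign D i * c) *: gd_tau (G i) else 0) ->
  am_top D (rho (dsum_of (V := fun i => vect (A i)) u)) = c.
Proof.
move=> hu; rewrite am_top_rho => [|i]; last first.
  rewrite ffunE hu; case: ifP => _; last exact: (rpred0 (gm_hom (A i) _)).
  exact/homZ/gd_tau_hom.
rewrite (bigD1 j) //= big1 => [|i /negPf ne]; last by rewrite ffunE hu ne raddf0 mulr0.
rewrite ffunE hu eqxx linearZ /= gd_top_tau addr0 [_ *: _]mulr1.
by rewrite mulrA am_sign_sq mul1r.
Qed.

Lemma am_top_class : am_top D top_class = 1.
Proof.
by apply: (@am_top_delta i0) => i; rewrite mulr1.
Qed.

Lemma dual_class_hom l : dual_class l \in gm_hom C (e%:Z - 1).
Proof.
apply: rho_hom => [|i]; first by lia.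
rewrite ffunE; case: eqP => [->|_]; last exact: (rpred0 (gm_hom (A i) _)).
by apply/homZ/gd_dual_hom.
Qed.

Lemma mulX_dual_class k l : mulX k (dual_class l) = if k == l then top_class else 0.
Proof.
apply/eqP; rewrite -subr_eq0; apply/eqP/(am_top_inj (a := D)).
  apply: (@submod_memB _ _ (gm_hom C e%:Z)).
    have -> : e%:Z = e%:Z - 1 + 1 by lia.
    by apply: mulX_hom (dual_class_hom l); apply: amalgam_action D.
  by case: ifP => _; [apply: top_class_hom | apply: (rpred0 (gm_hom C _))].
rewrite raddfB /= (rho_xm D k (j := e%:Z - 1)); last 2 first.
- by lia.
- move=> i; rewrite ffunE; case: eqP => [->|_]; last exact: (rpred0 (gm_hom (A i) _)).
  by apply/homZ/gd_dual_hom.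
rewrite (@am_top_delta (blk l) _ (k == l)%:R) => [|i].
  by case: (k == l); rewrite /= ?am_top_class ?[am_top D 0]raddf0; apply: subrr.
rewrite ffunE; case: eqP => [->|_]; last by rewrite raddf0.
rewrite linearZ /= gd_dualE //; case: eqP => _; rewrite ?mulr1 ?mulr0 ?scale0r ?scaler0 //.
Qed.

(** The elements dual_class provide a primitive of every e_S top_class with S
    different from the set of all variables. *)
Lemma KH_top_eq0 t : t != N -> isomorphic (KH C t e%:Z) 'rV[K]_0.
Proof.
move=> tN; apply: KH_eq0 => v /kcycleP[/khomP[hv sv] _]; apply/kboundP.
pose c S := am_top D (v S).
exists (kprim predT dual_class c).
  apply: kprim_hom => [l _|S St]; first exact: dual_class_hom.
  by rewrite /c sv ?raddf0 // -eqSS.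
apply/ffunP=> S; rewrite (kd_kprim _ (tau := top_class)) => [|k l _]; last exact: mulX_dual_class.
case: ifPn => [/forallP full|_].
  apply: sv; rewrite (_ : S = setT) ?cardsT ?card_ord 1?eq_sym //.
  by apply/setP=> l; rewrite inE; apply: (implyP (full l)).
apply/eqP; rewrite -subr_eq0; apply/eqP/(am_top_inj (a := D)).
  apply: (@submod_memB _ _ (gm_hom C e%:Z)) => //; apply/homZ/top_class_hom.
by rewrite raddfB /= linearZ /= am_top_class [_ *: _]mulr1; apply: subrr.
Qed.

Lemma KH_top : (forall y, y \in gm_hom C (e%:Z + 1) -> y = 0) ->
  isomorphic (KH C N e%:Z) K^o.
Proof.
move=> Chigh.
apply: (subquotient_iso (phi := fun v : kchain C => am_top D (v setT))).
- by move=> c v w _ _; rewrite !ffunE linearP.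
- move=> c; pose v : kchain C := [ffun S : {set 'I_N} => if S == setT then c *: top_class else 0].
  have hv S : v S \in gm_hom C e%:Z.
    rewrite ffunE; case: eqP => // _; last exact: (rpred0 (gm_hom C _)).
    exact/homZ/top_class_hom.
  exists v; last by rewrite ffunE eqxx linearZ /= am_top_class [_ *: _]mulr1.
  apply/kcycleP; split.
    apply/khomP; split=> // S SN; rewrite ffunE ifN //.
    by apply: contra SN => /eqP->; rewrite cardsT card_ord.
  apply/ffunP=> S; rewrite [RHS]ffunE ffunE big1 // => k _.
  rewrite (Chigh (mulX k _)) ?scaler0 //; apply: mulX_hom => //.
  exact: amalgam_action D.
- move=> v /kcycleP[/khomP[hv sv] _]; split=> [v0|/kboundP[w /khomP[_ sw] ->]].
    suff -> : v = 0 by apply: rpred0.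
    apply/ffunP=> S; rewrite [RHS]ffunE; have [->|ST] := eqVneq S setT.
      exact: (am_top_inj (a := D)).
    apply: sv; apply: contra ST => /eqP SN; rewrite eqEcard subsetT /=.
    by rewrite cardsT card_ord SN leqnn.
  rewrite ffunE big1 ?raddf0 // => k _; rewrite sw ?raddf0 ?scaler0 //.
  rewrite neq_ltn ltnS (leq_trans (max_card _)) ?card_ord //.
Qed.
End ConnectedStrands.

(** * The linear strand of the cross quotient *)
Section CrossStrand.
Variables (K : fieldType) (N r : nat) (blk : 'I_N -> 'I_r) (M : gmod K N).
Implicit Types (S T : {set 'I_N}) (k l : 'I_N).
Hypothesis gM : graded_action M.
Variables (u : vect M) (ev : {linear vect M -> K^o}) (cf : 'I_N -> {linear vect M -> K^o})
  (qf : 'I_N -> 'I_N -> {linear vect M -> K^o}).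
Hypothesis u_hom : u \in gm_hom M 0.
Hypothesis evE : forall y, y \in gm_hom M 0 -> y = ev y *: u.
Hypothesis cf_u : forall k l, cf k (mulX l u) = (k == l)%:R.
Hypothesis cf_inj : forall y, y \in gm_hom M 1 -> (forall k, cf k y = 0) -> y = 0.
Hypothesis cross_u : forall k l, blk k != blk l -> mulX k (mulX l u) = 0.
Hypothesis qfE : forall k l m y, blk k = blk l -> y \in gm_hom M 1 ->
  qf k l (mulX m y) = if m == k then cf l y else if m == l then cf k y else 0.

(** The sum over the blocks of the boundaries of c i, taken with the variables of
    block i only. *)
Let dform (c : 'I_r -> {set 'I_N} -> K) : kchain M :=
  [ffun S : {set 'I_N} => \sum_(k | k \notin S) (ksign K k S * c (blk k) (k |: S)) *: mulX k u].

Lemma cf_dform c k S : cf k (dform c S) = if k \notin S then ksign K k S * c (blk k) (k |: S) else 0.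
Proof.
rewrite ffunE linear_sum /=.
have term l : l \notin S -> cf k ((ksign K l S * c (blk l) (l |: S)) *: mulX l u) =
    if k == l then ksign K k S * c (blk k) (k |: S) else 0.
  move=> lS; rewrite linearZ /= cf_u; case: eqP => [<-|_]; first by rewrite [LHS]mulr1.
  by rewrite [LHS]mulr0.
rewrite (eq_bigr _ term) -big_mkcondr; case: ifP => kS.
  by rewrite (big_pred1 k) // => l; rewrite /= eq_sym; case: eqP => [->|]; rewrite ?kS ?andbT ?andbF.
by rewrite big_pred0 // => l; case: eqP => [<-|]; rewrite ?kS ?andbF.
Qed.

Lemma bcoord_dform c i T : hit blk T i -> bcoord blk cf i (dform c) T = c i T.
Proof. by apply: bcoordE => k S <-; apply: cf_dform. Qed.

(** Within a block the terms cancel as in the square of the Koszul differential;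
    products of variables from different blocks vanish. *)
Lemma dform_cycle c t : (forall i T, #|T| != t.+1 -> c i T = 0) ->
  dform c \in @kcycles K N M t 1.
Proof.
move=> hc; apply/kcycleP; split.
  apply/khomP; split=> S => [|St]; rewrite ffunE.
    by apply: hom_sum => k _; apply: homZ; rewrite -[1]add0r; apply: mulX_hom.
  by rewrite big1 // => k kS; rewrite hc ?mulr0 ?scale0r // cardsU1 kS.
apply/ffunP=> S; rewrite [RHS]ffunE ffunE.
pose F k l : vect M := if [&& k != l, k \notin S, l \notin S & blk l == blk k] then
  (ksign K k S * ksign K l (k |: S)) *: (c (blk l) (l |: (k |: S)) *: mulX k (mulX l u)) else 0.
rewrite -[RHS](@antisym_sum _ _ F) => [|k l|k]; last by rewrite /F eqxx.
  rewrite big_mkcond; apply: eq_bigr => k _ /=.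
  case: ifP => kS; last by rewrite big1 // => l _; rewrite /F kS andbF.
  rewrite ffunE linear_sum scaler_sumr big_mkcond; apply: eq_bigr => l _ /=.
  rewrite /F !inE negb_or eq_sym kS /=; case: (eqVneq k l) => //= kl.
  case: ifP => //= lS; case: eqP => [_|/eqP bl].
    by rewrite linearZ /= !scalerA mulrA.
  by rewrite linearZ /= cross_u ?scaler0 // eq_sym.
have e : [&& l != k, l \notin S, k \notin S & blk k == blk l] =
         [&& k != l, k \notin S, l \notin S & blk l == blk k].
  by rewrite [l == k]eq_sym [blk k == _]eq_sym; case: (k \in S); case: (l \in S); rewrite ?andbF.
rewrite /F e; case: ifP => [/and4P[kl kS lS /eqP->]|_]; last by rewrite oppr0.
by rewrite ksign_anti // scaleNr mulXC setUCA.
Qed.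

(** The coefficients of the squares and products of variables of one block in
    the boundary of v force the coefficient of x_k at S to vanish if k is in S,
    and to depend on k |: S and on the block of k only, up to sign. *)
Lemma cycle_dform v t : v \in @kcycles K N M t 1 -> v = dform (fun i => bcoord blk cf i v).
Proof.
move=> /kcycleP[/khomP[hv sv] zv].
have quad k l S : blk k = blk l -> k \notin S -> l \notin S ->
    ksign K k S * cf l (v (k |: S)) + (if l == k then 0 else ksign K l S * cf k (v (l |: S))) = 0.
  move=> kl kS lS.
  have := congr1 (fun v : kchain M => qf k l (v S)) zv.
  rewrite !ffunE raddf0 linear_sum /= (bigD1 k) //= linearZ /= qfE // eqxx => h.
  rewrite -[RHS]h; congr (_ + _); case: (eqVneq l k) => [lk|lk].
    rewrite big1 // => m /andP[mS mk].
    by rewrite linearZ /= qfE // lk (negPf mk) [LHS]mulr0.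
  rewrite (bigD1 l) ?lS //= linearZ /= qfE // eqxx (negPf lk) big1 ?addr0 //.
  by move=> m /andP[/andP[mS mk] ml]; rewrite linearZ /= qfE // (negPf ml) (negPf mk) [LHS]mulr0.
apply/ffunP=> S; apply/eqP; rewrite -subr_eq0; apply/eqP/cf_inj.
  apply: (@submod_memB _ _ (gm_hom M 1)) => //.
  rewrite ffunE; apply: hom_sum => k _; apply: homZ; rewrite -[1]add0r; exact: mulX_hom.
move=> k; rewrite raddfB /= cf_dform; case: ifPn => [kS|]; last first.
  rewrite negbK => kS; rewrite subr0.
  have := quad k k (S :\ k) erefl; rewrite !setD11 eqxx setD1K // addr0 => /(_ isT isT).
  by move=> /(congr1 (fun d => ksign K k (S :\ k) * d)); rewrite mulr0 mulrA ksign_sq mul1r.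
have hk : (k \in k |: S) && (blk k == blk k) by rewrite setU11 eqxx.
have [m mm] := @is_min_exists _ (fun l => (l \in k |: S) && (blk l == blk k)) _ hk.
rewrite /bcoord (sum_is_min _ mm).
have /andP[/andP[mkS /eqP bm] _] := mm.
have [->|mk] := eqVneq m k; first by rewrite setU1K // mulrA ksign_sq mul1r; apply: subrr.
have mS : m \in S by move: mkS; rewrite !inE (negPf mk).
pose U := S :\ m.
have kU : k \notin U by rewrite !inE negb_and kS orbT.
have mU : m \notin U by rewrite setD11.
have -> : (k |: S) :\ m = k |: U.
  by apply/setP=> i; rewrite !inE; case: (eqVneq i k) => // ->; rewrite eq_sym mk.
have SE : S = m |: U by rewrite setD1K.
have := quad k m U (esym bm) kU mU; rewrite (negPf mk) -SE.
move/(congr1 (fun d => ksign K m U * d)).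
rewrite mulrDr mulr0 [X in _ + X]mulrA ksign_sq mul1r addrC => /eqP.
rewrite addr_eq0 => /eqP->.
have := ksign_anti K mk mU kU; rewrite -SE => h.
have -> : ksign K k S * (ksign K m (k |: U) * cf m (v (k |: U))) =
   (ksign K m U * ksign K m U) * (ksign K k S * (ksign K m (k |: U) * cf m (v (k |: U)))).
  by rewrite ksign_sq mul1r.
rewrite [X in _ - X](_ : _ = - (ksign K m U *
  (ksign K k U * (ksign K m (k |: U) * ksign K m (k |: U)) * cf m (v (k |: U))))).
  by rewrite ksign_sq mulr1; apply: subrr.
transitivity ((ksign K m U * ksign K k S) * (ksign K m U * (ksign K m (k |: U) * cf m (v (k |: U))))).
  by ring.
rewrite h; ring.
Qed.

Lemma KH_cross t : isomorphic (KH M t 1) (hit_space K blk t.+1).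
Proof.
pose cA v i T := bcoord blk cf i v T.
have csupp v t' i T : khom t' 1 v -> #|T| != t'.+1 -> cA v i T = 0.
  by move=> /khomP[_ sv] Tt; apply: bcoord_supp sv Tt.
apply: (subquotient_iso (phi := fun v => hit_diff blk t.+1 (cA v))).
- move=> c v w _ _; rewrite -hit_diff_lin; congr hit_diff.
  by apply/funext=> i; apply/funext=> T; apply: bcoord_lin.
- move=> g; exists (dform (fun i T => hit_ext g T i)).
    by apply: dform_cycle => i T Tt; apply: hit_ext_eq0; rewrite (negPf Tt).
  by apply: hit_diff_surj => T i Tt Ti; rewrite /cA bcoord_dform.
- move=> v Zv; have /kcycleP[hv zv] := Zv; split=> [hg|/kboundP[w /khomP[hw _] ->]].
    pose c T := \sum_(i | is_min (hit blk T) i) cA v i T.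
    have csup T : #|T| != t.+1 -> c T = 0.
      by move=> Tt; rewrite /c big1 // => i _; apply: csupp hv Tt.
    have cE i T : hit blk T i -> cA v i T = c T.
      move=> Ti; have [Tt|Tt] := eqVneq #|T| t.+1; last by rewrite csup // (csupp _ _ _ _ hv Tt).
      have [j Tj] := is_min_exists Ti; rewrite /c (sum_is_min _ Tj).
      exact: hit_diff_eq0 hg _ _ _ Tt Ti Tj.
    apply/kboundP; exists (scalar_chain u c); first exact: khom_scalar.
    rewrite [LHS](cycle_dform Zv); apply/ffunP=> S; rewrite !ffunE; apply: eq_bigr => k kS.
    rewrite ffunE linearZ /= scalerA -(cE (blk k)) //.
    by apply/hitP; exists k; rewrite ?setU11.
  apply: eq0_hit_diff => T i j Ti Tj; rewrite /cA.
  have -> : kd w = dform (fun _ T => ev (w T)).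
    apply/ffunP=> S; rewrite !ffunE; apply: eq_bigr => k kS.
    by rewrite {1}(evE (hw _)) linearZ /= scalerA.
  by rewrite !bcoord_dform.
Qed.
End CrossStrand.

(** * Functionals and gradings on quotients *)
Section Functionals.
Variables (K : fieldType) (n : nat).
Local Notation Q := {mpoly K[n]}.

Section QuotientLift.
Variables (M : gmod K n) (S : submodClosed M) (V : lmodType K) (g : {linear vect M -> V}).
Hypothesis gS : forall x, x \in S -> g x = 0.

Definition quo_lift (x : vect (gquo S)) : V := g (repr (x : quo S)).

Lemma quo_lift_pi (y : M) : quo_lift (\pi_(quo S) y) = g y.
Proof.
apply/eqP; rewrite -subr_eq0 -raddfB; apply/eqP/gS.
by rewrite -pi_eq reprK.
Qed.

Lemma quo_lift_lin : linear quo_lift.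
Proof.
move=> c x y; have [x' ->] := pi_surj x; have [y' ->] := pi_surj y.
have -> : c *: (\pi_(quo S) x' : vect (gquo S)) + \pi_(quo S) y'
    = \pi_(quo S) (c%:MP *: x' + y') by rewrite pi_lin.
by rewrite !quo_lift_pi -linearP.
Qed.

Definition qlift : {linear vect (gquo S) -> V} :=
  HB.pack quo_lift (GRing.isLinear.Build K _ _ _ quo_lift quo_lift_lin).

Lemma qlift_pi (y : M) : qlift (\pi_(quo S) y : quo S) = g y.
Proof. exact: quo_lift_pi. Qed.
End QuotientLift.

Definition gcoef m (p : vect (greg K n)) : K^o := (p : Q)@_m.
Lemma gcoef_lin m : linear (gcoef m).
Proof.
move=> c p q; rewrite /gcoef mcoeffD; congr (_ + _).
by rewrite [_ *: _](mul_mpolyC c) mcoeffZ.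
Qed.
HB.instance Definition _ m := GRing.isLinear.Build K (vect (greg K n)) K^o _ (gcoef m) (gcoef_lin m).

Lemma graded_greg : graded_action (greg K n).
Proof. by move=> d e p x; apply: formM. Qed.

Lemma gquo_homP (M : gmod K n) (S : submodClosed M) d (x : gquo S) :
  reflect (exists2 y : M, y \in gm_hom M d & x = \pi_(quo S) y) (x \in gm_hom (gquo S) d).
Proof. exact: asboolP. Qed.

Lemma graded_gquo (M : gmod K n) (S : submodClosed M) :
  graded_action M -> graded_action (gquo S).
Proof.
move=> gM d e p x hp /gquo_homP[y hy ->]; apply/gquo_homP.
by exists (p *: y); [apply: gM | rewrite -pi_quo_scale].
Qed.

Lemma graded_gsub (M : gmod K n) (S : submodClosed M) :
  graded_action M -> graded_action (gsub S).
Proof. by move=> gM d e p x hp hx; apply: (gM _ _ _ _ hp hx). Qed.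

Lemma graded_gdsum (I : finType) (T : I -> gmod K n) :
  (forall i, graded_action (T i)) -> graded_action (gdsum T).
Proof.
move=> gT d e p x hp /forallP hx; apply/forallP=> i; rewrite ffunE.
exact: gT.
Qed.

End Functionals.

(** A tuple of vectors of W of maximal rank spans everything: otherwise some
    non-zero functional c kills it, and a vector of W not killed by c would
    increase the rank. *)
Lemma separating_subspace (K : fieldType) n (W : {pred 'rV[K]_n}) :
    submod_closed W ->
    (forall c : 'cV_n, (forall w, w \in W -> w *m c = 0) -> c = 0) ->
  forall v, v \in W.
Proof.
move=> [W0 Wlin] sep v.
have Wcomb m (B : 'M_(m, n)) (D : 'rV_m) : (forall i, row i B \in W) -> D *m B \in W.
  move=> hB; rewrite mulmx_sum_row; elim/big_ind: _ => // [x y Wx Wy|i _].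
    by rewrite -[x]scale1r; apply: Wlin.
  by rewrite -[_ *: _]addr0; apply: Wlin.
pose P k := `[< exists m (B : 'M[K]_(m, n)), (forall i, row i B \in W) /\ \rank B = k >].
have P0 : exists k, P k.
  exists 0%N; apply/asboolP; exists 0%N, 0; split=> [[]//|]; exact: mxrank0.
have Pub k : P k -> (k <= n)%N by move=> /asboolP[m [B [_ <-]]]; apply: rank_leq_col.
case: (ex_maxnP P0 Pub) => k /asboolP[m [B [hB rB]]] max.
have [/row_fullP[D DB]|nfull] := boolP (row_full B).
  by rewrite -[v]mulmx1 -DB mulmxA; apply: Wcomb.
suff : False by [].
have : cokermx B != 0.
  apply: contra nfull => /eqP c0; rewrite /row_full eqn_leq rank_leq_col /= -subn_eq0.
  by rewrite -mxrank_coker c0 mxrank0.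
move=> /eqP; apply; apply/matrixP=> i j.
suff /colP/(_ i) : col j (cokermx B) = 0 by rewrite !mxE.
apply: sep => w Ww; apply/eqP; apply: contraT => nz.
have lt : (B < col_mx B w)%MS.
  apply/andP; split; first by rewrite -addsmxE addsmxSl.
  apply: contra nz; rewrite col_mx_sub => /andP[_ /submxP[D ->]].
  by rewrite -mulmxA colE (mulmxA B) mulmx_coker mul0mx mulmx0.
suff /max : P (\rank (col_mx B w)) by rewrite -rB leqNgt (rank_ltmx lt).
apply/asboolP; exists (m + 1)%N, (col_mx B w); split=> // i'.
case: (split_ordP i') => [i1 ->|i1 ->]; first by rewrite rowKu.
by rewrite rowKd (_ : row i1 w = w) //; apply/rowP=> j'; rewrite mxE !ord1.
Qed.

(** * A single Gorenstein algebra *)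
Section LowDegree.
Variables (K : fieldType) (n : nat).
Local Notation R := {mpoly K[n]}.

Lemma mcoeffXM_unit (k l : 'I_n) (p : R) : ('X_k * p)@_U_(l) = (k == l)%:R * p@_0%MM.
Proof.
rewrite mcoeffXM mnm1E eq_sym; case: eqP => [->|_]; last by rewrite mul0r.
by rewrite mul1r; congr (_ @__); apply/mnmP=> i; rewrite mnmBE subnn mnm0E.
Qed.

Lemma irrelevant_const (p : R) : p \in irrelevant K n -> p@_0%MM = 0.
Proof.
move=> hp; apply/eqP.
apply: (span_sub (P := [pred p : R^o | (p : R)@_0%MM == 0]) _ _ hp).
  exact: const_submod.
by move=> _ [k ->]; rewrite inE mcoeffX mnm1_eq0.
Qed.

Lemma mnm_split (m : 'X_{1..n}) : m != 0%MM -> exists k m', m = (U_(k) + m')%MM.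
Proof.
move=> m0; have [k mk] : exists k, (0 < m k)%N.
  apply/existsP; apply: contra_neqT m0; rewrite negb_exists => /forallP h.
  by apply/mnmP=> k; rewrite mnm0E; apply/eqP; rewrite -leqn0 leqNgt h.
exists k, (m - U_(k))%MM.
by rewrite addmC submK //; apply/mnm_lepP=> l; rewrite mnm1E; case: eqP => // <-.
Qed.

(** A product of two elements without constant term has no linear term. *)
Lemma irrelevant2_linear (p : R) k : p \in irrelevant2 K n -> p@_U_(k) = 0.
Proof.
move=> hp; apply/eqP.
have lin0 : forall q u v : R, u@_0%MM = 0 -> v@_0%MM = 0 ->
    (q * u + v)@_U_(k) = q@_0%MM * u@_U_(k) + v@_U_(k).
  move=> q u v u0 v0; rewrite mcoeffD; congr (_ + _).
  elim/mpolyind: q => [|c m q _ _ IH]; first by rewrite mul0r !mcoeff0 mul0r.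
  rewrite mulrDl !mcoeffD mulrDl IH; congr (_ + _).
  rewrite -scalerAl !mcoeffZ -mulrA; congr (_ * _).
  have [->|m0] := eqVneq m 0%MM; first by rewrite mpolyX0 mul1r mcoeff1 eqxx mul1r.
  rewrite mcoeffX (negPf m0) mul0r.
  have [i [m' ->]] := mnm_split m0.
  by rewrite mpolyXD -mulrA mcoeffXM_unit rmorphM /= u0 !mulr0.
suff /andP[_ ->] : (p \in [pred p : R^o | ((p : R)@_0%MM == 0) && ((p : R)@_U_(k) == 0)]) by [].
apply: (span_sub _ _ hp) => [|y [u [v [/irrelevant_const u0 /irrelevant_const v0 ->]]]].
  split=> [|q x y]; first by rewrite inE !mcoeff0 eqxx.
  move=> /andP[/eqP x0 /eqP x1] /andP[/eqP y0 /eqP y1]; apply/andP; split.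
    by rewrite mcoeffD rmorphM /= x0 y0 mulr0 addr0.
  by rewrite lin0 // x1 y1 mulr0 addr0.
apply/andP; split; first by rewrite rmorphM /= u0 mul0r.
by have := lin0 u v 0 v0 (mcoeff0 _ _); rewrite addr0 mcoeff0 addr0 u0 mul0r => ->.
Qed.

Lemma form0_const (p : R) : p \in @Defs.form K n 0 -> p = (p@_0%MM)%:MP.
Proof.
move=> hp; apply/mpolyP=> m; rewrite mcoeffC.
have [->|m0] := eqVneq m 0%MM; first by rewrite mulr1.
rewrite mulr0; apply: (form_mcoeff hp).
by rewrite eqz_nat mdeg_eq0.
Qed.

Lemma form1_eq0 (p : R) : p \in @Defs.form K n 1 -> (forall k, p@_U_(k) = 0) -> p = 0.
Proof.
move=> hp p0; apply/mpolyP=> m; rewrite mcoeff0.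
have [/mdeg1P[i /eqP->]|m1] := boolP (mdeg m == 1%N); first exact: p0.
by apply: (form_mcoeff hp); rewrite eqz_nat.
Qed.

Lemma hcomp_mul_low (q p : R) (m : int) :
  (forall d, d < m -> hcomp d p = 0) -> forall d, d < m -> hcomp d (q * p) = 0.
Proof.
move=> hp d dm; elim/mpolyind: q => [|c mon q _ _ IH]; first by rewrite mul0r raddf0.
rewrite mulrDl raddfD /= IH addr0 -scalerAl linearZ /= mulrC.
have hm : 'X_[mon] \in @Defs.form K n (mdeg mon) by rewrite formE dhomogX.
by rewrite (hcompM _ _ hm) hp ?mul0r ?scaler0 //; lia.
Qed.

End LowDegree.

Section SingleAlgebra.
Variables (K : fieldType) (n : nat).
Local Notation R := {mpoly K[n]}.
Variable a : submodClosed R^o.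
Hypothesis a2 : {subset a <= irrelevant2 K n}.
Hypothesis ah : homogeneous a.
Local Notation A := (gquo (M := greg K n) a).
Local Notation pi := (\pi_(quo (V := R^o) a)).

Lemma algP d (x : A) : reflect (exists2 p : R, p \in @Defs.form K n d & x = pi p) (x \in gm_hom A d).
Proof. exact: asboolP. Qed.

Lemma alg_action : graded_action A.
Proof. exact/graded_gquo/graded_greg. Qed.

Lemma alg_neg d (x : A) : d < 0 -> x \in gm_hom A d -> x = 0.
Proof.
move=> d0 /algP[p hp ->]; case: d d0 hp => // d _; rewrite formE => /eqP->.
exact: raddf0.
Qed.

(** Distinct degrees are independent modulo a homogeneous ideal. *)
Lemma alg_sep d (p q : R) : p \in @Defs.form K n d -> hcomp d q = 0 ->
  pi p = pi q -> pi p = 0.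
Proof.
move=> hp hq epq; apply/eqP; rewrite pi_eq0.
have : p - q \in a.
  by have := pi_eq a (p : R^o) q; rewrite epq eqxx => /esym.
have hpq : hcomp d (p - q) = p by rewrite raddfB /= hq subr0 (hcomp_of_form _ hp) eqxx.
case: d hp hpq {hq} => [d|d] hp hpq; last by rewrite (eqP hp) => _; apply: rpred0.
by move/(@ah _ d); rewrite [X in X \in _]hpq.
Qed.

(** The ideal generated by the monomials of degree at least m, whose powers are
    the descending chain to which the Artinian condition is applied. *)
Definition order_ideal (m : nat) : {pred A} :=
  [pred x | `[< exists2 p : R, forall d : int, d < m -> hcomp d p = 0 & x = pi p >]].

Lemma order_ideal_submod m : submod_closed (order_ideal m).
Proof.
split=> [|q x y]; first by apply/asboolP; exists 0; rewrite ?raddf0 // => d _; rewrite raddf0.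
move=> /asboolP[p hp ->] /asboolP[p' hp' ->]; apply/asboolP; exists (q * p + p').
  by move=> d dm; rewrite raddfD /= (hcomp_mul_low _ hp) // hp' // addr0.
exact: esym (pi_lin a q (p : R^o) p').
Qed.

(** Once the chain of the order ideals is stationary, an element of degree d is
    congruent to one of order greater than d, hence is 0. *)
Lemma alg_nilpotent : artinian A -> exists m : nat, forall d (x : A), m%:Z <= d -> x \in gm_hom A d -> x = 0.
Proof.
move=> art.
pose I m : submodClosed A := HB.pack (order_ideal m)
  (GRing.isSubmodClosed.Build R A (order_ideal m) (order_ideal_submod m)).
have dec k : {subset I k.+1 <= I k}.
  move=> x /asboolP[p hp ->]; apply/asboolP; exists p => // d dk; apply: hp; lia.
have [m stab] := art I dec; exists m => -[d|d] // x md /algP[p hp ->].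
have Ik : pi p \in I d.
  apply/asboolP; exists p => // d' dd'; rewrite (hcomp_of_form _ hp) ifN //; lia.
have Im : {subset I d <= I m}.
  have [k ->] : exists k, d = (m + k)%N by exists (d - m)%N; lia.
  elim: k => [|k IH] y; first by rewrite addn0.
  by rewrite addnS => /dec/IH.
have /(stab d.+1) : (m <= d.+1)%N by lia.
move=> /(_ _ (Im _ Ik)) /asboolP[q hq e].
by apply: (alg_sep hp _ e); apply: hq; lia.
Qed.

Variables (e : nat) (f : {linear vect A -> K^o}) (tau : A).
Hypothesis e1 : (1 <= e)%N.
Hypothesis gor : gorenstein A.
Hypothesis orf : orientation e f.
Hypothesis thom : thom_class e f tau.
Hypothesis low_socle : forall d (x : A), x \in gm_hom A d -> e%:Z < d ->
  (forall k, 'X_k *: x = 0) -> x = 0.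

(** It suffices to test annihilation on the variables. *)
Lemma mem_socle (x : A) : (forall k, 'X_k *: x = 0) -> x \in @socle K n A.
Proof.
move=> hx; apply/asboolP => p hp.
suff /asboolP : p \in [pred p : R^o | `[< (p : R) *: x = 0 >]] by [].
apply: (span_sub _ _ hp) => [|_ [k ->]]; last exact/asboolP.
split=> [|q u v]; first by apply/asboolP; rewrite scale0r.
move=> /asboolP hu /asboolP hv; apply/asboolP.
by rewrite scalerDl -[(q *: u)]/(q * u) -scalerA hu hv scaler0 addr0.
Qed.

Lemma alg_XP d (x : A) k : x \in gm_hom A d -> 'X_k *: x \in gm_hom A (d + 1).
Proof. by move=> hx; rewrite addrC; apply: alg_action hx; apply: form_X. Qed.

(** A non-zero element of degree greater than e can be multiplied by variables as
    long as it is not in the socle; by nilpotence this must end in a non-zero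
    socle element of degree greater than e. *)
Lemma alg_high d (x : A) : e%:Z < d -> x \in gm_hom A d -> x = 0.
Proof.
move=> ed hx; apply/eqP; apply: contraT => nz.
have grow (j : nat) : exists2 y : A, y \in gm_hom A (d + j%:Z) & y != 0.
  elim: j => [|j [y hy ny]]; first by exists x; rewrite ?addr0.
  have [k hk|none] := pickP (fun k => 'X_k *: y != 0).
    by exists ('X_k *: y) => //; rewrite intS [1 + _]addrC addrA; apply: alg_XP.
  case/eqP: ny; apply: (low_socle hy); first by lia.
  by move=> k; apply/eqP/negPn; rewrite none.
have [m hm] := alg_nilpotent gor.1.
have [y hy /eqP[]] := grow m; apply: (hm _ _ _ hy); lia.
Qed.

Lemma f_off d (x : A) : x \in gm_hom A d -> d != e%:Z -> f x = 0.
Proof. by move=> hx hd; apply: (orf.2 d). Qed.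

(** The Thom class lies in the socle, which is a line. *)
Lemma socle_tau (x : A) : (forall k, 'X_k *: x = 0) -> x = f x *: (tau : vect A).
Proof.
move=> hx; have [htau ftau] := thom.
have stau : tau \in @socle K n A.
  by apply: mem_socle => k; apply: (alg_high (d := e%:Z + 1)); [lia|apply: alg_XP].
have sx := mem_socle hx.
have [g [g' gK _]] := gor.2.
pose u : submod (@socle K n A) := exist _ (x : vect A) sx.
pose v : submod (@socle K n A) := exist _ (tau : vect A) stau.
have gv : g v != 0.
  apply/eqP => gv0; have : v = 0 by apply: (can_inj gK); rewrite gv0 raddf0.
  move=> /(congr1 val) /= v0; move: ftau; rewrite [tau]v0 raddf0 => /esym/eqP.
  by rewrite oner_eq0.
have uv : u = (g u / g v) *: v.
  by apply: (can_inj gK); rewrite linearZ /= [_ *: _]mulrVK ?unitfE.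
have xv : x = (g u / g v) *: (tau : vect A) by have := congr1 val uv.
by rewrite {1}xv; congr (_ *: _); rewrite xv linearZ /= ftau [_ *: _]mulr1.
Qed.

Lemma X_tau k : 'X_k *: tau = 0.
Proof. by have [htau _] := thom; apply: (alg_high (d := e%:Z + 1)); [lia|apply: alg_XP]. Qed.

Lemma tau_scale (p : R) : p *: tau = (p@_0%MM)%:MP *: tau.
Proof.
pose good (p : R) := p *: tau = (p@_0%MM)%:MP *: tau.
have goodD (x y : R) : good x -> good y -> good (x + y).
  move=> hx hy; rewrite /good mcoeffD mpolyCD.
  exact: etrans (scalerDl tau x y) (etrans (congr2 +%R hx hy) (esym (scalerDl tau _ _))).
have goodC c : good c%:MP by rewrite /good mcoeffC eqxx mulr1.
elim/mpolyind: p => [|c m p _ _ IH]; first by rewrite -/(good 0) -mpolyC0.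
apply: goodD IH; have [->|m0] := eqVneq m 0%MM.
  have -> : c *: 'X_[0] = c%:MP :> R by rewrite mpolyX0 -mul_mpolyC mulr1.
  exact: goodC.
have [k [m' mE]] := mnm_split m0.
have m0' : (c *: 'X_[m] : R)@_0%MM = 0 by rewrite mcoeffZ mcoeffX (negPf m0) mulr0.
have cE : c *: 'X_[m] = (c *: 'X_[m']) * 'X_k :> R.
  by rewrite mE mpolyXD mulrC scalerAl.
rewrite /good m0' cE -scalerA X_tau scaler0.
by rewrite mpolyC0; symmetry; apply: scale0r.
Qed.

Lemma alg_top (x : A) : x \in gm_hom A e%:Z -> x = f x *: (tau : vect A).
Proof.
by move=> hx; apply: socle_tau => k; apply: (alg_high (d := e%:Z + 1)); [lia|apply: alg_XP].
Qed.

(** The linear form q is non-zero in A, because its ideal is contained in the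
    square of the irrelevant ideal.  A non-zero multiple of q in a degree other
    than e is not in the socle, so some variable multiplies it to a non-zero
    element; in this way a non-zero multiple of q is reached in degree e. *)
Lemma pairing_nondegenerate (c : 'I_n -> K) (l : 'I_n) : c l != 0 ->
  exists2 b : A, b \in gm_hom A (e%:Z - 1) & f ((\sum_k (c k)%:MP * 'X_k) *: b) != 0.
Proof.
move=> cl; set q := \sum_k _.
have hq : q \in @Defs.form K n 1.
  by apply: form_sum => k; apply: (@formM K n 0 1); [apply: form_const | apply: form_X].
have ql : q@_U_(l) = c l.
  rewrite /q raddf_sum (bigD1 l) //= big1 => [|k /negPf kl].
    by rewrite mcoeffCM mcoeffXU eqxx mulr1 addr0.
  by rewrite mcoeffCM mcoeffXU kl mulr0.
have grow (j : nat) : (j < e)%N -> exists2 b : A, b \in gm_hom A j%:Z & q *: b != 0.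
  elim: j => [|j IH] je.
    exists (pi 1); first by apply/algP; exists 1 => //; rewrite formE dhomog1.
    have -> : q *: (pi 1 : A) = pi (q : R^o).
      exact: etrans (pi_quo_scale a q (1 : R^o)) (congr1 _ (mulr1 q)).
    rewrite pi_eq0; apply/negP => /a2 /(irrelevant2_linear l).
    by rewrite ql; apply/eqP.
  have [b hb nb] := IH (ltnW je).
  have hqb : q *: b \in gm_hom A (1 + j%:Z) by apply: alg_action.
  have [k hk|none] := pickP (fun k => 'X_k *: (q *: b) != 0).
    exists ('X_k *: b); last by rewrite scalerA mulrC -scalerA.
    by rewrite intS [1 + _]addrC; apply: alg_XP.
  case/eqP: nb; rewrite (@socle_tau (q *: b)) => [|k]; last by apply/eqP/negPn; rewrite none.
  by rewrite (f_off hqb) ?scale0r //; lia.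
have [|b hb nb] := grow e.-1; first by rewrite prednK.
have bE : e.-1%:Z = e%:Z - 1 by lia.
exists b; first by rewrite -bE.
apply: contra nb => /eqP f0; rewrite (@alg_top (q *: b)) ?f0 ?scale0r //.
have -> : e%:Z = 1 + e.-1%:Z by lia.
exact: alg_action.
Qed.

(** The vectors of values of f on the x_k b, with b of degree e - 1, are
    separated by no linear form, so they include the vectors of the standard
    basis. *)
Lemma dual_exists (l : 'I_n) : exists2 b : A, b \in gm_hom A (e%:Z - 1) &
  forall k, 'X_k *: b = if k == l then tau else 0.
Proof.
pose W : {pred 'rV[K]_n} := [pred w : 'rV_n | `[< exists2 b : A, b \in gm_hom A (e%:Z - 1) &
  w = \row_k (f ('X_k *: b) : K) >]].
have rowlin c (b b' : A) :
    \row_k (f ('X_k *: (c%:MP *: b + b')) : K) =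
    c *: \row_k (f ('X_k *: b) : K) + \row_k (f ('X_k *: b') : K).
  apply/rowP=> k; rewrite !mxE scalerDr scalerA mulrC -scalerA.
  by have := linearP f c ('X_k *: b) ('X_k *: b').
have cW : submod_closed W.
  split=> [|c w w'].
    apply/asboolP; exists 0; first exact: (rpred0 (gm_hom A _)).
    by apply/rowP=> k; rewrite !mxE scaler0 raddf0.
  move=> /asboolP[b hb ->] /asboolP[b' hb' ->]; apply/asboolP.
  by exists (c%:MP *: b + b'); [apply: gm_hom_lin | rewrite rowlin].
have sep (c : 'cV_n) : (forall w, w \in W -> w *m c = 0) -> c = 0.
  move=> hc; apply/colP=> i; rewrite mxE; apply/eqP; apply: contraT => ci.
  have [b hb /eqP[]] := @pairing_nondegenerate (fun k => c k 0) i ci.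
  have /hc/rowP/(_ 0) : \row_k (f ('X_k *: b) : K) \in W by apply/asboolP; exists b.
  rewrite !mxE => h; rewrite -[RHS]h scaler_suml raddf_sum; apply: eq_bigr => k _ /=.
  by rewrite mxE -scalerA [RHS]mulrC; apply: (linearZ_LR f (c k 0) ('X_k *: b : vect A)).
have /asboolP[b hb hw] := @separating_subspace K n W cW sep (delta_mx 0 l).
exists b => // k; have hX : 'X_k *: b \in gm_hom A e%:Z.
  by rewrite -[e%:Z](subrK 1); apply: alg_XP.
rewrite (alg_top hX); have /rowP/(_ k) := hw; rewrite !mxE eqxx /= => <-.
by case: eqP => _; [apply: scale1r | apply: scale0r].
Qed.

End SingleAlgebra.

(** * Inflation to the ring in all variables *)

(** A socle element x gives the cycle x e_[all variables], and there are no
    boundaries in homological degree N. *)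
Lemma KH_socle (K : fieldType) N (M : gmod K N) d (x : vect M) :
  x \in gm_hom M d -> x != 0 -> (forall k, mulX k x = 0) -> exists y : KH M N d, y != 0.
Proof.
move=> hx nx kx; pose v : kchain M := [ffun S => if S == setT then x else 0].
have Zv : v \in @kcycles K N M N d.
  apply/kcycleP; split; last first.
    apply/ffunP=> S; rewrite [RHS]ffunE ffunE big1 // => k _.
    by rewrite ffunE; case: ifP => _; rewrite ?kx ?raddf0 ?scaler0.
  apply/khomP; split=> S; rewrite ffunE.
    by case: ifP => // _; apply: (rpred0 (gm_hom M _)).
  by move=> SN; rewrite ifN //; apply: contra SN => /eqP->; rewrite cardsT card_ord.
exists (cls _ _ v); apply: contra nx => /eqP/(cls_eq0 _ Zv)/kboundP[w /khomP[_ sw] e].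
have := congr1 (fun v : kchain M => v setT) e; rewrite !ffunE eqxx => ->.
by rewrite big1 // => k; rewrite inE.
Qed.

Section Inflation.
Variables (K : fieldType) (r : nat) (n : 'I_r -> nat).
Local Notation N := (\sum_(i < r) n i)%N.
Local Notation Q := {mpoly K[N]}.
Local Notation blk := (fun l : 'I_N => @tagnat.sig1 r n l).

Lemma xvar_inj i : injective (@xvar r n i).
Proof.
move=> k k' e; apply/eqP; rewrite Order.POrderTheory.eq_le.
by rewrite -!(@tagnat.le_Rank r n i) -!/(xvar _) e Order.POrderTheory.lexx.
Qed.

Lemma xvar_blk i k : blk (@xvar r n i k) = i.
Proof. exact: tagnat.Rank1K. Qed.

Lemma blk_xvar i l : blk l = i -> exists k, l = @xvar r n i k.
Proof. by move=> <-; exists (tagnat.sig2 l); rewrite /xvar tagnat.sig2K. Qed.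

Lemma retractX i l : retract i ('X_l : Q) =
  if [pick k | @xvar r n i k == l] is Some k then 'X_k else 0.
Proof. by rewrite /retract comp_mpolyXU -tnth_nth tnth_mktuple. Qed.

Lemma pick_xvar i k : [pick k' | @xvar r n i k' == xvar k] = Some k.
Proof.
case: pickP => [k' /eqP/xvar_inj->//|/(_ k)].
by rewrite eqxx.
Qed.

Lemma retract_xvar i k : retract i ('X_(@xvar r n i k) : Q) = 'X_k.
Proof. by rewrite retractX pick_xvar. Qed.

Lemma retract_off i l : blk l != i -> retract i ('X_l : Q) = 0.
Proof.
rewrite retractX; case: pickP => // k /eqP <-.
by rewrite xvar_blk eqxx.
Qed.

(** Each variable is sent to a variable or to 0, that is, to a form of
    degree 1. *)
Lemma retract_form i d (p : Q) : p \in @Defs.form K N d -> retract i p \in @Defs.form K (n i) d.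
Proof.
move=> hp; rewrite /retract comp_mpolyEX.
have formZ c d' (q : {mpoly K[n i]}) : q \in @Defs.form K (n i) d' -> c *: q \in @Defs.form K (n i) d'.
  by move=> hq; rewrite -mul_mpolyC -[d']add0r; apply: formM => //; apply: form_const.
rewrite big_seq; elim/big_ind: _ => [|x y|m hm]; first exact: form0.
  exact: (@rpredD _ (@Defs.form K (n i) d : submodClosed (vect (greg K (n i))))).
apply: formZ; rewrite comp_mpolyX.
have -> : d = (mdeg m)%:Z.
  apply/eqP; rewrite eq_sym; apply: contraTT hm => md.
  by rewrite mcoeff_msupp (form_mcoeff hp md) eqxx.
rewrite mdegE; elim/big_ind2: _ => [|d1 x d2 y hx hy|l _]; first by rewrite formE dhomog1.
  by rewrite PoszD; apply: formM.
rewrite tnth_mktuple; set q := (if _ is Some _ then _ else _).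
have hq : q \in @Defs.form K (n i) 1.
  by rewrite /q; case: pickP => [k _|_]; [apply: form_X | apply: form0].
elim: (m l) => [|u IH]; first by rewrite expr0 formE dhomog1.
by rewrite exprS intS; apply: formM.
Qed.

Section InflatedModule.
Variables (i : 'I_r) (M : gmod K (n i)).

Lemma graded_inflate : graded_action M -> graded_action (inflate M).
Proof. by move=> gM d e p x hp; apply: gM; apply: retract_form. Qed.

Lemma mulX_inflate k (x : vect (inflate M)) : mulX (@xvar r n i k) x = 'X_k *: (x : M).
Proof. by rewrite -retract_xvar. Qed.

Lemma mulX_inflate0 l (x : vect (inflate M)) : blk l != i -> mulX l x = 0.
Proof.
move=> h; have : retract i ('X_l : Q) *: (x : M) = 0 by rewrite retract_off // scale0r.
by [].
Qed.

(** The scalars of K act on an inflated module through the retraction, which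
    fixes them. *)
Lemma inflate_scale c (x : M) : c *: (x : vect (inflate M)) = c *: (x : vect M).
Proof. by rewrite [LHS]/(retract i c%:MP *: (x : M)) /retract comp_mpolyC. Qed.

Variables (V : lmodType K) (g : {linear vect M -> V}).
Definition inflate_fun (x : vect (inflate M)) : V := g x.
Lemma inflate_fun_lin : linear inflate_fun.
Proof. by move=> c x y; rewrite inflate_scale; apply: (linearP g). Qed.
HB.instance Definition _ := GRing.isLinear.Build K (vect (inflate M)) V _ inflate_fun inflate_fun_lin.
End InflatedModule.

Section Data.
Variables (i : 'I_r) (a : forall i, submodClosed {mpoly K[n i]}^o).
Hypothesis a2 : {subset a i <= irrelevant2 K (n i)}.
Variables (e : nat) (f : {linear vect (alg a i) -> K^o}) (tau : alg a i)
  (F : free_resolution K N).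
Hypothesis e1 : (1 <= e)%N.
Hypothesis ah : homogeneous (a i).
Hypothesis gor : gorenstein (alg a i).
Hypothesis reg : regularity F (algQ a i) e.
Hypothesis orf : orientation e f.
Hypothesis thom : thom_class e f tau.
Local Notation A := (alg a i).
Local Notation AQ := (algQ a i).

Lemma graded_algQ : graded_action AQ.
Proof. exact/graded_inflate/alg_action. Qed.

(** A socle element of degree d > e would give a non-zero class in
    [Tor_N]_(N + d), against the regularity. *)
Lemma low_socle d (x : A) : x \in gm_hom A d -> e%:Z < d -> (forall k, 'X_k *: x = 0) -> x = 0.
Proof.
move=> hx ed kx; apply/eqP; apply: contraT => nx.
have [y ny] : exists y : KH AQ N d, y != 0.
  apply: (@KH_socle _ _ AQ d (x : vect AQ)) => // l.
  have [/blk_xvar[k ->]|li] := eqVneq (blk l) i; last exact: mulX_inflate0.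
  by rewrite mulX_inflate kx.
have := Tor_koszul F N (d + N%:Z) graded_algQ; rewrite addrK => -[g [g' gK g'K]].
have nz : g' y != 0.
  by apply: contra ny => /eqP g0; rewrite -(g'K y) g0 raddf0.
by have := reg.2 N _ _ nz; rewrite addrK; lia.
Qed.

Definition alg_coef0 :=
  qlift (g := gcoef 0%MM) (fun p hp => irrelevant2_const (a2 hp)) : {linear vect A -> K^o}.
Definition alg_coef1 k := qlift (g := gcoef U_(k)%MM)
  (fun p hp => irrelevant2_linear k (a2 hp)) : {linear vect A -> K^o}.

Lemma alg_coef0_pi (p : {mpoly K[n i]}^o) : alg_coef0 (\pi_(quo (a i)) p) = p@_0%MM.
Proof. exact: qlift_pi. Qed.

Lemma alg_coef1_pi k (p : {mpoly K[n i]}^o) : alg_coef1 k (\pi_(quo (a i)) p) = p@_U_(k)%MM.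
Proof. exact: qlift_pi. Qed.

Lemma alg_coef0_off d (x : A) : x \in gm_hom A d -> d != 0 -> alg_coef0 x = 0.
Proof.
move=> /algP[p hp ->] d0; rewrite alg_coef0_pi.
by apply: (form_mcoeff hp); rewrite mdeg0 eq_sym.
Qed.

Definition algQ_coef (l : 'I_N) : {linear vect AQ -> K^o} :=
  if [pick k | @xvar r n i k == l] is Some k then inflate_fun (alg_coef1 k) else \0.

Definition alg_dual k : A := s2val (cid2 (dual_exists a2 ah e1 gor orf thom low_socle k)).
Definition algQ_dual (l : 'I_N) : vect AQ :=
  if [pick k | @xvar r n i k == l] is Some k then alg_dual k else 0.

Lemma piZ c : \pi_(quo (a i)) (c%:MP : {mpoly K[n i]}^o) = c *: (\pi_(quo (a i)) 1 : vect A).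
Proof.
symmetry; apply: etrans (pi_quo_scale (a i) c%:MP (1 : {mpoly K[n i]}^o)) (congr1 _ (mulr1 _)).
Qed.

Definition algQ_data : gorenstein_data (fun l => blk l == i) AQ e.
Proof.
refine (@GorensteinData K N _ AQ e graded_algQ (\pi_(quo (a i)) 1 : alg a i)
  (inflate_fun alg_coef0) algQ_coef (inflate_fun f) tau algQ_dual _ _ _ _ _ _ _ _ _ _ _ _ _ _ _).
- exact: mulX_inflate0.
- by apply/algP; exists 1 => //; apply: (form_const (n i) 1).
- move=> x /algP[p /form0_const hp ->]; rewrite inflate_scale /inflate_fun alg_coef0_pi.
  by rewrite {1}hp; exact: piZ.
- move=> l l' /eqP/blk_xvar[k ->]; rewrite /algQ_coef pick_xvar /inflate_fun.
  have [/blk_xvar[k' ->]|li] := eqVneq (blk l') i; last first.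
    rewrite mulX_inflate0 // raddf0 (_ : (_ == _) = false) //.
    by apply/negbTE; apply: contra li => /eqP <-; rewrite xvar_blk.
  have -> : mulX (xvar k') (\pi_(quo (a i)) 1 : vect AQ) = \pi_(quo (a i)) ('X_k' : {mpoly K[n i]}^o).
    rewrite mulX_inflate.
    by apply: etrans (pi_quo_scale (a i) 'X_k' (1 : {mpoly K[n i]}^o)) (congr1 _ (mulr1 _)).
  by rewrite alg_coef1_pi mcoeffXU (inj_eq (@xvar_inj i)) eq_sym.
- exact: thom.1.
- exact: thom.2.
- by move=> x hx; rewrite inflate_scale; apply: (alg_top ah e1 gor thom low_socle).
- move=> l /eqP/blk_xvar[k ->]; rewrite /algQ_dual pick_xvar /alg_dual.
  by case: cid2.
- move=> l l' /eqP/blk_xvar[k ->]; rewrite /algQ_dual pick_xvar /alg_dual.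
  case: cid2 => b hb /= bE.
  have [/blk_xvar[k' ->]|li] := eqVneq (blk l) i.
    by rewrite mulX_inflate bE (inj_eq (@xvar_inj i)).
  rewrite mulX_inflate0 // ifN //; apply: contra li => /eqP->.
  by rewrite xvar_blk.
- by rewrite /inflate_fun alg_coef0_pi mcoeff1 eqxx.
- exact: alg_coef0_off.
- exact: (f_off orf).
- move=> q; have := tau_scale ah e1 gor thom low_socle (retract i q).
  by rewrite retract_const -[(q@_0%MM)%:MP *: (_ : AQ)]/(q@_0%MM *: (tau : vect AQ)) inflate_scale.
- by move=> d x hx d0; apply: (alg_neg d0 hx).
- by move=> d x hx ed; apply: (alg_high ah e1 gor low_socle ed hx).
Defined.
End Data.
End Inflation.

(** * The fiber product and the Thom ideal *)
Lemma sum_only (V : nmodType) (I : finType) (P : pred I) (j : I) (F : I -> V) :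
  P j -> (forall i, P i -> i != j -> F i = 0) -> \sum_(i | P i) F i = F j.
Proof. by move=> Pj F0; rewrite (bigD1 j) //= big1 ?addr0 // => i /andP[]; apply: F0. Qed.

Lemma sum_only2 (V : nmodType) (I : finType) (j k : I) (F : I -> V) :
  j != k -> (forall i, i != j -> i != k -> F i = 0) -> \sum_i F i = F j + F k.
Proof.
move=> jk F0; rewrite (bigD1 j) //=; congr (_ + _).
by apply: sum_only => [|i ij ik]; [rewrite eq_sym | apply: F0].
Qed.

Lemma submod_sum (R : pzRingType) (V : lmodType R) (Z : submodClosed V) (I : finType)
  (P : pred I) (F : I -> V) : (forall i, P i -> F i \in Z) -> \sum_(i | P i) F i \in Z.
Proof. by move=> h; elim/big_ind: _ => // [|x y]; [apply: rpred0 | apply: rpredD]. Qed.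

Section ConnectedSum.
Variables (K : fieldType) (r : nat) (n : 'I_r -> nat).
Local Notation N := (\sum_(i < r) n i)%N.
Local Notation Q := {mpoly K[N]}.
Local Notation blk := (fun l : 'I_N => @tagnat.sig1 r n l).
Variables (a : forall i, submodClosed {mpoly K[n i]}^o)
  (a2 : forall i, {subset a i <= irrelevant2 K (n i)})
  (tau : forall i, alg a i) (e : nat).
Local Notation A i := (algQ a i).
Variable G : forall i, gorenstein_data (fun l => blk l == i) (A i) e.
Hypothesis Gtau : forall i, gd_tau (G i) = tau i.
Hypothesis Gproj : forall i (x : alg a i), gd_ev (G i) x = proj x.
Hypothesis r2 : (2 <= r)%N.
Hypothesis e3 : (3 <= e)%N.
Local Notation P := (fiber_product a2).
Local Notation C := (connected_sum a2 tau).
Local Notation ev i := (gd_ev (G i)).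
Local Notation top i := (gd_top (G i)).

Definition component i (x : vect P) : vect (A i) := (val x : gdsum (algQ a)) i.

Lemma component_linQ i (q : Q) (x y : P) :
  component i (q *: x + y) = q *: (component i x : A i) + component i y.
Proof. by rewrite /component linearP !ffunE. Qed.

Lemma component_Z i (q : Q) (x : P) : component i (q *: x) = q *: (component i x : A i).
Proof. by rewrite /component linearZ ffunE. Qed.

Lemma component_lin i : linear (component i).
Proof. by move=> c x y; apply: component_linQ. Qed.
HB.instance Definition _ i := GRing.isLinear.Build K (vect P) (vect (A i)) _
  (component i) (component_lin i).

Lemma component_inj (x y : P) : (forall i, component i x = component i y) -> x = y.
Proof. by move=> h; apply/val_inj/ffunP=> i; apply: h. Qed.

Lemma component_hom i d (x : P) : x \in gm_hom P d -> component i x \in gm_hom (A i) d.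
Proof. by move=> /forallP/(_ i). Qed.

Lemma hom_component d (x : P) : (forall i, component i x \in gm_hom (A i) d) -> x \in gm_hom P d.
Proof. by move=> h; apply/forallP. Qed.

(** The condition that defines the fiber product. *)
Lemma component_ev i j (x : P) : ev i (component i x) = ev j (component j x).
Proof.
have /forallP/(_ i)/forallP/(_ j)/eqP := valP x.
by rewrite -!Gproj.
Qed.

Lemma fiber_intro (u : forall i, vect (A i)) : (forall i j, ev i (u i) = ev j (u j)) ->
  exists x : P, forall i, component i x = u i.
Proof.
move=> h; pose v : gdsum (algQ a) := [ffun i => u i].
have hv : v \in fiber a2.
  apply/forallP=> i; apply/forallP=> j; rewrite !ffunE.
  by apply/eqP; rewrite -!Gproj; apply: h.
by exists (exist _ v hv) => i; rewrite /component /= ffunE.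
Qed.

(** The Thom classes are glued by tau_0 + tau_i = 0, so the functional on the sum
    of the lines K tau_i that vanishes on the relations has these signs. *)
Definition eps (i : 'I_r) : K := if val i == 0%N then 1 else -1.

Lemma sum_eps (t : 'I_r -> K) (j : 'I_r) : val j == 0%N ->
  t j - \sum_(i < r | (0 < i)%N) t i = \sum_i eps i * t i.
Proof.
move=> j0; rewrite [RHS](bigD1 j) //= {1}/eps j0 mul1r -sumrN; congr (_ + _).
apply: eq_big => i; last by move=> i0; rewrite /eps [val i == _]eqn0Ngt i0 mulN1r.
by rewrite -val_eqE (eqP j0) lt0n.
Qed.

Definition P_top (x : vect P) : K^o := \sum_i eps i * top i (component i x).
Lemma P_top_lin : linear P_top.
Proof.
move=> c x y; rewrite /P_top scaler_sumr -big_split; apply: eq_bigr => i _ /=.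
rewrite component_lin (linearP (top i)) mulrDr; congr (_ + _).
by apply: (mulrCA (eps i) c (top i (component i x))).
Qed.
HB.instance Definition _ := GRing.isLinear.Build K (vect P) K^o _ P_top P_top_lin.

(** Removing the multiple of the Thom class makes the i-th component well
    defined on the connected sum; in degrees other than e it changes nothing. *)
Definition P_lam i (x : vect P) : vect (A i) :=
  component i x - top i (component i x) *: gd_tau (G i).
Lemma P_lam_lin i : linear (P_lam i).
Proof.
move=> c x y; rewrite /P_lam component_lin (linearP (top i)) scalerDl opprD addrACA; congr (_ + _).
by rewrite scalerBr scalerA.
Qed.
HB.instance Definition _ i := GRing.isLinear.Build K (vect P) (vect (A i)) _
  (P_lam i) (P_lam_lin i).

(** A polynomial acts on the Thom classes through its constant term, so the ideal
    is the K-span of its generators. *)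
Lemma thom_idealE (x : P) : x \in @thom_ideal K r n a a2 tau ->
  (forall i, component i x = top i (component i x) *: gd_tau (G i)) /\ P_top x = 0.
Proof.
move=> hx.
have tops i (q : Q) (t : K) : q *: (t *: gd_tau (G i) : A i) = (q@_0%MM * t) *: gd_tau (G i).
  apply: etrans (scalerA q t%:MP (gd_tau (G i) : A i)) _; rewrite mulrC.
  apply: etrans (esym (scalerA t%:MP q (gd_tau (G i) : A i))) _; rewrite gd_tau_scale.
  apply: etrans (scalerA t%:MP (q@_0%MM)%:MP (gd_tau (G i) : A i)) _.
  by rewrite -mpolyCM mulrC.
pose U : {pred P} := [pred x |
  [forall i, component i x == top i (component i x) *: gd_tau (G i)] && (P_top x == 0)].
suff /andP[/forallP h /eqP h'] : x \in U by split=> // i; apply/eqP.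
apply: (span_sub _ _ hx) => [|y [i i0 ey]].
  split=> [|q y z].
    by rewrite inE raddf0 eqxx andbT; apply/forallP=> i; rewrite !raddf0 scale0r.
  move=> /andP[/forallP hy /eqP ty] /andP[/forallP hz /eqP tz].
  have cE i : component i (q *: y + z) =
      (q@_0%MM * top i (component i y) + top i (component i z)) *: gd_tau (G i).
    by rewrite component_linQ {1}(eqP (hy i)) {1}(eqP (hz i)) tops scalerDl.
  have tE i : top i (component i (q *: y + z)) = q@_0%MM * top i (component i y) + top i (component i z).
    by rewrite cE linearZ /= gd_top_tau [_ *: _]mulr1.
  apply/andP; split; first by apply/forallP=> i; rewrite tE cE.
  have -> : P_top (q *: y + z) = q@_0%MM * P_top y + P_top z.
    by rewrite /P_top mulr_sumr -big_split; apply: eq_bigr => i _; rewrite tE mulrDr mulrCA.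
  by rewrite ty tz mulr0 addr0.
have cE j : component j y = if (val j == 0%N) || (j == i) then gd_tau (G j) else 0.
  by rewrite /component ey ffunE Gtau.
apply/andP; split.
  apply/forallP=> j; rewrite cE; case: ifP => _; last by rewrite raddf0 scale0r.
  by rewrite gd_top_tau scale1r.
have r0 : (0 < r)%N by apply: ltnW.
have ne : i != Ordinal r0 by rewrite -val_eqE /= -lt0n.
pose w j : K := eps j * top j (component j y).
have -> : P_top y = w (Ordinal r0) + w i.
  apply: sum_only2 => [|j j0 ji]; first by rewrite eq_sym.
  by rewrite cE (negPf ji) orbF ifN ?raddf0 ?mulr0.
rewrite /w !cE /= eqxx orbT !gd_top_tau /eps /= ifN; last by rewrite -lt0n.
by rewrite !mulr1 subrr.
Qed.

(** The family (t_i tau_i) with t_0 equal to the sum of the other t_i is the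
    combination with coefficients t_i, i > 0, of the generators. *)
Lemma mem_thom_ideal (x : P) :
  (forall i, component i x = top i (component i x) *: gd_tau (G i)) -> P_top x = 0 ->
  x \in @thom_ideal K r n a a2 tau.
Proof.
move=> hx tx.
have pairs (i : 'I_r) : exists p : P, (0 < i)%N -> p \in @thom_ideal K r n a a2 tau /\
    forall j, component j p = if (val j == 0%N) || (j == i) then gd_tau (G j) else 0.
  have [|p hp] := @fiber_intro (fun j => if (val j == 0%N) || (j == i) then gd_tau (G j) else 0).
    have z j : ev j (if (val j == 0%N) || (j == i) then gd_tau (G j) else 0) = 0.
      case: ifP => _; last exact: raddf0.
      by apply: (@gd_ev_off _ _ _ _ _ (G j) e%:Z _ (gd_tau_hom (G j))); lia.
    by move=> j j'; rewrite !z.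
  exists p => i0; split=> //; apply: mem_span; exists i => //.
  by apply/ffunP=> j; rewrite ffunE -Gtau; apply: hp.
have {pairs} /boolp.choice[p hp] := pairs.
pose t i := top i (component i x).
suff -> : x = \sum_(i < r | (0 < i)%N) (t i)%:MP *: p i.
  apply: (@submod_sum _ P (@thom_ideal K r n a a2 tau)) => i i0.
  by apply: (@rpredZ _ _ (@thom_ideal K r n a a2 tau : submodClosed P)); have [] := hp i i0.
apply: component_inj => j.
have cs : component j (\sum_(i < r | (0 < i)%N) (t i)%:MP *: p i) =
    \sum_(i < r | (0 < i)%N) t i *: component j (p i).
  rewrite -[LHS]/(component j (\sum_(i < r | (0 < i)%N) t i *: (p i : vect P))).
  by rewrite linear_sum; apply: eq_bigr => i _; rewrite linearZ.
rewrite cs hx -/(t j); have [j0|j0] := posnP j; last first.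
  apply: esym; apply: etrans (@sum_only _ _ (fun i : 'I_r => (0 < i)%N) j _ j0 _) _ => [i i0 ij|].
    have [_ ->] := hp i i0; rewrite [val j == _]eqn0Ngt j0 [j == i]eq_sym (negPf ij).
    exact: scaler0.
  by have [_ ->] := hp j j0; rewrite eqxx orbT.
have jv : val j == 0%N by apply/eqP.
have sE : \sum_(i < r | (0 < i)%N) t i *: component j (p i) =
    (\sum_(i < r | (0 < i)%N) t i) *: gd_tau (G j).
  rewrite scaler_suml; apply: eq_bigr => i i0.
  by have [_ ->] := hp i i0; rewrite jv.
apply: esym; apply: etrans sE _; apply: esym.
congr (_ *: _); apply/eqP; rewrite -subr_eq0.
suff -> : t j - \sum_(i < r | (0 < i)%N) t i = P_top x by rewrite tx.
exact: (sum_eps t jv).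
Qed.
End ConnectedSum.

(** * The connected sum as an amalgam *)
Section ConnectedAmalgam.
Variables (K : fieldType) (r : nat) (n : 'I_r -> nat).
Local Notation N := (\sum_(i < r) n i)%N.
Local Notation Q := {mpoly K[N]}.
Local Notation blk := (fun l : 'I_N => @tagnat.sig1 r n l).
Variables (a : forall i, submodClosed {mpoly K[n i]}^o)
  (a2 : forall i, {subset a i <= irrelevant2 K (n i)})
  (tau : forall i, alg a i) (e : nat).
Local Notation A i := (algQ a i).
Variable G : forall i, gorenstein_data (fun l => blk l == i) (A i) e.
Hypothesis Gtau : forall i, gd_tau (G i) = tau i.
Hypothesis Gproj : forall i (x : alg a i), gd_ev (G i) x = proj x.
Hypothesis r2 : (2 <= r)%N.
Hypothesis e3 : (3 <= e)%N.
Local Notation P := (fiber_product a2).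
Local Notation C := (connected_sum a2 tau).
Local Notation ev i := (gd_ev (G i)).
Local Notation top i := (gd_top (G i)).
Local Notation component := (@component K r n a a2).
Local Notation T := (@thom_ideal K r n a a2 tau).
Local Notation piC := (\pi_(quo T)).

Lemma P_lam_thom i (x : P) : x \in T -> P_lam G i x = 0.
Proof. by move=> /(thom_idealE Gtau r2)[h _]; rewrite /P_lam {1}h subrr. Qed.

Lemma P_top_thom (x : P) : x \in T -> P_top G x = 0.
Proof. by move=> /(thom_idealE Gtau r2)[]. Qed.

Let i0 : 'I_r := Ordinal (ltnW r2).
Let P_ev : {linear vect P -> K^o} := (ev i0 : {linear _ -> _}) \o component i0.

Lemma P_ev_thom (x : P) : x \in T -> P_ev x = 0.
Proof.
move=> /(thom_idealE Gtau r2)[h _].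
rewrite -[P_ev x]/(ev i0 (component i0 x)) h linearZ /=.
rewrite (@gd_ev_off _ _ _ _ _ (G i0) e%:Z _ (gd_tau_hom (G i0))); last by lia.
exact: scaler0.
Qed.

Definition C_lam i : {linear vect C -> vect (A i)} := qlift (@P_lam_thom i).
Definition C_top : {linear vect C -> K^o} := qlift P_top_thom.
Definition C_ev : {linear vect C -> K^o} := qlift P_ev_thom.

Lemma C_lam_pi i (x : P) : C_lam i (piC x) = P_lam G i x.
Proof. exact: qlift_pi. Qed.
Lemma C_top_pi (x : P) : C_top (piC x) = P_top G x.
Proof. exact: qlift_pi. Qed.
Lemma C_ev_pi (x : P) : C_ev (piC x) = ev i0 (component i0 x).
Proof. exact: qlift_pi. Qed.

Lemma C_homP d (y : C) : reflect (exists2 x : P, x \in gm_hom P d & y = piC x) (y \in gm_hom C d).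
Proof. exact: asboolP. Qed.

Lemma piC_hom d (x : P) : x \in gm_hom P d -> piC x \in gm_hom C d.
Proof. by move=> hx; apply/C_homP; exists x. Qed.

Lemma piC_Z (q : Q) (x : P) : q *: (piC x : C) = piC (q *: x).
Proof. exact: pi_quo_scale. Qed.

Lemma P_lam_off i d (x : P) : x \in gm_hom P d -> d != e%:Z -> P_lam G i x = component i x.
Proof.
move=> hx de; rewrite /P_lam (gd_top_off (G i) (component_hom i hx) de).
by rewrite scale0r subr0.
Qed.

Local Notation DS := (dsum (fun i => vect (A i)) : lmodType K).

(** Removing the constant terms moves any family into the fiber product; it
    changes nothing in positive degrees. *)
Definition reduced (x : DS) i : vect (A i) := x i - ev i (x i) *: gd_one (G i).

Lemma ev_reduced x i : ev i (reduced x i) = 0.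
Proof. by rewrite /reduced raddfB /= linearZ /= gd_ev_gd_one [_ *: _]mulr1 subrr. Qed.

Lemma reduced_exists (x : DS) : exists y : P, forall i, component i y = reduced x i.
Proof. by apply: (fiber_intro a2 Gproj) => i j; rewrite !ev_reduced. Qed.

Definition to_fiber (x : DS) : P := sval (cid (reduced_exists x)).

Lemma component_to_fiber x i : component i (to_fiber x) = reduced x i.
Proof. by rewrite /to_fiber; case: cid. Qed.

Definition C_rho_fun (x : DS) : vect C := piC (to_fiber x).
Lemma C_rho_lin : linear C_rho_fun.
Proof.
move=> c x y.
rewrite /C_rho_fun; have -> : to_fiber (c *: x + y) = c%:MP *: to_fiber x + to_fiber y.
  apply: component_inj => i; rewrite component_to_fiber.
  apply: etrans _ (esym (component_linQ i c%:MP (to_fiber x) (to_fiber y))).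
  have redE : reduced (c *: x + y) i = c *: reduced x i + reduced y i.
    by rewrite /reduced !ffunE linearP scalerDl opprD addrACA scalerBr scalerA.
  apply: etrans redE _.
  exact: (congr2 (fun u v : vect (A i) => c *: u + v)
    (esym (component_to_fiber x i)) (esym (component_to_fiber y i))).
exact: pi_lin.
Qed.
HB.instance Definition _ := GRing.isLinear.Build K DS (vect C) _ C_rho_fun C_rho_lin.
Definition C_rho : {linear DS -> vect C} := C_rho_fun.

Lemma to_fiber_pos d (x : DS) : 1 <= d -> (forall i, x i \in gm_hom (A i) d) ->
  forall i, component i (to_fiber x) = x i.
Proof.
move=> d1 hx i; rewrite component_to_fiber /reduced.
rewrite (gd_ev_off (G i) (hx i)); last by lia.
by rewrite scale0r subr0.
Qed.

Lemma to_fiber_hom d (x : DS) : 1 <= d -> (forall i, x i \in gm_hom (A i) d) ->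
  to_fiber x \in gm_hom P d.
Proof. by move=> d1 hx; apply: hom_component => i; rewrite (to_fiber_pos d1 hx). Qed.

Lemma one_exists : exists y : P, forall i, component i y = gd_one (G i).
Proof. by apply: (fiber_intro a2 Gproj) => i j; rewrite !gd_ev_gd_one. Qed.

Definition P_one : P := sval (cid one_exists).
Lemma component_one i : component i P_one = gd_one (G i).
Proof. by rewrite /P_one; case: cid. Qed.

Lemma P_one_hom : P_one \in gm_hom P 0.
Proof. by apply: hom_component => i; rewrite component_one; apply: gd_one_hom. Qed.

Lemma graded_C : graded_action C.
Proof.
apply: graded_gquo; apply: graded_gsub; apply: graded_gdsum => i.
exact: gd_action (G i).
Qed.

Lemma C_neg d (y : C) : d < 0 -> y \in gm_hom C d -> y = 0.
Proof.
move=> d0 /C_homP[x hx ->]; rewrite (_ : x = 0) ?raddf0 //.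
apply: component_inj => i; rewrite raddf0.
exact: (gd_neg (G i) (component_hom i hx) d0).
Qed.

Lemma C_high d (y : C) : e%:Z < d -> y \in gm_hom C d -> y = 0.
Proof.
move=> d0 /C_homP[x hx ->]; rewrite (_ : x = 0) ?raddf0 //.
apply: component_inj => i; rewrite raddf0.
exact: (gd_high (G i) (component_hom i hx) d0).
Qed.

Lemma C_lam_hom i d y : y \in gm_hom C d -> C_lam i y \in gm_hom (A i) d.
Proof.
move=> /C_homP[x hx ->]; rewrite C_lam_pi.
have [de|de] := eqVneq d e%:Z; last by rewrite (P_lam_off i hx de); apply: component_hom.
rewrite /P_lam; apply: (@submod_memB _ _ (gm_hom (A i) d)); first exact: component_hom.
by apply: homZ; rewrite de; apply: gd_tau_hom.
Qed.

(** The degree is bounded by e - 2 because P_lam alters the elements of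
    degree e. *)
Lemma C_lam_xm i k d y : y \in gm_hom C d -> d <= e%:Z - 2 -> C_lam i (mulX k y) = mulX k (C_lam i y).
Proof.
move=> /C_homP[x hx ->] de.
have hkx : 'X_k *: x \in gm_hom P (d + 1).
  apply: (mulX_hom k _ hx); apply: graded_gsub; apply: graded_gdsum => j.
  exact: gd_action (G j).
have -> : mulX k (piC x : vect C) = piC ('X_k *: x) by apply: piC_Z.
rewrite !C_lam_pi (P_lam_off i hkx) ?(P_lam_off i hx); try lia.
exact: component_Z.
Qed.

Lemma C_rho_hom d (x : DS) : 1 <= d -> (forall i, x i \in gm_hom (A i) d) -> C_rho x \in gm_hom C d.
Proof. by move=> d1 hx; apply: piC_hom; apply: to_fiber_hom. Qed.

Lemma C_rho_xm k d (x : DS) : 1 <= d -> (forall i, x i \in gm_hom (A i) d) ->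
  mulX k (C_rho x) = C_rho (dsum_of (V := fun i => vect (A i)) (fun i => mulX k (x i))).
Proof.
move=> d1 hx; have -> : mulX k (C_rho x) = piC ('X_k *: to_fiber x) by apply: piC_Z.
congr (piC _); apply: component_inj => i.
have hkx j : (dsum_of (V := fun i => vect (A i)) (fun i => mulX k (x i))) j \in gm_hom (A j) (d + 1).
  by rewrite ffunE; apply: (mulX_hom k (gd_action (G j)) (hx j)).
rewrite (to_fiber_pos _ hkx); last by lia.
apply: etrans (component_Z i 'X_k (to_fiber x)) _.
by rewrite (to_fiber_pos d1 hx) ffunE.
Qed.

Lemma C_lam_rho d (x : DS) : 1 <= d -> d <= e%:Z - 1 -> (forall i, x i \in gm_hom (A i) d) ->
  forall i, C_lam i (C_rho x) = x i.
Proof.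
move=> d1 de hx i; rewrite C_lam_pi (P_lam_off i (to_fiber_hom d1 hx)); last by lia.
exact: to_fiber_pos d1 hx i.
Qed.

Lemma C_rho_lam d y : 1 <= d -> d <= e%:Z - 1 -> y \in gm_hom C d ->
  C_rho (dsum_of (V := fun i => vect (A i)) (fun i => C_lam i y)) = y.
Proof.
move=> d1 de /C_homP[x hx ->]; congr (piC _); apply: component_inj => i.
have hl j : (dsum_of (V := fun i => vect (A i)) (fun i => C_lam i (piC x))) j \in gm_hom (A j) d.
  by rewrite ffunE; apply: C_lam_hom; apply: piC_hom.
rewrite (to_fiber_pos d1 hl) ffunE C_lam_pi (P_lam_off i hx) //; lia.
Qed.

Lemma C_evE y : y \in gm_hom C 0 -> y = C_ev y *: (piC P_one : vect C).
Proof.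
move=> /C_homP[x hx ->]; rewrite C_ev_pi.
pose c : K := ev i0 (component i0 x).
transitivity (piC (c%:MP *: P_one)); last exact: esym (piC_Z c%:MP P_one).
congr (piC _); apply: component_inj => i.
apply: etrans _ (esym (component_Z i c%:MP P_one)).
apply: etrans (gd_ev_one (G i) (component_hom i hx)) _.
exact: (congr2 (fun (s : K) (u : vect (A i)) => s *: u)
  (component_ev Gproj i i0 x) (esym (component_one i))).
Qed.

Lemma C_top_rho (x : DS) : (forall i, x i \in gm_hom (A i) e%:Z) ->
  C_top (C_rho x) = \sum_i eps K i * top i (x i).
Proof.
move=> hx; rewrite C_top_pi; apply: eq_bigr => i _.
by rewrite (to_fiber_pos _ hx) //; lia.
Qed.

Lemma C_top_inj y : y \in gm_hom C e%:Z -> C_top y = 0 -> y = 0.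
Proof.
move=> /C_homP[x hx ->]; rewrite C_top_pi => tx.
apply/eqP; rewrite pi_eq0; apply: (mem_thom_ideal Gtau Gproj r2 e3) => // i.
exact: (gd_topE (G i) (component_hom i hx)).
Qed.

Lemma C_lam_one i : C_lam i (piC P_one) = gd_one (G i).
Proof. by rewrite C_lam_pi (P_lam_off i P_one_hom) ?component_one //; lia. Qed.

Lemma C_ev_one : C_ev (piC P_one) = 1.
Proof. by rewrite C_ev_pi component_one gd_ev_gd_one. Qed.

Lemma eps_sq (i : 'I_r) : eps K i * eps K i = 1 :> K.
Proof. by rewrite /eps; case: ifP => _; rewrite ?mulrNN mulr1. Qed.

Definition connected_amalgam : amalgam C G :=
  @Amalgam K N r (fun i => A i) C e (fun i l => blk l == i) G C_lam C_rho graded_C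
   C_lam_hom C_lam_xm C_rho_hom C_rho_xm C_lam_rho C_rho_lam (piC P_one) C_ev
   (piC_hom P_one_hom) C_ev_one C_evE C_lam_one (@eps K r) eps_sq C_top C_top_rho C_top_inj.

End ConnectedAmalgam.

(** * The quotient by the cross ideal *)
Section CrossQuotient.
Variables (K : fieldType) (r : nat) (n : 'I_r -> nat).
Local Notation N := (\sum_(i < r) n i)%N.
Local Notation Q := {mpoly K[N]}.
Local Notation blk := (fun l : 'I_N => @tagnat.sig1 r n l).
Local Notation L := (@cross_ideal K r n).
Local Notation QL := (cross_quotient K n).
Local Notation piL := (\pi_(quo (V := Q^o) L)).

(** The monomials that satisfy cond being closed under division, a multiple of a
    polynomial without such monomials has no such monomial either. *)
Lemma vanishing_submod (cond : 'X_{1..N} -> Prop) :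
  (forall m1 m2, cond (m1 + m2)%MM -> cond m2) ->
  submod_closed ([pred p : Q^o | `[< forall m, cond m -> (p : Q)@_m = 0 >]] : {pred Q^o}).
Proof.
move=> hc; split=> [|q x y]; first by apply/asboolP=> m _; rewrite mcoeff0.
move=> /asboolP hx /asboolP hy; apply/asboolP=> m cm.
rewrite mcoeffD hy // addr0 [_ *: _]/(q * x) mcoeffM big1 // => k /eqP mE.
by rewrite [X in _ * X]hx ?mulr0 //; apply: (hc k.1); rewrite -mE.
Qed.

Lemma xideal_coef i (p : Q) (m : 'X_{1..N}) : p \in @xideal K r n i ->
  (forall k, (0 < m k)%N -> blk k != i) -> p@_m = 0.
Proof.
move=> hp.
have : p \in [pred p : Q^o |
    `[< forall m : 'X_{1..N}, (forall k, (0 < m k)%N -> blk k != i) -> (p : Q)@_m = 0 >]].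
  apply: (span_sub _ _ hp) => [|_ [k ->]].
    apply: vanishing_submod => m1 m2 h k mk; apply: h.
    by rewrite mnmDE addn_gt0 mk orbT.
  apply/asboolP=> m' hm; rewrite mcoeffX; case: eqP => // e.
  by have := hm (xvar k); rewrite -e mnm1E eqxx xvar_blk eqxx => /(_ isT).
by move/asboolP; apply.
Qed.

(** Every monomial of an element of L involves at least two blocks. *)
Lemma cross_coef (p : Q) (m : 'X_{1..N}) : p \in L ->
  (forall k l, (0 < m k)%N -> (0 < m l)%N -> blk k = blk l) -> p@_m = 0.
Proof.
move=> hp.
have : p \in [pred p : Q^o | `[< forall m : 'X_{1..N}, (forall k l, (0 < m k)%N -> (0 < m l)%N ->
    blk k = blk l) -> (p : Q)@_m = 0 >]].
  apply: (span_sub _ _ hp) => [|y [i [j [ij yi yj]]]].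
    apply: vanishing_submod => m1 m2 h k l mk ml; apply: h.
      by rewrite mnmDE addn_gt0 mk orbT.
    by rewrite mnmDE addn_gt0 ml orbT.
  apply/asboolP=> m' hm.
  have [k /andP[mk /eqP ki]|none] := pickP (fun k : 'I_N => (0 < m' k)%N && (blk k == i)).
    by apply: (xideal_coef yj) => l ml; rewrite -(hm k l mk ml) ki.
  by apply: (xideal_coef yi) => k mk; have := none k; rewrite mk /= => ->.
by move/asboolP; apply.
Qed.

Lemma cross0 (p : vect (greg K N)) : p \in L -> gcoef 0%MM p = 0.
Proof. by move=> hp; apply: (cross_coef hp) => k l; rewrite mnm0E. Qed.

Lemma cross1 k (p : vect (greg K N)) : p \in L -> gcoef U_(k)%MM p = 0.
Proof.
move=> hp; apply: (cross_coef hp) => l l'; rewrite !mnm1E.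
by case: eqP => // <-; case: eqP => // <-.
Qed.

Lemma cross2 k l (p : vect (greg K N)) : blk k = blk l -> p \in L -> gcoef (U_(k) + U_(l))%MM p = 0.
Proof.
move=> kl hp; apply: (cross_coef hp) => i j; rewrite !mnmDE !mnm1E.
by case: eqP => [<-|_]; case: eqP => [<-|_] //=; case: eqP => [<-|_] //=; case: eqP => [<-|_] //=.
Qed.

Definition QL_coef0 : {linear vect QL -> K^o} := qlift cross0.
Definition QL_coef1 k : {linear vect QL -> K^o} := qlift (@cross1 k).
(** For variables of different blocks their product is 0 in the quotient, and 0
    is used as the functional. *)
Definition QL_coef2 k l : {linear vect QL -> K^o} :=
  if blk k =P blk l is ReflectT kl then qlift (fun p => @cross2 k l p kl) else \0.

Lemma QL_coef0_pi (p : Q^o) : QL_coef0 (piL p) = (p : Q)@_0%MM.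
Proof. exact: qlift_pi. Qed.
Lemma QL_coef1_pi k (p : Q^o) : QL_coef1 k (piL p) = (p : Q)@_U_(k)%MM.
Proof. exact: qlift_pi. Qed.
Lemma QL_coef2_pi k l (p : Q^o) : blk k = blk l ->
  QL_coef2 k l (piL p) = (p : Q)@_(U_(k) + U_(l))%MM.
Proof. by move=> kl; rewrite /QL_coef2; case: eqP => // kl'; apply: qlift_pi. Qed.

Lemma QL_homP d (y : QL) : reflect (exists2 p : Q, p \in @Defs.form K N d & y = piL p) (y \in gm_hom QL d).
Proof. exact: asboolP. Qed.

Lemma graded_QL : graded_action QL.
Proof. exact/graded_gquo/graded_greg. Qed.

Lemma mulX_piL k (p : Q^o) : mulX k (piL p : vect QL) = piL ('X_k * (p : Q)).
Proof. exact: (pi_quo_scale (V := Q^o) L 'X_k p). Qed.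

Lemma KH_cross_quotient t : isomorphic (KH QL t 1) (hit_space K blk t.+1).
Proof.
apply: (@KH_cross K N r blk QL graded_QL (piL 1) QL_coef0 QL_coef1 QL_coef2).
- by apply/QL_homP; exists 1 => //; apply: (form_const N 1).
- move=> y /QL_homP[p /form0_const hp ->]; rewrite QL_coef0_pi {1}hp.
  symmetry; exact: etrans (pi_quo_scale (V := Q^o) L (p@_0%MM)%:MP (1 : Q^o)) (congr1 _ (mulr1 _)).
- move=> k l; rewrite mulX_piL QL_coef1_pi mulr1 mcoeffXU.
  by rewrite eq_sym.
- move=> y /QL_homP[p hp ->] h; rewrite (form1_eq0 hp) ?raddf0 // => k.
  by rewrite -QL_coef1_pi.
- move=> k l kl; rewrite !mulX_piL; apply/eqP; rewrite pi_eq0 mulr1.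
  have inX (i j : 'I_N) (q : Q) : q * 'X_i \in @xideal K r n (blk i).
    apply: (@rpredZ _ _ (@xideal K r n (blk i) : submodClosed Q^o) q 'X_i).
    by apply: mem_span; exists (tagnat.sig2 i); rewrite /xvar tagnat.sig2K.
  apply: mem_span; exists (blk k), (blk l); split=> //.
    by rewrite mulrC; apply: inX.
  exact: inX.
- move=> k l m y kl /QL_homP[p hp ->]; rewrite mulX_piL QL_coef2_pi // !QL_coef1_pi mcoeffXM mnmDE !mnm1E.
  have [->|mk] := eqVneq m k; first by rewrite /= addmC addmK.
  by have [->|ml] := eqVneq m l; first by rewrite addnC /= addmK.
Qed.
End CrossQuotient.

(** * The Tor formula *)
Section EmptyBasis.
Variables (K : fieldType) (N r : nat) (blk : 'I_N -> 'I_r).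
Lemma hit_space0 (x : hit_space K blk 0) : x = 0.
Proof.
apply/ffunP=> -[[T i] h]; case/and3P: (h) => /= /eqP T0 /hit_card.
by rewrite T0.
Qed.
End EmptyBasis.

Theorem theorem3p15 (K : fieldType) (r : nat) (n : 'I_r -> nat)
  (a : forall i, submodClosed {mpoly K[n i]}^o)
  (a2 : forall i, {subset a i <= irrelevant2 K (n i)})
  (e : nat)
  (f : forall i, {linear vect (alg a i) -> K^o})
  (tau : forall i, alg a i)
  (F : free_resolution K (\sum_(i < r) n i)%N) :
  (2 <= r)%N ->
  (forall i, (1 <= n i)%N) ->
  (forall i, homogeneous (a i)) ->
  (forall i, gorenstein (alg a i)) ->
  (forall i, regularity F (algQ a i) e) ->
  (3 <= e)%N ->
  (forall i, orientation e (f i)) ->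
  (forall i, thom_class e (f i) (tau i)) ->
  let N := (\sum_(i < r) n i)%N in
  let C := connected_sum a2 tau in
  let QL := cross_quotient K n in
  let sumTor (t s : int) : lmodType K := dsum (fun i => Tor F (algQ a i) t s) in
  forall (t : nat) (s : int),
  (s <= t%:Z -> (t, s) <> (0%N, 0) ->
     isomorphic (Tor F C t s) 'rV[K]_0) /\
  ((t, s) = (0%N, 0) -> isomorphic (Tor F C t s) K^o) /\
  (s = t%:Z + 1 ->
     isomorphic (Tor F C t s)
       (oplus (sumTor t (t%:Z + 1)) (Tor F QL t (t%:Z + 1)))) /\
  (t%:Z + 2 <= s -> s <= t%:Z + e%:Z - 2 ->
     isomorphic (Tor F C t s) (sumTor t s)) /\
  (s = t%:Z + e%:Z - 1 ->
     isomorphic (Tor F C t s)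
       (oplus (sumTor t s) (Tor F QL (N%:Z - t%:Z) (N%:Z - t%:Z + 1)))) /\
  ((t, s) = (N, e%:Z + N%:Z) -> isomorphic (Tor F C t s) K^o) /\
  (e%:Z + t%:Z <= s -> (t, s) <> (N, e%:Z + N%:Z) ->
     isomorphic (Tor F C t s) 'rV[K]_0).
Proof.
move=> r2 n1 ah gor reg e3 orf thom N C QL sumTor t s.
have e1 : (1 <= e)%N by apply: leq_trans e3.
pose G i := algQ_data (@a2 i) e1 (@ah i) (gor i) (reg i) (orf i) (thom i).
have Gtau i : gd_tau (G i) = tau i by [].
have Gproj i (x : alg a i) : gd_ev (G i) x = proj x by [].
pose D := connected_amalgam a2 Gtau Gproj r2 e3.
have KC t' s' : isomorphic (Tor F C (Posz t') s') (KH C t' (s' - t'%:Z)).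
  by apply: Tor_koszul; apply: graded_C G.
have KA t' s' : isomorphic (dsum (fun i => KH (algQ a i) t' (s' - t'%:Z))) (sumTor t' s').
  apply: isomorphic_sym; apply: isomorphic_dsum => i; apply: Tor_koszul.
  exact: gd_action (G i).
have KQ t' : isomorphic (hit_space K (fun l => @tagnat.sig1 r n l) t'.+1) (Tor F QL (Posz t') (t'%:Z + 1)).
  apply: isomorphic_sym; apply: isomorphic_trans (Tor_koszul _ _ _ (@graded_QL K r n)) _.
  have -> : t'%:Z + 1 - t'%:Z = 1 by lia.
  exact: KH_cross_quotient.
have i0 : 'I_r := Ordinal (ltnW r2).
split; [|split; [|split; [|split; [|split; [|split]]]]].
- move=> st ne; apply: isomorphic_trans (KC t s) _.
  have [st0|st0] := eqVneq (s - t%:Z) 0; last first.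
    apply: KH_degree0 => y hy; apply: (C_neg G _ hy). lia.
  rewrite st0; case: t st ne st0 => [|t] st ne st0; last exact: (KH_linear e3 D).
  by case: ne; congr (_, _); lia.
- move=> [t0 s0]; apply: isomorphic_trans (KC t s) _; rewrite t0 s0 subr0.
  by apply: (KH_00 D) => y; exact: (C_neg G).
- move=> s1; apply: isomorphic_trans (KC t s) _.
  have -> : s - t%:Z = 1 by lia.
  apply: isomorphic_trans (KH_degree1 e3 D t) _; apply: isomorphic_oplus (KQ t).
  have tE : t%:Z + 1 - t%:Z = 1 by lia.
  by have := KA t (t%:Z + 1); rewrite tE.
- move=> s2 se; apply: isomorphic_trans (KC t s) _.
  apply: isomorphic_trans (KA t s).
  by apply: (KH_middle e3 D); lia.
- move=> se; apply: isomorphic_trans (KC t s) _.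
  have KAs := KA t s; have sE : s - t%:Z = e%:Z - 1 by lia.
  rewrite sE in KAs *.
  apply: isomorphic_trans (KH_degree_pred e3 D t) _; apply: isomorphic_oplus KAs _.
  have [tN|Nt] := leqP t N.
    have -> : N%:Z - t%:Z = (N - t)%N by rewrite -subzn.
    by rewrite subSn //; apply: KQ.
(* N - t is negative: Tor vanishes, and so does hit_space, as the empty set meets
   no block *)
  have -> : (N.+1 - t)%N = 0%N by lia.
  have -> : N%:Z - t%:Z = Negz (t - N).-1 by lia.
  by apply: isomorphic_zero => [x|x]; [apply: hit_space0 | apply: thinmx0].
- move=> [tN sN]; apply: isomorphic_trans (KC t s) _; rewrite tN sN addrK.
  by apply: (KH_top e3 D i0) => y hy; apply: (C_high G _ hy); lia.
- move=> se ne; apply: isomorphic_trans (KC t s) _.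
  have [st0|st0] := eqVneq (s - t%:Z) e%:Z; last first.
    by apply: KH_degree0 => y hy; apply: (C_high G _ hy); lia.
  rewrite st0; apply: (KH_top_eq0 e3 D i0); apply/eqP => tN.
  by apply: ne; rewrite /N tN; congr (_, _); rewrite -tN; lia.
Qed.
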